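(* Let $\lambda>\frac{n-1}{2}$, $1<s<\infty$, $0<p\le s$ and $n\left(\frac{p}{s}-1\right)\le\alpha<n(p-1)$. Then the maximal Bochner-Riesz operator $B_*^\lambda$ is of type $(BL^{p,s}_{|x|^\alpha},BL^{p,s}_{|x|^\alpha})$ on $\mathbf{R}^n$; that is, there is a constant $C$ such that $\|B_*^\lambda f\|_{BL^{p,s}_{|x|^\alpha}}\le C\|f\|_{BL^{p,s}_{|x|^\alpha}}$ for all $f\in BL^{p,s}_{|x|^\alpha}$.
   Context: Bochner-Riesz means: for $\lambda\ge0$ and $0<R<\infty$, $(B_R^\lambda f)^\wedge(\xi)=(1-|\xi/R|^2)^\lambda_+\hat f(\xi)$, i.e. $B_R^\lambda f=f*K_R^\lambda$, where $K_R^\lambda$ is the inverse Fourier transform of $(1-|\xi/R|^2)_+^\lambda$ on $\mathbf{R}^n$; the maximal operator is $B_*^\lambda f(x)=\sup_{R>0}|B_R^\lambda f(x)|$. Blocks: for $\alpha\in\mathbf{R}$, $0<p<\infty$, $0<s\le\infty$, a function $a$ on $\mathbf{R}^n$ is a $(p,s,\alpha)$-block if there is a ball $B(x_0,r)=\{x:|x-x_0|\le r\}$ with $x_0\in\mathbf{R}^n$, $r>0$, such that $\operatorname{supp}a\subseteq B(x_0,r)$ and $\|a\|_{L^s}\le|B(x_0,r)|^{-\frac{\alpha}{pn}-\frac1p+\frac1s}$ ($|\cdot|$ is Lebesgue measure). Let $\bar p=\min\{p,1\}$. The space $BL^{p,s}_{|x|^\alpha}$ consists of all $f=\sum_{k}\lambda_ka_k$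 (countable sum, convergence a.e.), where each $a_k$ is a $(p,s,\alpha)$-block and $\sum_k|\lambda_k|^{\bar p}<\infty$, with quasinorm $\|f\|_{BL^{p,s}_{|x|^\alpha}}=\inf\left(\sum_k|\lambda_k|^{\bar p}\right)^{1/\bar p}$, the infimum over all such decompositions. *)

(* Defs.v *)
From HB Require Import structures.
From mathcomp Require Import all_boot all_order all_algebra.
From mathcomp Require Import complex.
From mathcomp Require Import all_classical all_reals all_analysis.

Set Implicit Arguments.
Unset Strict Implicit.
Unset Printing Implicit Defensive.

Import Order.TTheory GRing.Theory Num.Theory.
Import numFieldNormedType.Exports.

Local Open Scope classical_set_scope.
Local Open Scope ring_scope.
Local Open Scope complex_scope.

(* R^n with its product (= Borel) sigma-algebra; the coordinates are
   [tnth x i]. *)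
Notation Rn R n := (n.-tuple (measurableTypeR R)).

(* Lebesgue measure on R^n is obtained by iterating the library's product
   measure, transported along the identification R x R^n = R^(n+1). *)

Section lebesgueRn_step.
Context {R : realType} (n : nat).

Definition tcons (p : measurableTypeR R * Rn R n) : Rn R n.+1 :=
  [tuple of p.1 :: p.2].

Lemma measurable_tcons : measurable_fun [set: measurableTypeR R * Rn R n] tcons.
Proof. exact: measurable_cons. Qed.

Definition tuncons (t : Rn R n.+1) : measurableTypeR R * Rn R n :=
  (tnth t ord0, [tuple of behead t]).

Lemma tconsK : cancel tcons tuncons.
Proof. by case=> x t; congr pair; exact/val_inj. Qed.

Lemma measurable_tuncons : measurable_fun [set: Rn R n.+1] tuncons.
Proof.
apply/measurable_fun_pairP; split.
  exact: (measurable_tnth ord0).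
exact: measurable_behead.
Qed.

Variable m : {sigma_finite_measure set (Rn R n) -> \bar R}.

Definition lebesgueRnS : set (Rn R n.+1) -> \bar R :=
  pushforward (lebesgue_measure \x m)%E tcons.

Let lebesgueRnS0 : lebesgueRnS set0 = 0%E.
Proof. by rewrite /lebesgueRnS /pushforward preimage_set0 measure0. Qed.

Let lebesgueRnS_ge0 A : (0 <= lebesgueRnS A)%E.
Proof. by rewrite /lebesgueRnS /pushforward measure_ge0. Qed.

Let lebesgueRnS_sigma_additive : semi_sigma_additive lebesgueRnS.
Proof.
move=> F mF tF mUF; rewrite /lebesgueRnS /pushforward preimage_bigcup.
apply: measure_semi_sigma_additive.
- by move=> k; rewrite -[X in measurable X]setTI; exact: measurable_tcons.
- apply/trivIsetP => /= i j _ _ ij; rewrite -preimage_setI.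
  by move/trivIsetP : tF => /(_ _ _ _ _ ij) ->//; rewrite preimage_set0.
- rewrite -preimage_bigcup -[X in measurable X]setTI.
  exact: measurable_tcons.
Qed.

HB.instance Definition _ := isMeasure.Build _ _ _ lebesgueRnS
  lebesgueRnS0 lebesgueRnS_ge0 lebesgueRnS_sigma_additive.

Let lebesgueRnS_sigma_finite : sigma_finite setT lebesgueRnS.
Proof.
have /sigma_finiteP[F [TF ndF Foo]] :=
  sigma_finiteT (lebesgue_measure :
    {sigma_finite_measure set (measurableTypeR R) -> \bar R}).
have /sigma_finiteP[G [TG ndG Goo]] := sigma_finiteT m.
exists (fun k => tuncons @^-1` (F k `*` G k)).
  rewrite -preimage_bigcup (_ : \bigcup_k _ = setT) ?preimage_setT//.
  apply/seteqP; split=> // -[x t] _.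
  have [i _ Fix] : (\bigcup_i F i) x by rewrite -TF.
  have [j _ Gjt] : (\bigcup_j G j) t by rewrite -TG.
  exists (maxn i j) => //; split.
    by move: x Fix; exact/subsetPset/ndF/leq_maxl.
  by move: t Gjt; exact/subsetPset/ndG/leq_maxr.
move=> k; have [mF Fk] := Foo k; have [mG Gk] := Goo k; split.
  rewrite -[X in measurable X]setTI; apply: measurable_tuncons => //.
  exact: measurableX.
rewrite /lebesgueRnS /pushforward -comp_preimage.
rewrite (_ : tuncons \o tcons = id); last first.
  by apply/funext => p; exact: tconsK.
by rewrite product_measure1E// lte_mul_pinfty// ge0_fin_numE.
Qed.

HB.instance Definition _ := Measure_isSigmaFinite.Build _ _ _
  lebesgueRnS lebesgueRnS_sigma_finite.

End lebesgueRn_step.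

Fixpoint lebesgueRn (R : realType) (n : nat) :
    {sigma_finite_measure set (Rn R n) -> \bar R} :=
  match n with
  | 0 => \d_([tuple] : Rn R 0)
  | n'.+1 => lebesgueRnS (lebesgueRn R n')
  end.

Lemma lebesgueRn_box (R : realType) (n : nat) (A : 'I_n -> set R) :
  (forall i, measurable (A i : set (measurableTypeR R))) ->
  lebesgueRn R n [set x | forall i, A i (tnth x i)] =
  (\prod_(i < n) lebesgue_measure (A i))%E.
Proof.
elim: n A => [|n ih] A mA.
  rewrite big_ord0 /= diracE mem_set//; by case.
rewrite big_ord_recl -ih//= /lebesgueRnS /pushforward.
rewrite -product_measure1E//; last first.
  rewrite (_ : mkset _ = \bigcap_(i in [set: 'I_n])
      ((fun x : Rn R n => tnth x i) @^-1` A (lift ord0 i))).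
    apply: fin_bigcap_measurable => // i _.
    by rewrite -[X in measurable X]setTI; exact: measurable_tnth.
  by apply/seteqP; split=> [x xA i _|x xA i]; exact: xA.
congr ((_ \x _)%E _); apply/seteqP; split=> -[x t] /=.
  move=> xA; split; first exact: (xA ord0).
  by move=> i; have := xA (lift ord0 i); rewrite tnthS.
by move=> [xA tA] i; have [j|] := unliftP ord0 i => -> //; rewrite tnthS.
Qed.

Section bochner_riesz.
Context {R : realType} {n : nat}.
Implicit Types (x y xi : Rn R n) (f g : Rn R n -> R[i]) (lam rho : R).

Definition dotp x y : R := \sum_(i < n) tnth x i * tnth y i.

Definition enorm x : R := Num.sqrt (dotp x x).

Definition tsub x y : Rn R n := [tuple (tnth x i - tnth y i) | i < n].

Definition tscale (c : R) x : Rn R n := [tuple (c * tnth x i) | i < n].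

Definition cball (x0 : Rn R n) (r : R) : set (Rn R n) :=
  [set x | enorm (tsub x x0) <= r].

Definition cmeasurable f : Prop :=
  measurable_fun setT (fun x => complex.Re (f x)) /\
  measurable_fun setT (fun x => complex.Im (f x)).

Definition cintegral f : R[i] :=
  (\int[lebesgueRn R n]_x complex.Re (f x)) +i*
  (\int[lebesgueRn R n]_x complex.Im (f x)).

Definition expi (t : R) : R[i] := cos t +i* sin t.

(* Normalisation: \hat f(xi) = \int f(x) exp(-2 i pi x.xi) dx, so that the
   inverse transform carries no multiplicative constant. *)
Definition inv_fourier g x : R[i] :=
  cintegral (fun xi => g xi * expi (2 * pi * dotp x xi)).

Definition convolution f g x : R[i] :=
  cintegral (fun y => f y * g (tsub x y)).

(* t_+^lam; the case distinction matters for lam = 0, where [0 `^ 0 = 1]. *)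
Definition pos_powR (t lam : R) : R := if 0 < t then t `^ lam else 0.

Definition br_multiplier lam rho xi : R[i] :=
  (pos_powR (1 - enorm (tscale rho^-1 xi) ^+ 2) lam)%:C.

Definition br_kernel lam rho : Rn R n -> R[i] :=
  inv_fourier (br_multiplier lam rho).

Definition br_mean lam rho f : Rn R n -> R[i] :=
  convolution f (br_kernel lam rho).

Definition br_maximal lam f x : \bar R :=
  ereal_sup [set (Normc.normc (br_mean lam rho f x))%:E | rho in `]0, +oo[].

End bochner_riesz.

Section block_space.
Context {R : realType} {n : nat}.
Implicit Types (f a : Rn R n -> R[i]) (p s alpha : R).

Local Notation mu := (lebesgueRn R n).

(* [cball x0 r] is closed, so that the closure of {a <> 0} is contained in it
   iff {a <> 0} is.  Only finite exponents s are covered. *)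
Definition is_block p s alpha a : Prop :=
  cmeasurable a /\
  exists (x0 : Rn R n) (r : R),
    [/\ 0 < r,
        forall x, a x != 0 -> cball x0 r x
      & (Lnorm mu s%:E (fun x => (Normc.normc (a x))%:E) <=
         mu (cball x0 r) `^ (- (alpha / (p * n%:R)) - p^-1 + s^-1)%R)%E].

Definition pbar p : R := Num.min p 1.

Definition block_coef_sum p (c : nat -> R[i]) : \bar R :=
  (\sum_(0 <= k <oo) (Normc.normc (c k) `^ pbar p)%R%:E)%E.

(* The family is indexed by nat; finite sums are obtained with c k = 0 from
   some rank on (the zero function being a block). *)
Definition block_decomposition p s alpha f
    (c : nat -> R[i]) (b : nat -> Rn R n -> R[i]) : Prop :=
  [/\ forall k, is_block p s alpha (b k),
      (block_coef_sum p c < +oo)%E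
    & {ae mu, forall x,
        Normc.normc (\sum_(0 <= k < N) c k * b k x - f x) @[N --> \oo]
          --> (0 : R)}].

Definition in_BL p s alpha f : Prop :=
  exists (c : nat -> R[i]) (b : nat -> Rn R n -> R[i]),
    block_decomposition p s alpha f c b.

(* The infimum is [+oo] when f has no decomposition. *)
Definition BL_norm p s alpha f : \bar R :=
  ereal_inf [set N : \bar R |
    exists (c : nat -> R[i]) (b : nat -> Rn R n -> R[i]),
      block_decomposition p s alpha f c b /\
      N = (block_coef_sum p c `^ ((pbar p)^-1)%R)%E].

End block_space.

(* Main.v *)
Require Import Defs.
From HB Require Import structures.
From mathcomp Require Import all_boot all_order all_algebra.
From mathcomp Require Import complex.
From mathcomp Require Import all_classical all_reals all_analysis.
From mathcomp Require Import measurable_realfun.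
From mathcomp Require Import ring lra.

(** Write [N] for the dimension and [delta = lam - (N - 1) / 2 > 0]. Above the
    critical index the Bochner-Riesz kernel has an integrable, radially
    decreasing majorant:
    [|K_rho(x)| <= C rho^N (1 + rho |x|)^(- N - delta)] ([br_kernel_bound]).
    Hence the maximal function of [f] is at most a constant times [V f], the
    supremum over dyadic scales of the averages of [|f|] against this majorant
    ([br_maximal_controlled]). Two properties of [V] matter: it is bounded on
    [L^s] ([radial_maximal_strong]), and at distance [d] from a ball carrying
    a mass [m] it is at most [m d^(- N)].

    Let [b] be a block on a ball [B], put [e = - alpha / (p N) - 1/p + 1/s], so
    that [||b||_s <= |B|^e], and cut [V b] along [A_0 = 2B] and
    [A_j = 2^(j+1) B - 2^j B]. On [A_0] the [L^s] bound applies; on the other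
    annuli the pointwise one does, since a block has mass at most
    [2 |B|^(1 - 1/s + e)]. Either way the piece of [V b] on [A_j] has [L^s] norm
    at most [C z^j |2^(j+1) B|^e] with [z = 2^(- N (1 - 1/s + e))]: it is
    [C z^j] times a block ([annulus_estimate]). The condition
    [alpha < N (p - 1)] says that [1 - 1/s + e > 0], so that [z < 1] and the
    coefficients are summable; [alpha >= N (p/s - 1)] says that [e <= 0], which
    keeps the comparison of [|B|^e] with [|2B|^e] on the right side and makes
    sums of blocks converge locally in [L^1].

    If [f = sum_k c_k b_k], the maximal function of [f] is at most [C G], where
    [G = sum_k |c_k| V b_k] is bounded by a sum of such pieces over [k] and [j].
    So it equals [C tau] times that sum for some measurable [tau] with values
    in [0, 1], and multiplying each piece by [tau] yields a decomposition of
    the maximal function itself, with coefficients [C z^j |c_k|]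
    ([br_maximal_block_decomposition]).

    The kernel bound: rotation invariance turns the Fourier integral of
    [(1 - |xi|^2)_+^lam] on [R^N] into the integral of
    [(1 - t^2)_+^mu cos(u t)] on the line, with [mu = lam + (N - 1) / 2]
    ([integral_radial], [br_kernelE]); the latter is [O(u^(- 1 - mu))]
    ([osc_decay]), by concavity for [mu <= 1] and by parts for larger [mu].

    The bound for [V]: the radial majorant lies below a product of majorants in
    the single variables, so [V] is controlled by iterating a maximal operator
    on the line; there the strong bound follows from the Hardy-Littlewood weak
    bound applied at dyadic levels ([line_maximal_strong]).

    Measurability: [f] only agrees almost everywhere with a measurable
    function, which is enough because an integral does not see a change of the
    integrand on a null Borel set ([integral_off_null]); and where [G] is finite
    the means depend continuously on [rho], so that the supremum over [rho] is
    one over the positive rationals. *)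

Set Implicit Arguments.
Unset Strict Implicit.
Unset Printing Implicit Defensive.

Import Order.TTheory GRing.Theory Num.Theory.
Import numFieldNormedType.Exports.

Local Open Scope classical_set_scope.
Local Open Scope ring_scope.

(** * Iterated integration on R^n *)

Section affine_substitution.
Context {R : realType}.
Local Open Scope ereal_scope.
Local Notation leb := (@lebesgue_measure R).

Definition affine (c d x : R) : R := (c * x + d)%R.

Lemma measurable_affine c d :
  measurable_fun [set: measurableTypeR R] (affine c d : _ -> measurableTypeR R).
Proof.
apply: measurable_funD; last exact: measurable_cst.
exact: mulrl_measurable.
Qed.

Definition affine_measure c d : {measure set (measurableTypeR R) -> \bar R} :=
  measure_function_pushforward__canonical__measure_function_Measure
    leb (measurable_affine c d).

Lemma affine_preimage c d a b : (0 < c)%R ->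
  affine c d @^-1` `]a, b] = `]((a - d) / c)%R, ((b - d) / c)%R]%classic.
Proof.
move=> c0; apply/seteqP; split=> x /=; rewrite !in_itv/= /affine.
  move=> /andP[h1 h2]; rewrite ltr_pdivrMr// ler_pdivlMr//.
  by rewrite ltrBlDr lerBrDr mulrC h1 h2.
move=> /andP[]; rewrite ltr_pdivrMr// ler_pdivlMr//.
by rewrite ltrBlDr lerBrDr mulrC => -> ->.
Qed.

Lemma lebesgue_measure_affine c d (c0 : (0 <= c)%R) (A : set R) :
  (0 < c)%R -> measurable A ->
  mscale (NngNum c0) (affine_measure c d) A
  = leb A.
Proof.
move=> c_gt0 mA; apply/esym/lebesgue_measure_unique => //= _ [[a b]] _ <-.
rewrite /mscale /= /pushforward affine_preimage// !lebesgue_measure_itv/=.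
rewrite !lte_fin ltr_pM2r ?invr_gt0// ltrD2r.
case: ifPn => ab; last by rewrite mule0.
by rewrite -!EFinB -EFinM; congr EFin; field; rewrite gt_eqF.
Qed.

Lemma ge0_integral_affine (c d : R) (f : R -> \bar R) : (0 < c)%R ->
  measurable_fun setT f -> (forall x, 0 <= f x) ->
  \int[leb]_x f (c * x + d)%R = (c^-1)%:E * \int[leb]_x f x.
Proof.
move=> c0 mf f0.
rewrite [in RHS](eq_measure_integral
    (mscale (NngNum (ltW c0)) (affine_measure c d))); last first.
  by move=> A mA _; apply/esym; exact: lebesgue_measure_affine.
rewrite ge0_integral_mscale//= muleA -EFinM mulVf ?gt_eqF// mul1e.
rewrite /affine_measure ge0_integral_pushforward//=.
exact: measurable_affine.
Qed.

Lemma ge0_integral_shift (d : R) (f : R -> \bar R) :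
  measurable_fun setT f -> (forall x, 0 <= f x) ->
  \int[leb]_x f (x + d)%R = \int[leb]_x f x.
Proof.
move=> mf f0; have := ge0_integral_affine d ltr01 mf f0.
by under eq_integral do rewrite mul1r; rewrite invr1 mul1e.
Qed.

Lemma ge0_integral_opp (f : R -> \bar R) :
  measurable_fun setT f -> (forall x, 0 <= f x) ->
  \int[leb]_x f (- x)%R = \int[leb]_x f x.
Proof.
move=> mf f0.
rewrite [in RHS](eq_measure_integral
    (pushforward leb (-%R : _ -> measurableTypeR R))); last first.
  by move=> A mA _; exact/esym/lebesgue_measureN.
by rewrite ge0_integral_pushforward.
Qed.

End affine_substitution.

Section integral_Rn.
Context {R : realType}.
Local Open Scope ereal_scope.
Local Notation leb := (@lebesgue_measure R).

Lemma integral_Rn0 (f : Rn R 0 -> \bar R) :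
  \int[lebesgueRn R 0]_x f x = f [tuple].
Proof.
have mf : measurable_fun [set: Rn R 0] f.
  move=> _ B _; rewrite setTI.
  have [fB|fB] := pselect (B (f [tuple])).
    rewrite (_ : _ @^-1` _ = setT) //.
    by apply/seteqP; split=> // x _ /=; rewrite (tuple0 x).
  rewrite (_ : _ @^-1` _ = set0) //.
  by apply/seteqP; split=> // x /=; rewrite (tuple0 x).
by rewrite integral_dirac//= diracT mul1e.
Qed.

Lemma integral_RnS n (f : Rn R n.+1 -> \bar R) :
  measurable_fun setT f -> (forall x, 0 <= f x) ->
  \int[lebesgueRn R n.+1]_x f x =
  \int[leb]_t \int[lebesgueRn R n]_z f (tcons (t, z)).
Proof.
move=> mf f0.
transitivity (\int[pushforward (leb \x lebesgueRn R n) (@tcons R n)]_x f x).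
  by [].
rewrite ge0_integral_pushforward//=; last exact: measurable_tcons.
rewrite fubini_tonelli1//.
exact: (measurableT_comp mf (@measurable_tcons R n)).
Qed.

Lemma integral_RnS_swap n (f : Rn R n.+1 -> \bar R) :
  measurable_fun setT f -> (forall x, 0 <= f x) ->
  \int[lebesgueRn R n.+1]_x f x =
  \int[lebesgueRn R n]_z \int[leb]_t f (tcons (t, z)).
Proof.
move=> mf f0; rewrite integral_RnS//.
rewrite (fubini_tonelli (fun p => f (tcons p)))//.
exact: (measurableT_comp mf (@measurable_tcons R n)).
Qed.

End integral_Rn.

(** * Fourier integrals of radial truncated powers *)

Section measurability_Rn.
Context {R : realType}.

Lemma measurable_fun_dotp d (T : measurableType d) n (f g : T -> Rn R n) :
  measurable_fun setT f -> measurable_fun setT g ->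
  measurable_fun setT (fun t => dotp (f t) (g t)).
Proof.
move=> /measurable_fun_tnthP mf /measurable_fun_tnthP mg.
by apply: measurable_sum => i; apply: measurable_funM; [exact: mf|exact: mg].
Qed.

Lemma measurable_fun_sqrt d (T : measurableType d) (f : T -> R) :
  measurable_fun setT f -> measurable_fun setT (fun t => Num.sqrt (f t)).
Proof.
move=> mf; apply: measurableT_comp mf.
apply: continuous_measurable_fun; exact: sqrt_continuous.
Qed.

Lemma measurable_fun_enorm d (T : measurableType d) n (f : T -> Rn R n) :
  measurable_fun setT f -> measurable_fun setT (fun t => enorm (f t)).
Proof. by move=> mf; apply: measurable_fun_sqrt; exact: measurable_fun_dotp. Qed.

Lemma measurable_fun_tsub d (T : measurableType d) n (f g : T -> Rn R n) :
  measurable_fun setT f -> measurable_fun setT g ->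
  measurable_fun setT (fun t => tsub (f t) (g t)).
Proof.
move=> /measurable_fun_tnthP mf /measurable_fun_tnthP mg.
apply/measurable_fun_tnthP => i /=.
rewrite [X in measurable_fun _ X](_ : _ =
  fun t => tnth (f t) i - tnth (g t) i); last first.
  by apply/funext => t /=; rewrite tnth_mktuple.
by apply: measurable_funB; [exact: mf|exact: mg].
Qed.

Lemma measurable_fun_tscale d (T : measurableType d) n (c : T -> R)
    (f : T -> Rn R n) :
  measurable_fun setT c -> measurable_fun setT f ->
  measurable_fun setT (fun t => tscale (c t) (f t)).
Proof.
move=> mc /measurable_fun_tnthP mf.
apply/measurable_fun_tnthP => i /=.
rewrite [X in measurable_fun _ X](_ : _ =
  fun t => c t * tnth (f t) i); last first.
  by apply/funext => t /=; rewrite tnth_mktuple.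
by apply: measurable_funM; [exact: mc|exact: mf].
Qed.

Lemma measurable_fun_pos_powR d (T : measurableType d) (lam : R) (f : T -> R) :
  measurable_fun setT f -> measurable_fun setT (fun t => pos_powR (f t) lam).
Proof.
move=> mf; apply: measurable_fun_ifT => //.
- by apply: measurable_fun_ltr => //; exact: measurable_cst.
- exact: (measurableT_comp (measurable_powR lam)).
Qed.

Lemma pos_powR_ge0 (t lam : R) : 0 <= pos_powR t lam.
Proof. by rewrite /pos_powR; case: ifP => // _; exact: powR_ge0. Qed.

Lemma dotp_tcons n (a b : R) (x y : Rn R n) :
  dotp (tcons (a, x)) (tcons (b, y)) = a * b + dotp x y.
Proof.
rewrite /dotp big_ord_recl /tcons /=; congr (_ + _).
by apply: eq_bigr => i _; rewrite !tnthS.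
Qed.

Lemma tunconsK n : cancel (@tuncons R n) (@tcons R n).
Proof.
case=> -[//|a s] sn; apply/val_inj => /=; congr (_ :: _).
Qed.

Lemma dotp_ge0 n (x : Rn R n) : 0 <= dotp x x.
Proof. by apply: sumr_ge0 => i _; rewrite -expr2 sqr_ge0. Qed.

Lemma enorm_ge0 n (x : Rn R n) : 0 <= enorm x.
Proof. exact: sqrtr_ge0. Qed.

Lemma sqr_enorm n (x : Rn R n) : enorm x ^+ 2 = dotp x x.
Proof. by rewrite sqr_sqrtr ?dotp_ge0. Qed.

End measurability_Rn.

Section plane_rotation.
Context {R : realType}.
Local Open Scope ereal_scope.
Local Notation leb := (@lebesgue_measure R).
Implicit Types F : R * R -> \bar R.

Let T2 : measurableType _ := (measurableTypeR R * measurableTypeR R)%type.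

Let plane F := \int[leb]_a \int[leb]_b F (a, b).

Let measurable_fun_plane F (u v : T2 -> R) : measurable_fun [set: T2] F ->
  measurable_fun [set: T2] u -> measurable_fun [set: T2] v ->
  measurable_fun [set: T2] (fun p => F (u p, v p)).
Proof.
move=> mF mu mv.
apply: (measurableT_comp mF (g := fun p => (u p, v p))).
exact: measurable_fun_pair.
Qed.

Let measurable_fun_lin (k l : R) :
  measurable_fun [set: T2] (fun p => k * p.1 + l * p.2)%R.
Proof.
apply: measurable_funD; (apply: measurable_funM; first exact: measurable_cst).
- exact: measurable_fst.
- exact: measurable_snd.
Qed.

Let measurable_fun_lin2 F (k l k' l' : R) : measurable_fun [set: T2] F ->
  measurable_fun [set: T2]
    (fun p => F (k * p.1 + l * p.2, k' * p.1 + l' * p.2)%R).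
Proof.
by move=> mF; apply: (measurable_fun_plane mF); exact: measurable_fun_lin.
Qed.

Let measurable_shear_left F (k : R) : measurable_fun [set: T2] F ->
  measurable_fun [set: T2] (fun p => F (p.1 + k * p.2, p.2)%R).
Proof.
move=> /(measurable_fun_lin2 1 k 0 1); apply: eq_measurable_fun => p _.
by rewrite !mul1r mul0r add0r.
Qed.

Let measurable_shear_right F (k : R) : measurable_fun [set: T2] F ->
  measurable_fun [set: T2] (fun p => F (p.1, p.2 + k * p.1)%R).
Proof.
move=> /(measurable_fun_lin2 1 0 k 1); apply: eq_measurable_fun => p _.
by rewrite !mul1r mul0r addr0 [(k * _ + _)%R]addrC.
Qed.

Let shear_left F (k : R) : measurable_fun [set: T2] F -> (forall p, 0 <= F p) ->
  plane (fun p => F (p.1 + k * p.2, p.2)%R) = plane F.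
Proof.
move=> mF F0; rewrite /plane.
apply: (etrans (fubini_tonelli (fun p : T2 => F (p.1 + k * p.2, p.2)%R)
  (measurable_shear_left k mF) _)); first by move=> p; exact: F0.
apply: (etrans _ (esym (fubini_tonelli (m1 := leb) (m2 := leb) F mF F0))).
apply: eq_integral => b _ /=.
rewrite (ge0_integral_shift (k * b)%R (f := fun a => F (a, b)))//.
exact: (measurable_fun_pair1 b mF).
Qed.

Let shear_right F (k : R) : measurable_fun [set: T2] F -> (forall p, 0 <= F p) ->
  plane (fun p => F (p.1, p.2 + k * p.1)%R) = plane F.
Proof.
move=> mF F0; apply: eq_integral => a _ /=.
rewrite (ge0_integral_shift (k * a)%R (f := fun b => F (a, b)))//.
exact: (measurable_fun_pair2 a mF).
Qed.

(** A rotation with [0 <= c] is a product of three shears, with factors [s / (1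
    + c)], [- s] and [s / (1 + c)]; each of them is a translation in one
    variable, which preserves the iterated integral. The sign of [c] keeps [1 +
    c] away from zero. *)
Lemma integral_rotation F (c s : R) : measurable_fun [set: T2] F ->
  (forall p, 0 <= F p) -> (0 <= c)%R -> (c ^+ 2 + s ^+ 2 = 1)%R ->
  \int[leb]_a \int[leb]_b F (c * a + s * b, - s * a + c * b)%R =
  \int[leb]_a \int[leb]_b F (a, b).
Proof.
move=> mF F0 c0 cs1; rewrite -!/(plane _).
have c1 : (1 + c != 0)%R by rewrite gt_eqF// ltr_pwDl.
(* The tangent of half the angle. *)
pose k := (s / (1 + c))%R.
rewrite -[RHS](shear_left k mF F0).
have := measurable_shear_left k mF.
set F1 := (fun p => F (p.1 + k * p.2, p.2)%R) => mF1.
have F10 p : 0 <= F1 p by exact: F0.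
rewrite -[RHS](shear_right (- s)%R mF1 F10).
have := measurable_shear_right (- s)%R mF1.
set F2 := (fun p => F1 (p.1, p.2 + - s * p.1)%R) => mF2.
have F20 p : 0 <= F2 p by exact: F0.
rewrite -[RHS](shear_left k mF2 F20).
apply: eq_integral => a _; apply: eq_integral => b _ /=.
rewrite /F2 /F1 /=.
have ks : (1 - k * s = c)%R.
  rewrite /k; have -> : (s / (1 + c) * s = s ^+ 2 / (1 + c))%R by field.
  by rewrite (_ : s ^+ 2 = 1 - c ^+ 2)%R; [field|rewrite -cs1; ring].
have k1c : (k * (1 + c) = s)%R by rewrite /k; field.
congr (F (_, _)).
- transitivity ((1 - k * s) * a + k * (1 + (1 - k * s)) * b)%R; last by ring.
  by rewrite ks k1c.
- transitivity (- s * a + (1 - k * s) * b)%R; last by ring.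
  by rewrite ks.
Qed.

(** The rotation that takes [(x, y)] to the first axis turns the phase [x a + y
    b] into a multiple of the first coordinate. A negative [x] is reflected
    first, so that the cosine of the rotation is nonnegative. *)
Lemma integral_radial_plane (H E : R -> \bar R) (x y : R) :
  measurable_fun setT H -> measurable_fun setT E ->
  (forall t, 0 <= H t) -> (forall t, 0 <= E t) ->
  \int[leb]_a \int[leb]_b (H (a ^+ 2 + b ^+ 2)%R * E (x * a + y * b)%R) =
  \int[leb]_a \int[leb]_b
    (H (a ^+ 2 + b ^+ 2)%R * E (Num.sqrt (x ^+ 2 + y ^+ 2) * a)%R).
Proof.
move=> mH mE H0 E0.
have mHE k l : measurable_fun [set: T2]
    (fun p => H (p.1 ^+ 2 + p.2 ^+ 2)%R * E (k * p.1 + l * p.2)%R).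
  apply: emeasurable_funM.
    apply: (measurableT_comp mH); apply: measurable_funD; apply: measurable_funX.
    + exact: measurable_fst.
    + exact: measurable_snd.
  exact: (measurableT_comp mE (measurable_fun_lin k l)).
wlog x0 : x / (0 <= x)%R.
  move=> wx; have [|x0] := leP 0%R x; first exact: wx.
  have := wx (- x)%R; rewrite oppr_ge0 => /(_ (ltW x0)).
  have -> : ((- x) ^+ 2 = x ^+ 2)%R by exact: sqrrN.
  apply: etrans.
  pose G (a : R) :=
    \int[leb]_b (H (a ^+ 2 + b ^+ 2)%R * E (- x * a + y * b)%R).
  have mG : measurable_fun setT G.
    apply: (measurable_fun_fubini_tonelli_F
      (fun p : T2 => H (p.1 ^+ 2 + p.2 ^+ 2)%R * E (- x * p.1 + y * p.2)%R)).
      exact: mHE.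
    by move=> p; rewrite mule_ge0.
  have G0 a : 0 <= G a by apply: integral_ge0 => b _; rewrite mule_ge0.
  apply: (etrans _ (ge0_integral_opp mG G0)).
  by apply: eq_integral => a _; apply: eq_integral => b _; rewrite sqrrN mulrNN.
set r := Num.sqrt _.
have r2 : (r ^+ 2 = x ^+ 2 + y ^+ 2)%R by rewrite sqr_sqrtr// addr_ge0 ?sqr_ge0.
have [r0|r0] := eqVneq r 0%R.
  move: r2; rewrite r0 expr0n/= => /esym/eqP.
  rewrite (paddr_eq0 (sqr_ge0 x) (sqr_ge0 y)) !sqrf_eq0 => /andP[/eqP-> /eqP->].
  by apply: eq_integral => a _; apply: eq_integral => b _; rewrite !mul0r addr0.
have mHEr : measurable_fun [set: T2]
    (fun p => H (p.1 ^+ 2 + p.2 ^+ 2)%R * E (r * p.1)%R).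
  have := mHE r 0%R.
  by under eq_fun do rewrite mul0r addr0.
have HE0 (p : R * R) : 0 <= H (p.1 ^+ 2 + p.2 ^+ 2)%R * E (r * p.1)%R.
  by rewrite mule_ge0.
have cs0 : (0 <= x / r)%R by rewrite divr_ge0// sqrtr_ge0.
have cs1 : ((x / r) ^+ 2 + (y / r) ^+ 2 = 1)%R.
  by rewrite !exprMn -mulrDl -r2 -exprMn divff// expr1n.
apply: (etrans _ (integral_rotation mHEr HE0 cs0 cs1)).
apply: eq_integral => a _; apply: eq_integral => b _ /=.
suff [-> ->] : (a ^+ 2 + b ^+ 2 =
    (x / r * a + y / r * b) ^+ 2 + (- (y / r) * a + x / r * b) ^+ 2 /\
    x * a + y * b = r * (x / r * a + y / r * b))%R by [].
split.
- have e : ((x ^+ 2 + y ^+ 2) / r ^+ 2 = 1)%R.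
    by rewrite -r2 divff// sqrf_eq0.
  rewrite -[LHS]mul1r -e; field; exact: r0.
- by field.
Qed.

End plane_rotation.

Section radial_fourier.
Context {R : realType}.
Local Open Scope ereal_scope.
Local Notation leb := (@lebesgue_measure R).

Definition line_mass (m : R) : R :=
  fine (\int[leb]_b (pos_powR (1 - b ^+ 2)%R m)%:E).

Lemma pos_powR_le1 (t m : R) : (0 <= m)%R -> (t <= 1)%R -> (pos_powR t m <= 1)%R.
Proof.
move=> m0 t1; rewrite /pos_powR; case: ifP => // t0.
have e1 : (1 `^ m = 1 :> R)%R by rewrite powR1.
rewrite -[leRHS]e1; apply: ge0_ler_powR => //; rewrite nnegrE//; exact: ltW.
Qed.

Lemma pos_powR_disc0 (t m : R) : (1 < `|t|)%R -> pos_powR (1 - t ^+ 2) m = 0%R.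
Proof.
move=> t1; rewrite /pos_powR subr_gt0 ltNge.
by rewrite -real_normK ?num_real// expr_ge1 ?(ltW t1).
Qed.

Lemma measurable_disc_power (A m : R) :
  measurable_fun [set: R] (fun t : R => pos_powR (A - t ^+ 2)%R m).
Proof.
by apply: measurable_fun_pos_powR; apply: measurable_funB => //; exact: measurable_funX.
Qed.

Lemma line_mass_fin (m : R) : (0 <= m)%R ->
  \int[leb]_b (pos_powR (1 - b ^+ 2)%R m)%:E < +oo.
Proof.
move=> m0; apply: (@le_lt_trans _ _ (\int[leb]_b (\1_(`[-1, 1] : set R) b)%:E)).
  apply: ge0_le_integral => //.
  - by move=> b _; rewrite lee_fin pos_powR_ge0.
  - by apply/measurable_EFinP; exact: measurable_disc_power.
  - by apply/measurable_EFinP; exact: measurable_indic.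
  - move=> b _; rewrite lee_fin indicE mem_setE in_itv/= -ler_norml.
    have [b1|b1] := leP `|b|%R 1%R.
      by rewrite pos_powR_le1// gerBl sqr_ge0.
    by rewrite pos_powR_disc0.
rewrite integral_indic//= setIT lebesgue_measure_itv/= lte_fin.
by case: ifPn => // _; rewrite ltry.
Qed.

Lemma line_massE (m : R) : (0 <= m)%R ->
  (line_mass m)%:E = \int[leb]_b (pos_powR (1 - b ^+ 2)%R m)%:E.
Proof.
move=> m0; rewrite fineK// ge0_fin_numE ?line_mass_fin//.
by apply: integral_ge0 => b _; rewrite lee_fin pos_powR_ge0.
Qed.

Lemma line_mass_ge0 (m : R) : (0 <= line_mass m)%R.
Proof.
by apply: fine_ge0; apply: integral_ge0 => b _; rewrite lee_fin pos_powR_ge0.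
Qed.

(** Rescaling by the square root of [B] shows how integrating out one variable
    raises the exponent by one half. *)
Lemma integral_pos_powR_line (B m : R) : (0 <= m)%R ->
  \int[leb]_b (pos_powR (B - b ^+ 2)%R m)%:E =
  (line_mass m)%:E * (pos_powR B (m + 2^-1)%R)%:E.
Proof.
move=> m0; have [B0|B0] := ltP 0%R B; last first.
  rewrite integral0_eq; last first.
    move=> b _; rewrite /pos_powR ltNge (_ : (B - b ^+ 2 <= 0)%R)//.
    by rewrite subr_le0 (le_trans B0)// sqr_ge0.
  by rewrite [in RHS]/pos_powR ltNge B0/= mule0.
pose q := Num.sqrt B.
have q0 : (0 < q)%R by rewrite sqrtr_gt0.
have qq : (q ^+ 2 = B)%R by rewrite sqr_sqrtr// ltW.
have := ge0_integral_affine (c := q) 0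
  (f := fun b => (pos_powR (B - b ^+ 2)%R m)%:E) q0.
have mpp : measurable_fun setT (fun b : R => (pos_powR (B - b ^+ 2)%R m)%:E).
  by apply/measurable_EFinP; exact: measurable_disc_power.
have pp0 (b : R) : 0 <= (pos_powR (B - b ^+ 2)%R m)%:E.
  by rewrite lee_fin pos_powR_ge0.
move=> /(_ mpp pp0).
move=> /(congr1 (fun z => q%:E * z)); rewrite muleA -EFinM mulfV ?gt_eqF// mul1e.
move=> <-.
transitivity (q%:E * \int[leb]_b ((B `^ m)%:E * (pos_powR (1 - b ^+ 2)%R m)%:E)).
  congr *%E; apply: eq_integral => b _; rewrite -EFinM; congr EFin.
  have -> : (B - (q * b + 0) ^+ 2 = B * (1 - b ^+ 2))%R by rewrite -qq; ring.
  rewrite /pos_powR pmulr_rgt0//; case: ifPn => b1; last by rewrite mulr0.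
  by rewrite powRM// ltW.
rewrite ge0_integralZl//; last 3 first.
- by apply/measurable_EFinP; exact: measurable_disc_power.
- by move=> b _; rewrite lee_fin pos_powR_ge0.
- by rewrite lee_fin powR_ge0.
rewrite -line_massE// muleA muleC; congr (_ * _).
rewrite /pos_powR B0 -EFinM; congr EFin.
rewrite powRD; last by rewrite (gt_eqF B0) implybT.
by rewrite mulrC; congr (_ * _)%R; rewrite powR12_sqrt// ltW.
Qed.

(** The masses produced by integrating out [n] variables one after the other.
    *)
Fixpoint radial_const (n : nat) (m : R) : R :=
  if n is n'.+1 then (radial_const n' m * line_mass (m + n'%:R / 2))%R else 1%R.

Lemma radial_const_ge0 n m : (0 <= radial_const n m)%R.
Proof. by elim: n => //= n ih; rewrite mulr_ge0// line_mass_ge0. Qed.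

(** Induction on the dimension. The induction hypothesis, used in all variables
    but the first, leaves a planar integral whose phase sees the other
    variables only through the norm of their dual vector; a rotation of that
    plane removes one direction from the phase, and integrating it out raises
    the exponent by one half. With [E] nonnegative every exchange of integrals
    is an instance of Tonelli's theorem. *)
Theorem integral_radial n (m A : R) (E : R -> \bar R) (x : Rn R n.+1) :
  (0 <= m)%R -> measurable_fun setT E -> (forall t, 0 <= E t) ->
  \int[lebesgueRn R n.+1]_xi
    ((pos_powR (A - dotp xi xi)%R m)%:E * E (dotp x xi)) =
  (radial_const n m)%:E *
  \int[leb]_t ((pos_powR (A - t ^+ 2)%R (m + n%:R / 2)%R)%:E * E (enorm x * t)%R).
Proof.
move=> m0; elim: n A E x => [|n ih] A E x mE E0.
  rewrite integral_RnS; last 2 first.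
  - apply: emeasurable_funM.
      apply/measurable_EFinP; apply: measurable_fun_pos_powR.
      apply: measurable_funB; first exact: measurable_cst.
      by apply: measurable_fun_dotp; exact: measurable_id.
    apply: (measurableT_comp mE); apply: measurable_fun_dotp.
      exact: measurable_cst.
    exact: measurable_id.
  - by move=> xi; rewrite mule_ge0// lee_fin pos_powR_ge0.
  rewrite mul1e mul0r addr0 -(tunconsK x); case: (tuncons x) => x1 x'.
  have d0 (u v : Rn R 0) : dotp u v = 0%R by rewrite /dotp big_ord0.
  under eq_integral do rewrite integral_Rn0 !dotp_tcons !d0 !addr0 -expr2.
  rewrite /enorm dotp_tcons d0 addr0 -expr2 sqrtr_sqr.
  have [x0|x0] := ger0P x1; first by [].
  rewrite -[LHS]ge0_integral_opp.
  - by apply: eq_integral => t _; rewrite sqrrN mulrN mulNr.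
  - apply: emeasurable_funM; first by apply/measurable_EFinP; exact: measurable_disc_power.
    by apply: (measurableT_comp mE); exact: measurable_funM.
  - by move=> xi; rewrite mule_ge0// lee_fin pos_powR_ge0.
rewrite integral_RnS; last 2 first.
- apply: emeasurable_funM.
    apply/measurable_EFinP; apply: measurable_fun_pos_powR.
    apply: measurable_funB; first exact: measurable_cst.
    by apply: measurable_fun_dotp; exact: measurable_id.
  apply: (measurableT_comp mE); apply: measurable_fun_dotp.
    exact: measurable_cst.
  exact: measurable_id.
- by move=> xi; rewrite mule_ge0// lee_fin pos_powR_ge0.
rewrite -(tunconsK x); case: (tuncons x) => x1 x'.
pose H t := (pos_powR (A - t)%R (m + n%:R / 2)%R)%:E.
have mn0 : (0 <= m + n%:R / 2)%R by rewrite addr_ge0// divr_ge0.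
have mH : measurable_fun setT H.
  by apply/measurable_EFinP; apply: measurable_fun_pos_powR; exact: measurable_funB.
have H0 t : 0 <= H t by rewrite lee_fin pos_powR_ge0.
transitivity (\int[leb]_a ((radial_const n m)%:E *
   \int[leb]_b (H (a ^+ 2 + b ^+ 2)%R * E (x1 * a + enorm x' * b)%R))).
  apply: eq_integral => a _.
  under eq_integral do rewrite !dotp_tcons opprD addrA -expr2.
  have mEa : measurable_fun setT (fun u => E (x1 * a + u)%R).
    by apply: (measurableT_comp mE); exact: measurable_funD.
  apply: (etrans (ih (A - a ^+ 2)%R (fun u => E (x1 * a + u)%R) x' mEa _)).
    by move=> t; exact: E0.
  apply: (@congr1 _ _ (mule (radial_const n m)%:E)); apply: eq_integral => b _.
  by rewrite /H opprD addrA.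
rewrite ge0_integralZl//; last 3 first.
- apply: (measurable_fun_fubini_tonelli_F (fun p : measurableTypeR R * measurableTypeR R =>
    H (p.1 ^+ 2 + p.2 ^+ 2)%R * E (x1 * p.1 + enorm x' * p.2)%R)).
    apply: emeasurable_funM.
      apply: (measurableT_comp mH); apply: measurable_funD; apply: measurable_funX.
      + exact: measurable_fst.
      + exact: measurable_snd.
    apply: (measurableT_comp mE).
    apply: measurable_funD; (apply: measurable_funM; first exact: measurable_cst).
    - exact: measurable_fst.
    - exact: measurable_snd.
  by move=> p; rewrite mule_ge0.
- by move=> a _; apply: integral_ge0 => b _; rewrite mule_ge0.
- by rewrite lee_fin radial_const_ge0.
rewrite integral_radial_plane//.
have -> : Num.sqrt (x1 ^+ 2 + enorm x' ^+ 2) = enorm (tcons (x1, x')).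
  by rewrite /enorm dotp_tcons sqr_sqrtr ?dotp_ge0// expr2.
set N := enorm _.
transitivity ((radial_const n m)%:E * \int[leb]_a ((line_mass (m + n%:R / 2)%R)%:E *
   ((pos_powR (A - a ^+ 2)%R (m + n.+1%:R / 2)%R)%:E * E (N * a)%R))).
  congr *%E; apply: eq_integral => a _.
  rewrite ge0_integralZr//; last first.
  - apply: (measurableT_comp mH); apply: measurable_funD => //; exact: measurable_funX.
  have -> : \int[leb]_b H (a ^+ 2 + b ^+ 2)%R =
      \int[leb]_b (pos_powR (A - a ^+ 2 - b ^+ 2)%R (m + n%:R / 2)%R)%:E.
    by apply: eq_integral => b _; rewrite /H opprD addrA.
  rewrite integral_pos_powR_line// muleA.
  have -> // : (m + n.+1%:R / 2 = m + n%:R / 2 + 2^-1)%R.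
  by rewrite -natr1 mulrDl mul1r addrA.
rewrite ge0_integralZl//.
- by rewrite muleA -EFinM.
- apply: emeasurable_funM; first by apply/measurable_EFinP; exact: measurable_disc_power.
  by apply: (measurableT_comp mE); exact: measurable_funM.
- by move=> a _; rewrite mule_ge0// lee_fin pos_powR_ge0.
- by rewrite lee_fin line_mass_ge0.
Qed.

End radial_fourier.

(** * Decay of oscillatory integrals on the line *)

Section powR_inequalities.
Context {R : realType}.
Implicit Types x y nu : R.

Lemma ler_powR_base nu x y : 0 <= nu -> 0 <= x -> x <= y -> x `^ nu <= y `^ nu.
Proof.
move=> nu0 x0 xy; apply: ge0_ler_powR => //; rewrite nnegrE//.
exact: le_trans xy.
Qed.

(** Young's inequality for the product of [z `^ nu] and [1], with exponents [1
    / nu] and [1 / (1 - nu)]. *)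
Lemma powR_Bernoulli nu z : 0 < nu -> nu <= 1 -> 0 <= z ->
  z `^ nu <= 1 + nu * (z - 1).
Proof.
move=> nu0; rewrite le_eqVlt => /predU1P[->|nu1] z0.
  by rewrite powRr1// mul1r subrKC.
have := @conjugate_powR _ (z `^ nu) 1 nu^-1 (1 - nu)^-1 (powR_ge0 _ _) ler01.
rewrite !invr_gt0 subr_gt0 !invrK nu0 nu1 subrKC => /(_ isT isT erefl).
rewrite mulr1 -powRrM mulfV ?gt_eqF// powRr1// powR1 => /le_trans; apply.
by rewrite le_eqVlt; apply/orP; left; apply/eqP; ring.
Qed.

(** Add up the tangent-line bounds at the midpoint, which are [powR_Bernoulli]
    for [x] and [y] divided by it. *)
Lemma powR_midpoint_concave nu x y : 0 < nu -> nu <= 1 -> 0 <= x -> 0 <= y ->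
  (x `^ nu + y `^ nu) / 2 <= ((x + y) / 2) `^ nu.
Proof.
move=> nu0 nu1 x0 y0; set m := (x + y) / 2.
have m0 : 0 <= m by rewrite divr_ge0// addr_ge0.
have [m_eq0|mneq0] := eqVneq m 0.
  have : x + y == 0 by rewrite -(mulr0 2) -m_eq0 /m; apply/eqP; field.
  rewrite paddr_eq0// => /andP[/eqP -> /eqP ->].
  by rewrite m_eq0 powR0 ?gt_eqF// addr0 mul0r.
have mgt0 : 0 < m by rewrite lt_neqAle eq_sym mneq0.
have H z : 0 <= z -> z `^ nu <= m `^ nu * (1 + nu * (z / m - 1)).
  move=> z0; rewrite -{1}(divfK mneq0 z) mulrC (powRM _ m0 (divr_ge0 z0 m0)).
  by rewrite ler_wpM2l ?powR_ge0// powR_Bernoulli// (divr_ge0 z0 m0).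
rewrite ler_pdivrMr// (le_trans (lerD (H x x0) (H y y0)))// le_eqVlt.
apply/orP; left; apply/eqP; rewrite -mulrDr; congr (_ * _).
have -> : y = 2 * m - x by rewrite /m; field.
by field.
Qed.

(** The fractions [x / (x + y)] and [y / (x + y)] add up to one and increase
    when raised to a power [nu <= 1]. *)
Lemma powR_subadditive nu x y : 0 < nu -> nu <= 1 -> 0 <= x -> 0 <= y ->
  (x + y) `^ nu <= x `^ nu + y `^ nu.
Proof.
move=> nu0 nu1; rewrite le_eqVlt => /predU1P[<- y0|x0].
  by rewrite add0r powR0 ?gt_eqF// add0r.
rewrite le_eqVlt => /predU1P[<-|y0].
  by rewrite addr0 powR0 ?gt_eqF// addr0.
have s0 : 0 < x + y by rewrite addr_gt0.
have H z : 0 < z -> z <= x + y -> (x + y) `^ nu * (z / (x + y)) <= z `^ nu.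
  move=> z0 zs; rewrite -[leRHS](_ : ((x + y) * (z / (x + y))) `^ nu = _); last first.
    by congr powR; field; rewrite gt_eqF.
  rewrite (powRM _ (ltW s0) (ltW (divr_gt0 z0 s0))) ler_wpM2l ?powR_ge0//.
  by apply: ger1_powR => //; rewrite divr_gt0//= ler_pdivrMr// mul1r.
apply: le_trans (lerD (H x x0 _) (H y y0 _)); rewrite ?lerDl ?lerDr ?(ltW x0) ?(ltW y0)//.
by rewrite -mulrDr -mulrDl divff ?gt_eqF// mulr1.
Qed.

Lemma pos_powRE nu x : 0 < nu -> pos_powR x nu = (Num.max x 0) `^ nu.
Proof.
move=> nu0; rewrite /pos_powR; case: ltP => x0; first by [].
by rewrite powR0// gt_eqF.
Qed.

Lemma pos_powR_homo nu x y : 0 < nu -> x <= y -> pos_powR x nu <= pos_powR y nu.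
Proof.
move=> nu0 xy; rewrite !pos_powRE//; apply: ler_powR_base; first exact: ltW.
- by rewrite le_max lexx orbT.
- by rewrite ge_max !le_max xy lexx orbT.
Qed.

Lemma pos_powR_Hoelder nu x y : 0 < nu -> nu <= 1 ->
  `|pos_powR x nu - pos_powR y nu| <= `|x - y| `^ nu.
Proof.
move=> nu0 nu1; wlog xy : x y / x <= y.
  move=> H; have [xy|/ltW yx] := leP x y; first exact: H.
  by rewrite distrC [in leRHS]distrC; exact: H.
rewrite distrC ger0_norm ?subr_ge0 ?pos_powR_homo// distrC.
rewrite [in leRHS]ger0_norm ?subr_ge0//.
rewrite lerBlDr !pos_powRE//.
apply: le_trans (powR_subadditive nu0 nu1 _ _); last 2 first.
- by rewrite subr_ge0.
- by rewrite le_max lexx orbT.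
apply: ler_powR_base; first exact: ltW.
- by rewrite le_max lexx orbT.
rewrite ge_max; apply/andP; split.
  by rewrite -lerBlDl opprB addrC subrK le_max lexx.
by rewrite addr_ge0 ?subr_ge0// le_max lexx orbT.
Qed.

Lemma pos_powR_cvg0 nu x : 0 < nu -> x <= 0 -> {for x, continuous (pos_powR ^~ nu)}.
Proof.
move=> nu0 x0; rewrite /prop_for /continuous_at {2}/pos_powR ltNge x0 /=.
apply/cvgrPdist_lt => e e0; near=> y.
rewrite sub0r normrN ger0_norm ?pos_powR_ge0// /pos_powR; case: ifPn => // y0.
have -> : e = (e `^ nu^-1) `^ nu.
  by rewrite -powRrM mulVf ?gt_eqF// powRr1// ltW.
apply: gt0_ltr_powR => //; rewrite ?nnegrE ?powR_ge0 ?(ltW y0)//.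
apply: (@le_lt_trans _ _ `|x - y|).
  by rewrite distrC (le_trans _ (ler_norm _))// lerBrDr gerDl.
by near: y; apply: cvgr_dist_lt => //; rewrite powR_gt0.
Unshelve. all: by end_near. Qed.

Lemma is_derive_pos_powR nu x : 0 < x ->
  is_derive x 1 (pos_powR ^~ nu) (nu * x `^ (nu - 1)).
Proof.
move=> x0; have [d e] := is_derive1_powR nu x0.
have E : \forall z \near x, z `^ nu = pos_powR z nu.
  by near=> z; rewrite /pos_powR ifT//; near: z; exact: lt_nbhsr.
split; first exact: near_eq_derivable d.
by rewrite -e; apply/esym; exact: near_eq_derive.
Unshelve. all: by end_near. Qed.

Lemma continuous_pos_powR nu : 0 < nu -> continuous (pos_powR ^~ nu : R -> R).
Proof.
move=> nu0 x; have [x0|x0] := leP x 0; first exact: pos_powR_cvg0.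
have [d _] := is_derive_pos_powR nu x0.
exact/differentiable_continuous/derivable1_diffP.
Qed.

End powR_inequalities.

Section bounded_support.
Context {R : realType}.
Local Notation leb := (@lebesgue_measure R).
Implicit Types f w : R -> R.

Lemma Rintegral_shift d f : measurable_fun setT f ->
  \int[leb]_t f (t + d) = \int[leb]_t f t.
Proof.
move=> mf; rewrite /Rintegral integralE [in RHS]integralE.
have mfE : measurable_fun setT (EFin \o f) by exact/measurable_EFinP.
have e1 := ge0_integral_shift d (measurable_funepos mfE)
  (fun t => funepos_ge0 (EFin \o f) t).
have e2 := ge0_integral_shift d (measurable_funeneg mfE)
  (fun t => funeneg_ge0 (EFin \o f) t).
have -> : (\int[leb]_t (fun t => (f (t + d))%:E)^\+ t = \int[leb]_t (EFin \o f)^\+ t)%E.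
  by apply: etrans e1; apply: eq_integral => t _; rewrite !funeposE.
have -> // : (\int[leb]_t (fun t => (f (t + d))%:E)^\- t = \int[leb]_t (EFin \o f)^\- t)%E.
by apply: etrans e2; apply: eq_integral => t _; rewrite !funenegE.
Qed.

Lemma Rintegral_indic_itv a b : a <= b -> \int[leb]_t \1_(`[a, b] : set R) t = b - a.
Proof.
move=> ab; rewrite /Rintegral integral_indic//= setIT lebesgue_measure_itv/=.
rewrite lte_fin; case: ltgtP ab => //= -> _; by rewrite subrr.
Qed.

Lemma integrable_indic_cst a b K :
  leb.-integrable setT (EFin \o (fun t => K * \1_(`[a, b] : set R) t)).
Proof.
have := integrableZl measurableT K (integrable_indic_itv a b true false).
by apply: eq_integrable => // t _; rewrite /= EFinM.
Qed.

Lemma integrable_bounded_support M K f : measurable_fun setT f ->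
  (forall t, `|f t| <= K) -> (forall t, M < `|t| -> f t = 0) ->
  leb.-integrable setT (EFin \o f).
Proof.
move=> mf fK f0.
apply: le_integrable (integrable_indic_cst (- M) M K) => //.
  exact/measurable_EFinP.
have K0 : 0 <= K by exact: le_trans (fK 0).
move=> t _; rewrite /= lee_fin normrM (ger0_norm K0) indicE mem_setE in_itv/= -ler_norml.
have [tM|tM] := leP `|t| M; first by rewrite normr1 mulr1.
by rewrite f0// !normr0 mulr0.
Qed.

(** A translation by [tau] in either direction changes the sign of the weight,
    hence of the integral. Averaging the three expressions replaces [f] with
    its second difference, which is small where [f] is smooth. *)
Lemma second_difference_bound (tau M K : R) f w :
  measurable_fun setT f -> measurable_fun setT w ->
  (forall t, `|f t| <= K) -> (forall t, M < `|t| -> f t = 0) ->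
  (forall t, `|w t| <= 1) -> (forall t, w (t + tau) = - w t) ->
  4 * `|\int[leb]_t (f t * w t)| <=
  \int[leb]_t `|2 * f t - f (t + tau) - f (t - tau)|.
Proof.
move=> mf mw fK f0 w1 wtau.
have wtauN t : w (t - tau) = - w t.
  by rewrite -[in RHS](subrK tau t) wtau opprK.
have mshift d (g : R -> R) : measurable_fun setT g -> measurable_fun setT (fun t : R => g (t + d)).
  by move=> mg; apply: (measurableT_comp mg); exact: measurable_funD.
have ifs d : leb.-integrable setT (EFin \o (fun t => f (t + d) * w t)).
  apply: (@integrable_bounded_support (M + `|d|) K).
  - by apply: measurable_funM => //; exact: mshift.
  - move=> t; rewrite normrM -[leRHS]mulr1; exact: ler_pM.
  - move=> t Mt; rewrite f0 ?mul0r//.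
    by have := ler_normB (t + d) d; rewrite addrK; lra.
have I1 : \int[leb]_t (f (t + tau) * w t) = - \int[leb]_t (f t * w t).
  have mg : measurable_fun setT (fun t => f t * w (t - tau)).
    by apply: measurable_funM => //; exact: (mshift (- tau)).
  rewrite (_ : (fun t => f (t + tau) * w t) =
               (fun t => (fun t => f t * w (t - tau)) (t + tau))); last first.
    by apply/funext => t /=; rewrite addrK.
  rewrite (Rintegral_shift tau mg) -[RHS]mulN1r -RintegralZl//.
    by apply: eq_Rintegral => t _; rewrite wtauN; ring.
  by have := ifs 0; under eq_fun do rewrite addr0.
have I2 : \int[leb]_t (f (t - tau) * w t) = - \int[leb]_t (f t * w t).
  have mg : measurable_fun setT (fun t => f t * w (t + tau)).
    by apply: measurable_funM => //; exact: (mshift tau).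
  rewrite (_ : (fun t => f (t - tau) * w t) =
               (fun t => (fun t => f t * w (t + tau)) (t - tau))); last first.
    by apply/funext => t /=; rewrite subrK.
  rewrite (Rintegral_shift (- tau) mg) -[RHS]mulN1r -RintegralZl//.
    by apply: eq_Rintegral => t _; rewrite wtau; ring.
  by have := ifs 0; under eq_fun do rewrite addr0.
have if0 : leb.-integrable setT (EFin \o (fun t => f t * w t)).
  by have := ifs 0; under eq_fun do rewrite addr0.
have if2 : leb.-integrable setT (EFin \o (fun t => 2 * (f t * w t))).
  by have := integrableZl measurableT 2 if0; apply: eq_integrable => // t _; rewrite /= EFinM.
have if3 : leb.-integrable setT (EFin \o (fun t => 2 * (f t * w t) - f (t + tau) * w t)).
  by have := integrableB measurableT if2 (ifs tau); apply: eq_integrable.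
have I3 : 4 * \int[leb]_t (f t * w t) =
    \int[leb]_t ((2 * f t - f (t + tau) - f (t - tau)) * w t).
  transitivity (\int[leb]_t ((2 * (f t * w t) - f (t + tau) * w t) - f (t - tau) * w t)).
    rewrite RintegralB// RintegralB// RintegralZl// I1 I2; ring.
  by apply: eq_Rintegral => t _; ring.
have -> : 4 * `|\int[leb]_t (f t * w t)| = `|4 * \int[leb]_t (f t * w t)|.
  by rewrite normrM (ger0_norm (_ : 0 <= 4)).
rewrite I3; set D := fun t => 2 * f t - f (t + tau) - f (t - tau).
have mD : measurable_fun setT D.
  apply: measurable_funB; last exact: (mshift (- tau)).
  apply: measurable_funB; last exact: mshift.
  exact: measurable_funM.
have DK t : `|D t| <= 4 * K.
  rewrite /D (le_trans (ler_normB _ _))//.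
  have := ler_normB (2 * f t) (f (t + tau)); rewrite [`|2 * _|]normrM ger0_norm//.
  have := fK t; have := fK (t + tau); have := fK (t - tau); lra.
have D0 t : M + `|tau| < `|t| -> D t = 0.
  move=> Mt; have tau0 := normr_ge0 tau.
  rewrite /D !f0 ?mulr0 ?subr0//; last by lra.
  - by have := ler_normD (t - tau) tau; rewrite subrK; lra.
  - by have := ler_normB (t + tau) tau; rewrite addrK; lra.
have iD : leb.-integrable setT (EFin \o D) by exact: integrable_bounded_support DK D0.
have DwK t : `|D t * w t| <= `|D t|.
  by rewrite normrM ler_piMr.
have iDw : leb.-integrable setT (EFin \o (fun t => D t * w t)).
  apply: (@integrable_bounded_support (M + `|tau|) (4 * K)).
  - exact: measurable_funM.
  - by move=> t; rewrite (le_trans (DwK t)).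
  - by move=> t Mt; rewrite D0// mul0r.
rewrite (le_trans (le_normr_Rintegral measurableT iDw))//.
apply: le_Rintegral => //.
- by have := integrable_norm iDw; apply: eq_integrable.
- by have := integrable_norm iD; apply: eq_integrable.
Qed.

End bounded_support.

Section oscillatory.
Context {R : realType}.
Local Notation leb := (@lebesgue_measure R).
Implicit Types nu tau u : R.

Let h nu (t : R) := pos_powR (1 - t ^+ 2) nu.

Let mh nu : measurable_fun setT (h nu).
Proof. exact: measurable_disc_power. Qed.

Let h_ge0 nu t : 0 <= h nu t. Proof. exact: pos_powR_ge0. Qed.

Let h_le1 nu t : 0 < nu -> h nu t <= 1.
Proof. by move=> nu0; rewrite /h pos_powR_le1 ?(ltW nu0)// gerBl sqr_ge0. Qed.

Let normh_le1 nu t : 0 < nu -> `|h nu t| <= 1.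
Proof. by move=> nu0; rewrite ger0_norm ?h_le1. Qed.

Let h_out nu t : 1 < `|t| -> h nu t = 0.
Proof. exact: pos_powR_disc0. Qed.

Let ih nu : 0 < nu -> leb.-integrable setT (EFin \o h nu).
Proof.
by move=> nu0; apply: (@integrable_bounded_support _ 1 1) => // t;
  [exact: normh_le1|exact: h_out].
Qed.

Let ihs nu d : 0 < nu -> leb.-integrable setT (EFin \o (fun t => h nu (t + d))).
Proof.
move=> nu0; apply: (@integrable_bounded_support _ (1 + `|d|) 1).
- by apply: (measurableT_comp (mh nu)); exact: measurable_funD.
- by move=> t; exact: normh_le1.
- move=> t t1; apply: h_out.
  by have := ler_normB (t + d) d; rewrite addrK; lra.
Qed.

Let D nu tau t := 2 * h nu t - h nu (t + tau) - h nu (t - tau).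

Let mD nu tau : measurable_fun setT (D nu tau).
Proof.
apply: measurable_funB; [apply: measurable_funB|].
- exact: measurable_funM.
- by apply: (measurableT_comp (mh nu)); exact: measurable_funD.
- by apply: (measurableT_comp (mh nu)); exact: measurable_funB.
Qed.

Let D_out nu tau t : 0 < tau -> 1 + tau < `|t| -> D nu tau t = 0.
Proof.
move=> tau0 t1; rewrite /D !h_out ?mulr0 ?subr0//; last by lra.
- by have := ler_normD (t - tau) tau; rewrite subrK (gtr0_norm tau0); lra.
- by have := ler_normB (t + tau) tau; rewrite addrK (gtr0_norm tau0); lra.
Qed.

Let h_edge nu tau t : 0 < nu -> tau <= 2^-1 -> 1 - 2 * tau <= `|t| ->
  h nu t <= (4 * tau) `^ nu.
Proof.
move=> nu0 tau1 t1.
have t2 : (1 - 2 * tau) ^+ 2 <= t ^+ 2.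
  rewrite -(real_normK (num_real t)) ler_sqr ?nnegrE//; lra.
have tau2 := sqr_ge0 tau.
rewrite /h /pos_powR; case: ifPn => [t0|_]; last exact: powR_ge0.
apply: ler_powR_base; [exact: ltW|exact: ltW|].
have : (1 - 2 * tau) ^+ 2 = 1 - 4 * tau + 4 * tau ^+ 2 by ring.
by lra.
Qed.

Let D_edge nu tau t : 0 < nu -> 0 < tau -> tau <= 2^-1 -> 1 - tau <= `|t| ->
  `|D nu tau t| <= 4 * (4 * tau) `^ nu.
Proof.
move=> nu0 tau0 tau1 t1.
have H d : `|d| = tau -> h nu (t + d) <= (4 * tau) `^ nu.
  move=> dtau; apply: h_edge => //.
  by have := ler_normB (t + d) d; rewrite addrK dtau; lra.
have h0 : h nu t <= (4 * tau) `^ nu by apply: h_edge => //; lra.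
have h1 := H tau (gtr0_norm tau0).
have h2 := H (- tau); rewrite normrN (gtr0_norm tau0) in h2.
have {}h2 := h2 erefl.
rewrite /D ler_norml.
by have := h_ge0 nu t; have := h_ge0 nu (t + tau); have := h_ge0 nu (t - tau); lra.
Qed.

Let D_inside nu tau t : 0 < nu -> nu <= 1 -> 0 < tau -> `|t| < 1 - tau ->
  0 <= D nu tau t.
Proof.
move=> nu0 nu1 tau0; rewrite ltr_norml => /andP[t1 t2].
have H d : `|d| <= tau -> h nu (t + d) = (1 - (t + d) ^+ 2) `^ nu /\
    0 <= 1 - (t + d) ^+ 2.
  rewrite ler_norml => /andP[d1 d2].
  have d0 : 0 <= 1 - (t + d) ^+ 2.
    by rewrite (_ : _ - _ = (1 - (t + d)) * (1 + (t + d))); [apply: mulr_ge0; lra|ring].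
  split => //; rewrite /h pos_powRE//; congr powR.
  by apply/max_idPl.
have := H (- tau); rewrite normrN (gtr0_norm tau0) => /(_ (lexx _))[e2 p2].
have := H 0; rewrite normr0 addr0 => /(_ (ltW tau0))[e0 p0].
have := H tau; rewrite (gtr0_norm tau0) => /(_ (lexx _))[e1 p1].
rewrite /D e0 e1 e2.
have := powR_midpoint_concave nu0 nu1 p1 p2.
have : ((1 - (t + tau) ^+ 2 + (1 - (t - tau) ^+ 2)) / 2) `^ nu <= (1 - t ^+ 2) `^ nu.
  apply: ler_powR_base; first exact: ltW.
    by rewrite divr_ge0// addr_ge0.
  have -> : (1 - (t + tau) ^+ 2 + (1 - (t - tau) ^+ 2)) / 2 = 1 - t ^+ 2 - tau ^+ 2.
    by field.
  by rewrite gerBl sqr_ge0.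
by lra.
Qed.

Let iD nu tau : 0 < nu -> 0 < tau -> leb.-integrable setT (EFin \o D nu tau).
Proof.
move=> nu0 tau0; apply: (@integrable_bounded_support _ (1 + tau) 4).
- exact: mD.
- move=> t; rewrite /D ler_norml.
  have := h_ge0 nu t; have := h_ge0 nu (t + tau); have := h_ge0 nu (t - tau).
  have := h_le1 t nu0; have := h_le1 (t + tau) nu0; have := h_le1 (t - tau) nu0.
  by lra.
- by move=> t; exact: D_out.
Qed.

Let intD nu tau : 0 < nu -> 0 < tau -> \int[leb]_t D nu tau t = 0.
Proof.
move=> nu0 tau0.
have i2 : leb.-integrable setT (EFin \o (fun t => 2 * h nu t)).
  by have := integrableZl measurableT 2 (ih nu0); apply: eq_integrable => // t _; rewrite /= EFinM.
have i3 : leb.-integrable setT (EFin \o (fun t => 2 * h nu t - h nu (t + tau))).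
  by have := integrableB measurableT i2 (ihs tau nu0); apply: eq_integrable.
rewrite /D RintegralB//; last exact: (ihs (- tau) nu0).
rewrite RintegralB//; last exact: ihs.
rewrite RintegralZl//; last exact: ih.
rewrite (Rintegral_shift tau (mh nu)) (Rintegral_shift (- tau) (mh nu)).
by ring.
Qed.

(** The second difference has integral zero and, by concavity, is nonnegative
    at distance more than [tau] from the endpoints; its absolute integral is
    therefore governed by the intervals of length [2 tau] around [-1] and [1],
    where the function itself is at most [(4 tau)^nu]. *)
Let int_normD nu tau : 0 < nu -> nu <= 1 -> 0 < tau -> tau <= 2^-1 ->
  \int[leb]_t `|D nu tau t| <= 32 * tau * (4 * tau) `^ nu.
Proof.
move=> nu0 nu1 tau0 tau1; set K := (4 * tau) `^ nu.
have K0 : 0 <= K by exact: powR_ge0.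
pose I1 : set R := `[- 1 - tau, - 1 + tau]%classic; pose I2 : set R := `[1 - tau, 1 + tau]%classic.
have ii1 := integrable_indic_cst (- 1 - tau) (- 1 + tau) (8 * K).
have ii2 := integrable_indic_cst (1 - tau) (1 + tau) (8 * K).
have ii := integrableD measurableT ii1 ii2.
have iD' := iD nu0 tau0.
have isum := integrableD measurableT iD' ii.
have pt t : `|D nu tau t| <= D nu tau t + (8 * K * \1_I1 t + 8 * K * \1_I2 t).
  have J1 : 0 <= 8 * K * (\1_I1 t : R) by rewrite mulr_ge0// mulr_ge0.
  have J2 : 0 <= 8 * K * (\1_I2 t : R) by rewrite mulr_ge0// mulr_ge0.
  have [t1|t1] := ltP `|t| (1 - tau).
    by rewrite (ger0_norm (D_inside nu0 nu1 tau0 t1)); lra.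
  have [t2|t2] := ltP (1 + tau) `|t|.
    by rewrite D_out// normr0; lra.
  have DK := D_edge nu0 tau0 tau1 t1.
  suff : 8 * K <= 8 * K * \1_I1 t + 8 * K * \1_I2 t.
    by move: DK; rewrite -/K ler_norml => /andP[]; have := ler_norm (D nu tau t);
      have [] := ger0P (D nu tau t); lra.
  move: t1 t2; rewrite !indicE !mem_setE !in_itv/=.
  have [t0|t0] := ger0P t => t1 t2.
    have -> : (1 - tau <= t <= 1 + tau) by rewrite t1 t2.
    by move: J1; rewrite indicE mem_setE in_itv/= mulr1 => J1; lra.
  have -> : (- 1 - tau <= t <= - 1 + tau) by apply/andP; split; lra.
  by move: J2; rewrite indicE mem_setE in_itv/= mulr1 => J2; lra.
apply: (@le_trans _ _ (\int[leb]_t (D nu tau t + (8 * K * \1_I1 t + 8 * K * \1_I2 t)))).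
  apply: le_Rintegral => //.
    by have := integrable_norm iD'; apply: eq_integrable.
rewrite RintegralD// intD// add0r RintegralD//.
rewrite !RintegralZl//; [|exact: integrable_indic_itv..].
rewrite !Rintegral_indic_itv; [|lra..].
by rewrite le_eqVlt; apply/orP; left; apply/eqP; ring.
Qed.

Let phase_flip (w : R -> R) u (tau := pi / u) : 0 < u ->
  (forall t, w (t + pi) = - w t) ->
  forall t, w (u * (t + tau)) = - w (u * t).
Proof.
move=> u0 wpi t; rewrite -wpi mulrDr; congr (w (_ + _)).
by rewrite /tau; field; rewrite gt_eqF.
Qed.

(** Take [tau = pi / u], half a period. For the integrand with the additional
    factor [t], the second difference differs from [t] times that of the
    truncated power by [tau] times a first difference, which Hoelder continuity
    bounds by a multiple of [tau `^ nu]. *)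
Lemma osc_second_difference (w : R -> R) nu u : measurable_fun setT w ->
  (forall t, `|w t| <= 1) -> (forall t, w (t + pi) = - w t) ->
  0 < nu -> nu <= 1 -> 2 * pi <= u ->
  `|\int[leb]_t (h nu t * w (u * t))| <= 8 * (pi / u) * (4 * (pi / u)) `^ nu /\
  `|\int[leb]_t (t * h nu t * w (u * t))| <= 17 * (pi / u) * (8 * (pi / u)) `^ nu.
Proof.
move=> mw w1 wpi nu0 nu1 u2.
have p0 : 0 < pi :> R by exact: pi_gt0.
have u0 : 0 < u by apply: lt_le_trans u2; lra.
set tau := pi / u.
have tau0 : 0 < tau by rewrite divr_gt0.
have tau1 : tau <= 2^-1 by rewrite /tau ler_pdivrMr//; lra.
have mwu : measurable_fun setT (fun t => w (u * t)).
  by apply: (measurableT_comp mw); exact: measurable_funM.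
have wu1 t : `|w (u * t)| <= 1 by [].
have wut := phase_flip u0 wpi.
have ID := int_normD nu0 nu1 tau0 tau1.
split.
  have := second_difference_bound (mh nu) mwu (fun t => normh_le1 t nu0)
    (@h_out nu) wu1 wut.
  by move: ID; rewrite /D -/tau; lra.
pose g t := t * h nu t.
have mg : measurable_fun setT g by exact: measurable_funM.
have g_out t : 1 < `|t| -> g t = 0 by move=> t1; rewrite /g h_out// mulr0.
have g1 t : `|g t| <= 1.
  have [t1|t1] := ltP 1 `|t|; first by rewrite g_out// normr0.
  by rewrite /g normrM -[leRHS]mulr1 ler_pM// normh_le1.
have := second_difference_bound mg mwu g1 g_out wu1 wut.
have i2D : leb.-integrable setT (EFin \o (fun t => 2 * `|D nu tau t|)).
  have := integrableZl measurableT 2 (integrable_norm (iD nu0 tau0)).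
  by apply: eq_integrable => // t _; rewrite /= EFinM.
have ic := integrable_indic_cst (- 2) 2 (tau * (8 * tau) `^ nu).
have pt t : `|2 * g t - g (t + tau) - g (t - tau)| <=
    2 * `|D nu tau t| + tau * (8 * tau) `^ nu * \1_(`[(- 2), 2] : set R) t.
  have J : 0 <= tau * (8 * tau) `^ nu by rewrite mulr_ge0 ?powR_ge0// ltW.
  have [t2|t2] := ltP 2 `|t|.
    rewrite !g_out ?mulr0 ?subr0 ?normr0; last 3 first.
    - by have := ler_normD (t - tau) tau; rewrite subrK (gtr0_norm tau0); lra.
    - by have := ler_normB (t + tau) tau; rewrite addrK (gtr0_norm tau0); lra.
    - lra.
    - by apply: addr_ge0; apply: mulr_ge0.
  have -> : 2 * g t - g (t + tau) - g (t - tau) =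
      t * D nu tau t - tau * (h nu (t + tau) - h nu (t - tau)).
    by rewrite /g /D; ring.
  rewrite (le_trans (ler_normB _ _))// lerD//.
    by rewrite normrM ler_wpM2r.
  rewrite indicE mem_setE in_itv/= -ler_norml t2 mulr1 normrM (gtr0_norm tau0).
  rewrite ler_wpM2l ?(ltW tau0)//.
  apply: le_trans (pos_powR_Hoelder _ _ nu0 nu1) _.
  apply: ler_powR_base => //; first exact: ltW.
  have -> : 1 - (t + tau) ^+ 2 - (1 - (t - tau) ^+ 2) = - (4 * tau * t) by ring.
  rewrite normrN normrM (ger0_norm (_ : 0 <= 4 * tau)); last by lra.
  by have := ler_wpM2l (ltW tau0) t2; lra.
move=> /le_trans => /(_ (2 * (32 * tau * (4 * tau) `^ nu) + tau * (8 * tau) `^ nu * 4)).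
have IG : \int[leb]_t `|2 * g t - g (t + tau) - g (t - tau)| <=
    2 * (32 * tau * (4 * tau) `^ nu) + tau * (8 * tau) `^ nu * 4.
  apply: (@le_trans _ _ (\int[leb]_t (2 * `|D nu tau t| +
     tau * (8 * tau) `^ nu * \1_(`[(- 2), 2] : set R) t))).
    apply: le_Rintegral => //; last first.
      by have := integrableD measurableT i2D ic; apply: eq_integrable.
    apply: (@integrable_bounded_support _ 2 4).
    - apply: measurableT_comp => //; apply: measurable_funB; [apply: measurable_funB|].
      + exact: measurable_funM.
      + by apply: (measurableT_comp mg); exact: measurable_funD.
      + by apply: (measurableT_comp mg); exact: measurable_funB.
    - move=> t; rewrite normr_id.
      have := g1 t; have := g1 (t + tau); have := g1 (t - tau).
      by rewrite !ler_norml; lra.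
    - move=> t t2; rewrite !g_out ?mulr0 ?subr0 ?normr0//; last by lra.
      + by have := ler_normD (t - tau) tau; rewrite subrK (gtr0_norm tau0); lra.
      + by have := ler_normB (t + tau) tau; rewrite addrK (gtr0_norm tau0); lra.
  have inD : leb.-integrable setT (EFin \o (fun t => `|D nu tau t|)).
    by have := integrable_norm (iD nu0 tau0); apply: eq_integrable.
  rewrite (RintegralD measurableT i2D ic) (RintegralZl _ measurableT inD).
  rewrite RintegralZl//; last exact: integrable_indic_itv.
  rewrite Rintegral_indic_itv; last by lra.
  by move: ID; lra.
move=> /(_ IG).
have : (4 * tau) `^ nu <= (8 * tau) `^ nu.
  by apply: ler_powR_base; [exact: ltW|lra|lra].
move=> le48; have := ler_wpM2l (ltW tau0) le48; rewrite /g; lra.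
Qed.

End oscillatory.

Section osc_decay.
Context {R : realType}.
Local Notation leb := (@lebesgue_measure R).
Implicit Types nu mu u : R.

(** There is no boundary term since [F] vanishes at the endpoints, where the
    truncated powers need not be differentiable. *)
Lemma Rintegral_by_parts_disc (F G f g : R -> R) :
  continuous F -> continuous f -> continuous G -> continuous g ->
  (forall t : R, 1 <= `|t| -> F t = 0) -> (forall t : R, 1 < `|t| -> f t = 0) ->
  (forall t : R, `|t| < 1 -> is_derive t 1 F (f t)) ->
  (forall t : R, is_derive t 1 G (g t)) ->
  \int[leb]_t (F t * g t) = - \int[leb]_t (f t * G t).
Proof.
move=> cF cf cG cg F0 f0 dF dG.
have restr (k : R -> R) : (forall t : R, 1 < `|t| -> k t = 0) ->
    \int[leb]_t k t = \int[leb]_(t in `[(- 1), 1]) k t.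
  move=> k0; rewrite [RHS]Rintegral_mkcond; apply: eq_Rintegral => t _.
  rewrite patchE mem_setE in_itv/= -ler_norml.
  by case: leP => // /k0.
rewrite (restr (fun t => F t * g t)); last by move=> t t1; rewrite F0 ?mul0r// ltW.
rewrite (restr (fun t => f t * G t)); last by move=> t t1; rewrite f0 ?mul0r.
have LR (k : R -> R) : continuous k -> (forall t : R, `|t| < 1 -> derivable k t 1) ->
    derivable_oo_LRcontinuous k (- 1) 1.
  move=> ck dk; split.
  - by move=> t; rewrite in_itv/= -ltr_norml => /dk.
  - exact/cvg_at_right_filter/ck.
  - exact/cvg_at_left_filter/ck.
rewrite (@Rintegration_by_parts _ F G f g); first last.
- by move=> t _; rewrite derive1E; have [_ ->] := dG t.
- by apply: LR => // t _; have [] := dG t.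
- exact: continuous_subspaceT.
- by move=> t; rewrite in_itv/= -ltr_norml derive1E => t1; have [_ ->] := dF t t1.
- by apply: LR => // t t1; have [] := dF t t1.
- exact: continuous_subspaceT.
- lra.
by rewrite !F0 ?normrN ?normr1// !mul0r subrr sub0r.
Qed.

Let h nu (t : R) := pos_powR (1 - t ^+ 2) nu.

Let ch nu : 0 < nu -> continuous (h nu).
Proof.
move=> nu0 t.
apply: (@cvg_comp _ _ _ (fun t : R => 1 - t ^+ 2) (pos_powR ^~ nu) _
  (nbhs (1 - t ^+ 2))); last exact: continuous_pos_powR.
by apply: cvgB; [exact: cvg_cst|exact: exprn_continuous].
Qed.

Let h_out nu t : 1 < `|t| -> h nu t = 0.
Proof. exact: pos_powR_disc0. Qed.

Let h_edge nu t : 1 <= `|t| -> h nu t = 0.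
Proof.
rewrite le_eqVlt => /predU1P[t1|]; last exact: h_out.
by rewrite /h -(real_normK (num_real t)) -t1 expr1n subrr /pos_powR ltxx.
Qed.

Let pos_disc t : `|t| < 1 -> 0 < 1 - t ^+ 2 :> R.
Proof. by move=> t1; rewrite subr_gt0 -(real_normK (num_real t)) expr_lt1. Qed.

Let dh nu (t : R) : `|t| < 1 -> is_derive t 1 (h nu) (- 2 * nu * (t * h (nu - 1) t)).
Proof.
move=> /pos_disc t1.
have d1 : is_derive t 1 (fun t : R => 1 - t ^+ 2) (- (2 * t)).
  by apply: is_derive_eq; rewrite /GRing.scale /=; ring.
have d2 := is_derive_pos_powR nu t1.
have D : is_derive t 1 (h nu) (nu * (1 - t ^+ 2) `^ (nu - 1) * - (2 * t)) :=
  @is_derive1_comp R (pos_powR ^~ nu) (fun t : R => 1 - t ^+ 2) t _ _ d2 d1.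
by apply: (is_derive_eq D); rewrite /h /pos_powR t1; ring.
Qed.

Let dh2 nu (t : R) : `|t| < 1 ->
  is_derive t 1 (fun t => t * h nu t) (h nu t - 2 * nu * (t ^+ 2 * h (nu - 1) t)).
Proof.
move=> t1; have d := dh nu t1.
have d0 : is_derive t 1 (fun t : R => t) 1 by exact: is_derive_id.
have D := is_deriveM d0 d.
rewrite (_ : (fun t => t * h nu t) = (fun t : R => t) * h nu) //.
by apply: (is_derive_eq D); rewrite /GRing.scale /=; ring.
Qed.

Let normh_le1 nu t : 0 < nu -> `|h nu t| <= 1.
Proof.
move=> nu0; rewrite ger0_norm ?pos_powR_ge0// pos_powR_le1 ?(ltW nu0)//.
by rewrite gerBl sqr_ge0.
Qed.

Definition osc_cos nu u : R := \int[leb]_t (pos_powR (1 - t ^+ 2) nu * cos (u * t)).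
Definition osc_sin nu u : R := \int[leb]_t (t * pos_powR (1 - t ^+ 2) nu * sin (u * t)).

Let cont_scale (w : R -> R) u : continuous w -> continuous (fun t => w (u * t)).
Proof.
move=> cw t; apply: (@continuous_comp _ _ _ ( *%R u) w); last exact: cw.
exact: mulrl_continuous.
Qed.

Let integrable_hw nu (w : R -> R) : 0 < nu -> continuous w -> (forall t, `|w t| <= 1) ->
  leb.-integrable setT (EFin \o (fun t => h nu t * w t)).
Proof.
move=> nu0 cw w1; apply: (@integrable_bounded_support _ 1 1).
- apply: measurable_funM; first exact: measurable_disc_power.
  exact: continuous_measurable_fun.
- by move=> t; rewrite normrM -[leRHS]mulr1 ler_pM// normh_le1.
- by move=> t t1; rewrite h_out// mul0r.
Qed.

Let d_sin u (t : R) : 0 < u -> is_derive t 1 (fun t : R => sin (u * t) / u) (cos (u * t)).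
Proof.
move=> u0.
have d1 : is_derive t 1 (fun t : R => u * t) u.
  by apply: is_derive_eq; rewrite /GRing.scale /=; ring.
have d2 : is_derive t 1 (fun t : R => sin (u * t)) (u * cos (u * t)).
  have D : is_derive t 1 (fun t : R => sin (u * t)) (cos (u * t) * u) :=
    @is_derive1_comp R sin ( *%R u) t _ _ (is_derive_sin (u * t)) d1.
  by apply: (is_derive_eq D); ring.
apply: is_derive_eq; rewrite /GRing.scale /=; field; exact: lt0r_neq0.
Qed.

Let d_cos u (t : R) : 0 < u -> is_derive t 1 (fun t : R => - (cos (u * t) / u)) (sin (u * t)).
Proof.
move=> u0.
have d1 : is_derive t 1 (fun t : R => u * t) u.
  by apply: is_derive_eq; rewrite /GRing.scale /=; ring.
have d2 : is_derive t 1 (fun t : R => cos (u * t)) (- u * sin (u * t)).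
  have D : is_derive t 1 (fun t : R => cos (u * t)) (- sin (u * t) * u) :=
    @is_derive1_comp R cos ( *%R u) t _ _ (is_derive_cos (u * t)) d1.
  by apply: (is_derive_eq D); ring.
apply: is_derive_eq; rewrite /GRing.scale /=; field; exact: lt0r_neq0.
Qed.

(** Integration by parts: one unit of the exponent is exchanged for a factor [1
    / u]. *)
Lemma osc_cos_step mu u : 1 < mu -> 0 < u ->
  osc_cos mu u = 2 * mu / u * osc_sin (mu - 1) u.
Proof.
move=> mu1 u0; rewrite /osc_cos.
have mu0 : 0 < mu - 1 by rewrite subr_gt0.
have cF : continuous (h mu) by apply: ch; lra.
have cf : continuous (fun t : R => - 2 * mu * (t * h (mu - 1) t)).
  move=> t; apply: cvgM; first exact: cvg_cst.
  by apply: cvgM; [exact: cvg_id|exact: ch].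
have cG : continuous (fun t : R => sin (u * t) / u : R).
  move=> t; apply: cvgM; last exact: cvg_cst.
  by apply: cont_scale; exact: continuous_sin.
have cg : continuous (fun t : R => cos (u * t) : R).
  by apply: cont_scale; exact: continuous_cos.
have f0 (t : R) : 1 < `|t| -> - 2 * mu * (t * h (mu - 1) t) = 0.
  by move=> t1; rewrite h_out// !mulr0.
apply: (etrans (Rintegral_by_parts_disc cF cf cG cg (@h_edge mu) f0
  (@dh mu) (fun t => d_sin t u0))).
rewrite -[LHS]mulN1r -RintegralZl//; last first.
    apply: (@integrable_bounded_support _ 1 (2 * mu / u)).
    + apply: measurable_funM.
        apply: measurable_funM; first exact: measurable_cst.
        by apply: measurable_funM => //; exact: measurable_disc_power.
      apply: measurable_funM; last exact: measurable_cst.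
      by apply: continuous_measurable_fun; apply: cont_scale; exact: continuous_sin.
    + move=> t; have [t1|t1] := ltP 1 `|t|.
        by rewrite h_out// !mulr0 mul0r normr0 divr_ge0 ?(ltW u0)// mulr_ge0; lra.
      rewrite !normrM normrN (ger0_norm (_ : 0 <= 2 :> R))// (gtr0_norm (_ : 0 < mu)); last by lra.
      rewrite normfV (gtr0_norm u0) mulrA ler_pM2r ?invr_gt0//.
      rewrite -[leRHS]mulr1 ler_pM ?mulr_ge0//; last exact: sin_max.
        by lra.
      rewrite -[leRHS]mulr1 ler_pM ?mulr_ge0//; first by lra.
      by rewrite -[leRHS]mulr1 ler_pM// normh_le1.
    + by move=> t t1; rewrite h_out// !mulr0 mul0r.
  rewrite /osc_sin -RintegralZl//; last first.
    apply: (@integrable_bounded_support _ 1 1).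
    + apply: measurable_funM.
        by apply: measurable_funM => //; exact: measurable_disc_power.
      by apply: continuous_measurable_fun; apply: cont_scale; exact: continuous_sin.
    + move=> t; have [t1|t1] := ltP 1 `|t|.
        by rewrite -/(h _ t) h_out// mulr0 mul0r normr0.
      rewrite !normrM -[leRHS]mulr1 ler_pM ?mulr_ge0//; last exact: sin_max.
      by rewrite -[leRHS]mulr1 ler_pM//; exact: normh_le1.
    + by move=> t t1; rewrite -/(h _ t) h_out// mulr0 mul0r.
  apply: eq_Rintegral => t _; rewrite -/(h _ _); field; exact: lt0r_neq0.
Qed.

(** Integration by parts, followed by [t^2 (1 - t^2)^(nu - 1) = (1 - t^2)^(nu -
    1) - (1 - t^2)^nu], which removes the factor [t^2] created by the
    derivative. *)
Lemma osc_sin_step nu u : 1 < nu -> 0 < u ->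
  osc_sin nu u = ((1 + 2 * nu) * osc_cos nu u - 2 * nu * osc_cos (nu - 1) u) / u.
Proof.
move=> nu1 u0; rewrite /osc_sin.
have nu0 : 0 < nu - 1 by rewrite subr_gt0.
have nu00 : 0 < nu by lra.
have cc : continuous (fun t : R => cos (u * t) : R).
  by apply: cont_scale; exact: continuous_cos.
have i1 := integrable_hw nu00 cc (fun t => cos_max (u * t)).
have i2 := integrable_hw nu0 cc (fun t => cos_max (u * t)).
have j1 : leb.-integrable setT (EFin \o (fun t => (1 + 2 * nu) / u * (h nu t * cos (u * t)))).
  by have := integrableZl measurableT ((1 + 2 * nu) / u) i1;
    apply: eq_integrable => // t _; rewrite /= EFinM.
have j2 : leb.-integrable setT (EFin \o (fun t => 2 * nu / u * (h (nu - 1) t * cos (u * t)))).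
  by have := integrableZl measurableT (2 * nu / u) i2;
    apply: eq_integrable => // t _; rewrite /= EFinM.
(* Both sides vanish off the open interval, by the definition of [h]. *)
have red t : t ^+ 2 * h (nu - 1) t = h (nu - 1) t - h nu t.
  rewrite /h /pos_powR; case: ifPn => t1; last by rewrite mulr0 subrr.
  have := mulr_powRB1 (ltW t1) nu00; lra.
have cF : continuous (fun t : R => t * h nu t).
  by move=> t; apply: cvgM; [exact: cvg_id|exact: ch].
have cf : continuous (fun t : R => h nu t - 2 * nu * (t ^+ 2 * h (nu - 1) t)).
  move=> t; apply: cvgB; first exact: ch.
  apply: cvgM; first exact: cvg_cst.
  by apply: cvgM; [exact: exprn_continuous|exact: ch].
have cG : continuous (fun t : R => - (cos (u * t) / u) : R).
  by move=> t; apply: cvgN; apply: cvgM; [exact: cc|exact: cvg_cst].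
have cg : continuous (fun t : R => sin (u * t) : R).
  by apply: cont_scale; exact: continuous_sin.
have F0 (t : R) : 1 <= `|t| -> t * h nu t = 0.
  by move=> t1; rewrite h_edge// mulr0.
have f0 (t : R) : 1 < `|t| -> h nu t - 2 * nu * (t ^+ 2 * h (nu - 1) t) = 0.
  by move=> t1; rewrite !h_out// !mulr0 subr0.
apply: (etrans (Rintegral_by_parts_disc cF cf cG cg F0 f0
  (@dh2 nu) (fun t => d_cos t u0))).
transitivity (\int[leb]_t ((1 + 2 * nu) / u * (h nu t * cos (u * t)) -
      2 * nu / u * (h (nu - 1) t * cos (u * t)))).
    rewrite -[LHS]mulN1r -RintegralZl//.
      by apply: eq_Rintegral => t _; rewrite red; field; exact: lt0r_neq0.
    have := integrableN (integrableB measurableT j1 j2).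
    apply: eq_integrable => // t _ /=; rewrite red; congr EFin.
    by field; exact: lt0r_neq0.
  rewrite RintegralB// RintegralZl// RintegralZl// /osc_cos.
  by field; exact: lt0r_neq0.
Qed.

Let osc_trivial nu (w : R -> R) : 0 < nu -> measurable_fun setT w ->
  (forall t, `|t| <= 1 -> `|w t| <= 1) -> `|\int[leb]_t (h nu t * w t)| <= 2.
Proof.
move=> nu0 mw w1.
have hw1 t : `|h nu t * w t| <= 1 * \1_(`[(- 1), 1] : set R) t.
  rewrite indicE mem_setE in_itv/= -ler_norml.
  have [t1|t1] := leP `|t| 1.
    by rewrite normrM mulr1 -[leRHS]mulr1 ler_pM// ?normh_le1// w1.
  by rewrite h_out// mul0r normr0 mulr0.
have hw2 t : `|h nu t * w t| <= 1.
  by apply: le_trans (hw1 t) _; rewrite mul1r indicE; case: (_ \in _).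
have mhw : measurable_fun setT (fun t => h nu t * w t).
  by apply: measurable_funM => //; exact: measurable_disc_power.
have ii : leb.-integrable setT (EFin \o (fun t => h nu t * w t)).
  apply: (@integrable_bounded_support _ 1 1) => // t t1.
  by rewrite h_out// mul0r.
rewrite (le_trans (le_normr_Rintegral measurableT ii))//.
apply: (@le_trans _ _ (\int[leb]_t (1 * \1_(`[(- 1), 1] : set R) t))).
  apply: le_Rintegral => //.
    by have := integrable_norm ii; apply: eq_integrable.
  exact: integrable_indic_cst.
rewrite RintegralZl//; last exact: integrable_indic_itv.
by rewrite Rintegral_indic_itv; lra.
Qed.

Lemma osc_cos_le2 nu u : 0 < nu -> `|osc_cos nu u| <= 2.
Proof.
move=> nu0; apply: osc_trivial => //; last by move=> t _; exact: cos_max.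
by apply: continuous_measurable_fun; apply: cont_scale; exact: continuous_cos.
Qed.

Lemma osc_sin_le2 nu u : 0 < nu -> `|osc_sin nu u| <= 2.
Proof.
move=> nu0; rewrite /osc_sin.
under eq_Rintegral do rewrite mulrAC mulrC.
apply: osc_trivial => //.
  apply: measurable_funM => //.
  by apply: continuous_measurable_fun; apply: cont_scale; exact: continuous_sin.
by move=> t t1; rewrite normrM -[leRHS]mulr1 ler_pM// sin_max.
Qed.

Let base_decay (J : R -> R) nu c : 0 < nu -> 0 <= c ->
  (forall u, `|J u| <= 2) ->
  (forall u, 2 * pi <= u -> `|J u| <= c * (pi / u) * (8 * (pi / u)) `^ nu) ->
  exists2 C, 0 <= C & forall u, 1 <= u -> `|J u| <= C * u `^ (- (1 + nu)).
Proof.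
move=> nu0 c0 J2 Jc; have p0 : 0 < pi :> R by exact: pi_gt0.
(* [C1] serves [2 pi <= u], and [C2] the remaining interval, where [|J u| <= 2]. *)
pose C1 := c * pi * (8 * pi) `^ nu; pose C2 := 2 * (2 * pi) `^ (1 + nu) : R.
have C10 : 0 <= C1 by rewrite mulr_ge0 ?powR_ge0// mulr_ge0 ?(ltW p0).
have C20 : 0 <= C2 by rewrite mulr_ge0 ?powR_ge0.
exists (C1 + C2); first exact: addr_ge0.
move=> u u1; have u0 : 0 < u by lra.
have pu : 0 <= u `^ (- (1 + nu)) by exact: powR_ge0.
rewrite mulrDl; have [u2|u2] := leP (2 * pi) u.
  apply: le_trans (Jc u u2) _.
  rewrite -[leLHS]addr0 lerD ?(mulr_ge0 C20 pu)// le_eqVlt; apply/orP; left; apply/eqP.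
  have -> : 8 * (pi / u) = (8 * pi) * u^-1 by rewrite mulrA.
  rewrite powRM ?invr_ge0 ?mulr_ge0 ?(ltW p0) ?(ltW u0)//.
  rewrite -(powR_inv1 (ltW u0)) -powRrM mulN1r /C1.
  rewrite opprD powRD ?(gt_eqF u0) ?implybT//; ring.
apply: le_trans (J2 u) _.
rewrite -[leLHS]add0r lerD ?(mulr_ge0 C10 pu)// /C2 -mulrA ler_peMr//.
rewrite powRN -ler_pdivrMr ?invr_gt0 ?powR_gt0// invrK mul1r.
by apply: ler_powR_base; lra.
Qed.

Lemma osc_decay01 nu : 0 < nu -> nu <= 1 ->
  (exists2 C, 0 <= C & forall u, 1 <= u -> `|osc_cos nu u| <= C * u `^ (- (1 + nu))) /\
  (exists2 C, 0 <= C & forall u, 1 <= u -> `|osc_sin nu u| <= C * u `^ (- (1 + nu))).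
Proof.
move=> nu0 nu1; have p0 : 0 < pi :> R by exact: pi_gt0.
split; [apply: (@base_decay _ _ 8)|apply: (@base_decay _ _ 17)] => //.
- by move=> u; exact: osc_cos_le2.
- move=> u u2.
  have [||H _] := @osc_second_difference R cos nu u _ (@cos_max R) _ nu0 nu1 u2.
  + by apply: continuous_measurable_fun; exact: continuous_cos.
  + by move=> t; rewrite cosDpi.
  apply: le_trans H _.
  have pu : 0 <= pi / u by rewrite divr_ge0 ?(ltW p0)//; lra.
  by rewrite ler_wpM2l ?(mulr_ge0 _ pu)//; apply: ler_powR_base; lra.
- by move=> u; exact: osc_sin_le2.
- move=> u u2.
  have [||_ H] := @osc_second_difference R sin nu u _ (@sin_max R) _ nu0 nu1 u2 => //.
  + by apply: continuous_measurable_fun; exact: continuous_sin.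
  + by move=> t; rewrite sinDpi.
Qed.

(** Induction on the integer part of [nu] through the two recurrences. The step
    for the cosine integral uses the sine integral at [nu - 1]; the step for
    the sine integral uses the cosine integral both at [nu - 1] and, just
    bounded, at [nu]. *)
Lemma osc_decay nu : 0 < nu ->
  (exists2 C, 0 <= C & forall u, 1 <= u -> `|osc_cos nu u| <= C * u `^ (- (1 + nu))) /\
  (exists2 C, 0 <= C & forall u, 1 <= u -> `|osc_sin nu u| <= C * u `^ (- (1 + nu))).
Proof.
suff H n : forall nu, 0 < nu -> nu <= n.+1%:R ->
  (exists2 C, 0 <= C & forall u, 1 <= u -> `|osc_cos nu u| <= C * u `^ (- (1 + nu))) /\
  (exists2 C, 0 <= C & forall u, 1 <= u -> `|osc_sin nu u| <= C * u `^ (- (1 + nu))).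
  move=> nu0; apply: (H (Num.truncn nu)) => //.
  by have := truncnS_gt nu; exact: ltW.
elim: n => [|n IH] {}nu nu0 nun; first exact: osc_decay01.
have [nu1|nu1] := leP nu 1; first exact: osc_decay01.
have [||[Cc Cc0 Hc] [Cs Cs0 Hs]] := IH (nu - 1).
- lra.
- by rewrite lerBlDr natr1.
have cosD : forall u, 1 <= u -> `|osc_cos nu u| <= (2 * nu * Cs) * u `^ (- (1 + nu)).
  move=> u u1; have u0 : 0 < u by lra.
  rewrite osc_cos_step// normrM ger0_norm; last by rewrite divr_ge0 ?mulr_ge0//; lra.
  apply: (@le_trans _ _ (2 * nu / u * (Cs * u `^ (- (1 + (nu - 1)))))).
    by rewrite ler_wpM2l ?Hs// divr_ge0 ?mulr_ge0//; lra.
  rewrite subrKC opprD powRD ?(gt_eqF u0) ?implybT//.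
  rewrite powR_inv1 ?(ltW u0)// le_eqVlt; apply/orP; left; apply/eqP; ring.
split.
  by exists (2 * nu * Cs) => //; rewrite mulr_ge0// mulr_ge0// ltW.
exists ((1 + 2 * nu) * (2 * nu * Cs) + 2 * nu * Cc).
  by rewrite addr_ge0 ?mulr_ge0//; lra.
move=> u u1; have u0 : 0 < u by lra.
rewrite osc_sin_step// normrM normfV (gtr0_norm u0).
have p0 : 0 < u `^ (- nu) by rewrite powR_gt0.
have pE : u `^ (- (1 + nu)) = u `^ (- nu) / u.
  by rewrite opprD addrC powRD ?(gt_eqF u0) ?implybT// powR_inv1// ltW.
rewrite pE [leRHS]mulrA ler_pM2r ?invr_gt0//.
have c1 := cosD u u1; have c2 := Hc u u1; rewrite subrKC in c2.
rewrite (le_trans (ler_normB _ _))// [leRHS]mulrDl lerD//.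
  rewrite normrM ger0_norm; last by lra.
  rewrite -[leRHS]mulrA ler_wpM2l//; first by lra.
  apply: le_trans c1 _; rewrite ler_wpM2l ?mulr_ge0//; first by lra.
  by rewrite pE ler_pdivrMr// ler_peMr// ltW.
rewrite normrM ger0_norm; last by lra.
by rewrite -[leRHS]mulrA ler_wpM2l//; lra.
Qed.

End osc_decay.

(** * The Bochner-Riesz kernel *)

Section signed_radial.
Context {R : realType}.
Local Notation leb := (@lebesgue_measure R).

Lemma Rintegral_opp (f : R -> R) : measurable_fun setT f ->
  \int[leb]_t f (- t) = \int[leb]_t f t.
Proof.
move=> mf; rewrite /Rintegral integralE [in RHS]integralE.
have mfE : measurable_fun setT (EFin \o f) by exact/measurable_EFinP.
have e1 := ge0_integral_opp (measurable_funepos mfE)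
  (fun t => funepos_ge0 (EFin \o f) t).
have e2 := ge0_integral_opp (measurable_funeneg mfE)
  (fun t => funeneg_ge0 (EFin \o f) t).
have -> : (\int[leb]_t (fun t => (f (- t))%:E)^\+ t = \int[leb]_t (EFin \o f)^\+ t)%E.
  by apply: etrans e1; apply: eq_integral => t _; rewrite !funeposE.
have -> // : (\int[leb]_t (fun t => (f (- t))%:E)^\- t = \int[leb]_t (EFin \o f)^\- t)%E.
by apply: etrans e2; apply: eq_integral => t _; rewrite !funenegE.
Qed.

Lemma measurable_br_symbol n (lam rho : R) : measurable_fun setT
  (fun xi : Rn R n => pos_powR (1 - enorm (tscale rho^-1 xi) ^+ 2) lam).
Proof.
apply: measurable_fun_pos_powR; apply: measurable_funB; first exact: measurable_cst.
apply: measurable_funX; apply: measurable_fun_enorm.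
by apply: measurable_fun_tscale; [exact: measurable_cst|exact: measurable_id].
Qed.

Lemma br_symbolE n (lam rho : R) (xi : Rn R n) : 0 < rho ->
  pos_powR (1 - enorm (tscale rho^-1 xi) ^+ 2) lam =
  rho `^ (- (2 * lam)) * pos_powR (rho ^+ 2 - dotp xi xi) lam.
Proof.
move=> rho0; have r2 : 0 < rho ^+ 2 by rewrite exprn_gt0.
rewrite sqr_enorm.
have -> : dotp (tscale rho^-1 xi) (tscale rho^-1 xi) = dotp xi xi / rho ^+ 2.
  rewrite /dotp mulr_suml; apply: eq_bigr => i _; rewrite !tnth_mktuple.
  by field; rewrite gt_eqF.
have -> : 1 - dotp xi xi / rho ^+ 2 = (rho ^+ 2 - dotp xi xi) / rho ^+ 2.
  by field; rewrite gt_eqF.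
rewrite /pos_powR pmulr_lgt0 ?invr_gt0//; case: ifPn => x0; last by rewrite mulr0.
rewrite powRM ?(ltW x0)// ?invr_ge0 ?(ltW r2)// mulrC; congr (_ * _).
by rewrite -(powR_inv1 (ltW r2)) -(powR_mulrn 2 (ltW rho0)) -!powRrM; congr powR; ring.
Qed.

Lemma integral_br_symbol n (lam rho : R) (E : R -> \bar R) (x : Rn R n.+1) :
  0 <= lam -> 0 < rho -> measurable_fun setT E -> (forall t, 0 <= E t)%E ->
  (\int[lebesgueRn R n.+1]_xi
    ((pos_powR (1 - enorm (tscale rho^-1 xi) ^+ 2) lam)%:E * E (dotp x xi)) =
  (radial_const n lam * rho ^+ n.+1)%:E *
  \int[leb]_t ((pos_powR (1 - t ^+ 2) (lam + n%:R / 2))%:E * E (rho * enorm x * t)%R))%E.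
Proof.
move=> lam0 rho0 mE E0.
set mu := lam + n%:R / 2.
have mu0 : 0 <= mu by rewrite addr_ge0// divr_ge0.
transitivity (\int[lebesgueRn R n.+1]_xi ((rho `^ (- (2 * lam)))%:E *
   ((pos_powR (rho ^+ 2 - dotp xi xi) lam)%:E * E (dotp x xi))))%E.
  by apply: eq_integral => xi _; rewrite br_symbolE// EFinM muleA.
rewrite ge0_integralZl//; last 3 first.
- apply: emeasurable_funM.
    apply/measurable_EFinP; apply: measurable_fun_pos_powR.
    apply: measurable_funB; first exact: measurable_cst.
    by apply: measurable_fun_dotp; exact: measurable_id.
  apply: (measurableT_comp mE); apply: measurable_fun_dotp.
    exact: measurable_cst.
  exact: measurable_id.
- by move=> xi _; rewrite mule_ge0// lee_fin pos_powR_ge0.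
- by rewrite lee_fin powR_ge0.
rewrite integral_radial//.
pose G (t : R) : \bar R := ((pos_powR (rho ^+ 2 - t ^+ 2) mu)%:E * E (enorm x * t)%R)%E.
have mG : measurable_fun setT G.
  apply: emeasurable_funM; first by apply/measurable_EFinP; exact: measurable_disc_power.
  by apply: (measurableT_comp mE); exact: measurable_funM.
have G0 t : (0 <= G t)%E by rewrite mule_ge0// lee_fin pos_powR_ge0.
have IG : (\int[leb]_t G t = rho%:E * \int[leb]_t G (rho * t + 0)%R)%E.
  rewrite (ge0_integral_affine 0 rho0 mG G0) muleA -EFinM mulfV ?gt_eqF//.
  by rewrite mul1e.
rewrite -/mu IG {IG}.
pose F (t : R) : \bar R :=
  ((pos_powR (1 - t ^+ 2) mu)%:E * E (rho * enorm x * t)%R)%E.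
have IF : (\int[leb]_t ((rho `^ (2 * mu))%:E * F t) =
    (rho `^ (2 * mu))%:E * \int[leb]_t F t)%E.
  apply: ge0_integralZl => //.
  - apply: emeasurable_funM; first by apply/measurable_EFinP; exact: measurable_disc_power.
    by apply: (measurableT_comp mE); exact: measurable_funM.
  - by move=> t _; rewrite mule_ge0// lee_fin pos_powR_ge0.
  - by rewrite lee_fin powR_ge0.
transitivity ((radial_const n lam * rho ^+ n.+1)%:E * \int[leb]_t F t)%E; last by [].
transitivity ((rho `^ (- (2 * lam)))%:E * ((radial_const n lam)%:E * (rho%:E *
  \int[leb]_t ((rho `^ (2 * mu))%:E * F t))))%E.
  do 3 apply: (@congr1 _ _ (mule _)).
  apply: eq_integral => t _; rewrite /G /F addr0 muleA -EFinM.
  have -> : rho ^+ 2 - (rho * t) ^+ 2 = rho ^+ 2 * (1 - t ^+ 2) by ring.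
  have -> : enorm x * (rho * t) = rho * enorm x * t by ring.
  suff -> : pos_powR (rho ^+ 2 * (1 - t ^+ 2)) mu =
            rho `^ (2 * mu) * pos_powR (1 - t ^+ 2) mu by [].
  have r2 : 0 < rho ^+ 2 by rewrite exprn_gt0.
  rewrite /pos_powR pmulr_rgt0//; case: ifPn => t0; last by rewrite mulr0.
  rewrite powRM ?(ltW t0) ?(ltW r2)//; congr (_ * _).
  by rewrite -(powR_mulrn 2 (ltW rho0)) -powRrM.
rewrite IF.
rewrite !muleA -!EFinM.
apply: (@congr1 _ _ (fun z : R => z%:E * \int[leb]_t F t)%E).
rewrite -mulrA -mulrA mulrCA; congr (_ * _).
rewrite -{2}(powRr1 (ltW rho0)) -!powRD ?(gt_eqF rho0) ?implybT//.
rewrite -powR_mulrn ?(ltW rho0)//; congr powR; rewrite /mu -[n.+1%:R]natr1; lra.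
Qed.

Lemma integral_br_symbol1 n (lam rho : R) : 0 <= lam -> 0 < rho ->
  (\int[lebesgueRn R n.+1]_xi
    (pos_powR (1 - enorm (tscale rho^-1 xi) ^+ 2) lam)%:E =
  (radial_const n lam * rho ^+ n.+1)%:E *
  \int[leb]_t (pos_powR (1 - t ^+ 2) (lam + n%:R / 2))%:E)%E.
Proof.
move=> lam0 rho0.
have := integral_br_symbol (E := cst 1%E) [tuple 0 | i < n.+1] lam0 rho0
  (measurable_cst _) (fun=> lee01).
under eq_integral do rewrite /= mule1.
by under [in X in _ = X -> _]eq_integral do rewrite /= mule1.
Qed.

Lemma integrable_disc_power (mu : R) : 0 <= mu ->
  leb.-integrable setT (EFin \o (fun t => pos_powR (1 - t ^+ 2) mu)).
Proof.
move=> mu0; apply: (@integrable_bounded_support _ 1 1).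
- exact: measurable_disc_power.
- move=> t; rewrite ger0_norm ?pos_powR_ge0// pos_powR_le1//.
  by rewrite gerBl sqr_ge0.
- by move=> t; exact: pos_powR_disc0.
Qed.

Lemma integrable_br_symbol n (lam rho : R) : 0 <= lam -> 0 < rho ->
  (lebesgueRn R n.+1).-integrable setT
    (EFin \o (fun xi => pos_powR (1 - enorm (tscale rho^-1 xi) ^+ 2) lam)).
Proof.
move=> lam0 rho0; apply/integrableP; split.
  by apply/measurable_EFinP; exact: measurable_br_symbol.
under eq_integral do rewrite /= ger0_norm ?pos_powR_ge0//.
rewrite integral_br_symbol1// lte_mul_pinfty//.
- by rewrite lee_fin mulr_ge0 ?radial_const_ge0// exprn_ge0// ltW.
- by rewrite line_mass_fin// addr_ge0// divr_ge0.
Qed.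

(** Since [1 + w] is nonnegative, this brings an oscillating integral within
    reach of identities proved for nonnegative integrands. *)
Lemma Rintegral_bounded_factor d (T : measurableType d)
    (m : {measure set T -> \bar R}) (g w : T -> R) :
  m.-integrable setT (EFin \o g) -> measurable_fun setT w ->
  (forall x, 0 <= g x) -> (forall x, `|w x| <= 1) ->
  \int[m]_x (g x * w x) =
  fine (\int[m]_x ((g x)%:E * (1 + w x)%:E))%E - fine (\int[m]_x (g x)%:E)%E.
Proof.
move=> ig mw g0 w1.
have mg : measurable_fun setT g by case/integrableP : (ig) => /measurable_EFinP.
have igw : m.-integrable setT (EFin \o (fun x => g x * w x)).
  apply: le_integrable ig => //.
    apply/measurable_EFinP; exact: measurable_funM.
  by move=> x _; rewrite /= lee_fin normrM ler_piMr.
have -> : fine (\int[m]_x ((g x)%:E * (1 + w x)%:E))%E =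
    \int[m]_x (g x + g x * w x).
  by congr fine; apply: eq_integral => x _; rewrite -EFinM mulrDr mulr1.
by rewrite RintegralD//; rewrite addrC addKr.
Qed.

Lemma Rintegral_br_symbol n (lam rho : R) (w : R -> R) (x : Rn R n.+1) :
  0 <= lam -> 0 < rho -> measurable_fun setT w -> (forall t, `|w t| <= 1) ->
  \int[lebesgueRn R n.+1]_xi
    (pos_powR (1 - enorm (tscale rho^-1 xi) ^+ 2) lam * w (dotp x xi)) =
  radial_const n lam * rho ^+ n.+1 *
  \int[leb]_t (pos_powR (1 - t ^+ 2) (lam + n%:R / 2) * w (rho * enorm x * t)).
Proof.
move=> lam0 rho0 mw w1.
have mu0 : 0 <= lam + n%:R / 2 by rewrite addr_ge0// divr_ge0.
rewrite Rintegral_bounded_factor; last 4 first.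
- exact: integrable_br_symbol.
- apply: (measurableT_comp mw); apply: measurable_fun_dotp.
    exact: measurable_cst.
  exact: measurable_id.
- by move=> xi; exact: pos_powR_ge0.
- by move=> xi.
rewrite Rintegral_bounded_factor; last 4 first.
- exact: integrable_disc_power.
- by apply: (measurableT_comp mw); exact: measurable_funM.
- by move=> t; exact: pos_powR_ge0.
- by move=> t.
have w0 t : 0 <= 1 + w t by move: (w1 t); rewrite ler_norml; lra.
have mE : measurable_fun setT (fun t => (1 + w t)%:E).
  by apply/measurable_EFinP; exact: measurable_funD.
rewrite (integral_br_symbol x lam0 rho0 mE); last by move=> t; rewrite lee_fin.
rewrite integral_br_symbol1// !fineM//; first by rewrite mulrBr.
- exact/integrable_fin_num/integrable_disc_power.
- have i1 := integrable_disc_power mu0.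
  have i2 : leb.-integrable setT (fun t => (pos_powR (1 - t ^+ 2) (lam + n%:R / 2))%:E *
      (1 + w (rho * enorm x * t))%:E)%E.
    apply: (le_integrable _ _ _ (integrableZl measurableT 2 i1)) => //.
      apply: emeasurable_funM; first by apply/measurable_EFinP; exact: measurable_disc_power.
      by apply: (measurableT_comp mE); exact: measurable_funM.
    move=> t _; rewrite /= !lee_fin !normrM mulrC ler_wpM2r//.
    by rewrite ger0_norm// ger0_norm//; move: (w1 (rho * enorm x * t)); rewrite ler_norml; lra.
  exact: integrable_fin_num.
Qed.

(** The cosine and sine parts of the exponential are both covered by
    [integral_radial]; the sine part vanishes because its integrand on the line
    is odd. *)
Theorem br_kernelE n (lam rho : R) (x : Rn R n.+1) : 0 <= lam -> 0 < rho ->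
  br_kernel lam rho x =
  ((radial_const n lam * rho ^+ n.+1 *
    osc_cos (lam + n%:R / 2) (2 * pi * (rho * enorm x)))%:C)%C.
Proof.
move=> lam0 rho0; rewrite /br_kernel /inv_fourier /cintegral.
have ReE (xi : Rn R n.+1) : complex.Re (br_multiplier lam rho xi * expi (2 * pi * dotp x xi)) =
    pos_powR (1 - enorm (tscale rho^-1 xi) ^+ 2) lam * cos (2 * pi * dotp x xi).
  by rewrite /br_multiplier /expi /= mul0r subr0.
have ImE (xi : Rn R n.+1) : complex.Im (br_multiplier lam rho xi * expi (2 * pi * dotp x xi)) =
    pos_powR (1 - enorm (tscale rho^-1 xi) ^+ 2) lam * sin (2 * pi * dotp x xi).
  by rewrite /br_multiplier /expi /= mul0r addr0.
under eq_Rintegral do rewrite ReE.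
under [in X in (_ +i* X)%C]eq_Rintegral do rewrite ImE.
rewrite (@Rintegral_br_symbol n lam rho (fun t => cos (2 * pi * t)))//; last 2 first.
- by apply: continuous_measurable_fun => t; apply: (@continuous_comp _ _ _ ( *%R (2 * pi)) cos);
    [exact: mulrl_continuous|exact: continuous_cos].
- by move=> t; exact: cos_max.
rewrite (@Rintegral_br_symbol n lam rho (fun t => sin (2 * pi * t)))//; last 2 first.
- by apply: continuous_measurable_fun => t; apply: (@continuous_comp _ _ _ ( *%R (2 * pi)) sin);
    [exact: mulrl_continuous|exact: continuous_sin].
- by move=> t; exact: sin_max.
congr (_ +i* _)%C.
  congr (_ * _); apply: eq_Rintegral => t _; congr (_ * cos _); ring.
set I := \int[leb]_t _.
suff -> : I = 0 by rewrite mulr0.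
have mf : measurable_fun setT (fun t : R => pos_powR (1 - t ^+ 2) (lam + n%:R / 2) *
    sin (2 * pi * (rho * enorm x * t))).
  apply: measurable_funM; first exact: measurable_disc_power.
  rewrite (_ : (fun t => _) = (fun t => sin (2 * pi * (rho * enorm x) * t))); last first.
    by apply/funext => t; congr sin; ring.
  by apply: continuous_measurable_fun => t; apply: (@continuous_comp _ _ _ ( *%R (2 * pi * (rho * enorm x))) sin);
    [exact: mulrl_continuous|exact: continuous_sin].
have mu0 : 0 <= lam + n%:R / 2 by rewrite addr_ge0// divr_ge0.
have ii : leb.-integrable setT (EFin \o (fun t => pos_powR (1 - t ^+ 2) (lam + n%:R / 2) *
    sin (2 * pi * (rho * enorm x * t)))).
  apply: le_integrable (integrable_disc_power mu0) => //; first exact/measurable_EFinP.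
  by move=> t _; rewrite /= lee_fin normrM ler_piMr// sin_max.
have := Rintegral_opp mf.
under eq_Rintegral do rewrite sqrrN mulrN mulrN sinN mulrN -mulN1r.
rewrite RintegralZl// -/I mulN1r => IN.
by move: IN; lra.
Qed.

End signed_radial.

Section kernel_bounds.
Context {R : realType}.
Local Notation leb := (@lebesgue_measure R).

(** Replacing [u] by [1 + u] merges the decay for large [u] with the trivial
    bound for small [u]. *)
Lemma osc_cos_bound (mu : R) : 0 < mu -> exists2 C : R, 0 < C &
  forall u, 0 <= u -> `|osc_cos mu u| <= C * (1 + u) `^ (- (1 + mu)).
Proof.
move=> mu0; have [[C C0 HC] _] := osc_decay mu0.
pose K := 2 `^ (1 + mu) : R.
have K0 : 0 < K by rewrite powR_gt0.
exists ((C + 2) * K); first by rewrite mulr_gt0//; lra.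
move=> u u0; have u10 : 0 < 1 + u by lra.
have p0 : 0 < (1 + u) `^ (1 + mu) by rewrite powR_gt0.
rewrite powRN ler_pdivlMr//.
have [u1|u1] := leP u 1.
  apply: (@le_trans _ _ (2 * K)).
    rewrite ler_pM ?osc_cos_le2//; first exact: ltW.
    by apply: ler_powR_base; lra.
  by rewrite ler_wpM2r ?(ltW K0)//; lra.
have upos : 0 < u by lra.
apply: (@le_trans _ _ (C * u `^ (- (1 + mu)) * (K * u `^ (1 + mu)))).
  rewrite ler_pM ?(ltW p0)//; first by apply: HC; exact: ltW.
  rewrite -powRM ?(ltW upos)//; apply: ler_powR_base; lra.
rewrite mulrACA [X in X * _]mulrC powRN.
have -> : K * C * ((u `^ (1 + mu))^-1 * u `^ (1 + mu)) = K * C.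
  by rewrite mulVf ?mulr1// gt_eqF// powR_gt0.
by rewrite mulrC ler_wpM2r ?(ltW K0)//; lra.
Qed.

Lemma cos_Lipschitz (a b : R) : `|cos a - cos b| <= `|a - b|.
Proof.
wlog ab : a b / a <= b.
  move=> H; have [|/ltW ba] := leP a b; first exact: H.
  by rewrite distrC [X in _ <= X]distrC; exact: H.
move: ab; rewrite le_eqVlt => /predU1P[->|ab]; first by rewrite !subrr.
have [] := @MVT R cos (fun x => - sin x) a b ab.
- exact/continuous_subspaceT/continuous_cos.
move=> c _ e; rewrite distrC e normrM normrN distrC.
by rewrite ler_piMl// sin_max.
Qed.

Lemma osc_cos_Lipschitz (mu u v : R) : 0 <= mu ->
  `|osc_cos mu u - osc_cos mu v| <= 2 * `|u - v|.
Proof.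
move=> mu0; rewrite /osc_cos.
have I (x : R) : leb.-integrable setT (EFin \o (fun t => pos_powR (1 - t ^+ 2) mu * cos (x * t))).
  apply: le_integrable (integrable_disc_power mu0) => //.
    apply/measurable_EFinP; apply: measurable_funM; first exact: measurable_disc_power.
    by apply: continuous_measurable_fun => t; apply: (@continuous_comp _ _ _ ( *%R x) cos);
      [exact: mulrl_continuous|exact: continuous_cos].
  by move=> t _; rewrite /= lee_fin normrM ler_piMr// cos_max.
rewrite -RintegralB//.
have IB : leb.-integrable setT (EFin \o (fun t => pos_powR (1 - t ^+ 2) mu * cos (u * t) -
     pos_powR (1 - t ^+ 2) mu * cos (v * t))).
  by have := integrableB measurableT (I u) (I v); apply: eq_integrable.
rewrite (le_trans (le_normr_Rintegral measurableT IB))//.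
apply: (@le_trans _ _ (\int[leb]_t (`|u - v| * \1_(`[(- 1), 1] : set R) t))).
  apply: le_Rintegral => //.
  - by have := integrable_norm IB; apply: eq_integrable.
  - exact: integrable_indic_cst.
  - move=> t _; rewrite -mulrBr normrM indicE mem_setE in_itv/= -ler_norml.
    have [t1|t1] := leP `|t| 1; last by rewrite pos_powR_disc0// normr0 mul0r mulr0.
    rewrite mulr1 -[leRHS]mul1r ler_pM//.
      by rewrite ger0_norm ?pos_powR_ge0// pos_powR_le1// gerBl sqr_ge0.
    by rewrite (le_trans (cos_Lipschitz _ _))// -mulrBl normrM ler_piMr.
rewrite RintegralZl//; last exact: integrable_indic_itv.
by rewrite Rintegral_indic_itv; lra.
Qed.

Lemma continuous_osc_cos (mu : R) : 0 <= mu -> continuous (osc_cos mu).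
Proof.
move=> mu0 u; apply/cvgrPdist_lt => e e0; near=> v.
apply: le_lt_trans (osc_cos_Lipschitz _ _ mu0) _.
rewrite -ltr_pdivlMl//; near: v; apply: cvgr_dist_lt => //.
by rewrite mulr_gt0.
Unshelve. all: by end_near. Qed.

(** Dilates of an integrable profile, with a mass independent of [rho]. *)
Definition radial_bump n (delta rho : R) (x : Rn R n) : R :=
  rho ^+ n * (1 + rho * enorm x) `^ (- (n%:R + delta)).

(** The decay exponent [1 + lam + n / 2] of the oscillatory integral is exactly
    [n + 1 + delta] for [delta = lam - n / 2]. *)
Lemma br_kernel_bound n (lam : R) : n%:R / 2 < lam -> exists2 C : R, 0 < C &
  forall rho (x : Rn R n.+1), 0 < rho ->
  Normc.normc (br_kernel lam rho x) <= C * radial_bump (lam - n%:R / 2) rho x.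
Proof.
move=> lamn.
have n0 : 0 <= n%:R / 2 :> R by rewrite divr_ge0.
have lam0 : 0 < lam by exact: le_lt_trans lamn.
have mu0 : 0 < lam + n%:R / 2 by rewrite ltr_wpDr.
have [C C0 HC] := osc_cos_bound mu0.
have c0 := radial_const_ge0 n lam.
exists ((radial_const n lam + 1) * C); first by rewrite mulr_gt0//; lra.
move=> rho x rho0; rewrite br_kernelE//; last exact: ltW.
have x0 := enorm_ge0 x.
have rx0 : 0 <= rho * enorm x by rewrite mulr_ge0// ltW.
have p0 := pi_gt0 R.
have rn : 0 <= rho ^+ n.+1 by rewrite exprn_ge0// ltW.
rewrite /= expr0n/= addr0 sqrtr_sqr !normrM (ger0_norm c0) (ger0_norm rn).
rewrite /radial_bump -!mulrA ler_pM//.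
- by rewrite mulr_ge0.
- by lra.
rewrite [leRHS]mulrCA ler_wpM2l//.
apply: (le_trans (HC (2 * (pi * (rho * enorm x))) _)); first by rewrite !mulr_ge0// ltW.
rewrite ler_wpM2l ?(ltW C0)//.
have -> : - (n.+1%:R + (lam - n%:R / 2)) = - (1 + (lam + n%:R / 2)).
  by rewrite -natr1; field.
rewrite !powRN lef_pV2 ?posrE ?powR_gt0//; [|nra|lra].
apply: ler_powR_base; [lra|lra|].
have := pi_ge2 R; nra.
Qed.

End kernel_bounds.

(** * A maximal operator on the line *)

Section series_sup.
Context {R : realType}.
Local Open Scope ereal_scope.

Definition nsup (u : nat -> \bar R) : \bar R := ereal_sup (range u).

Lemma measurable_fun_nsup d (T : measurableType d) (f : nat -> T -> \bar R) :
  (forall k, measurable_fun setT (f k)) ->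
  measurable_fun setT (fun x => nsup (f ^~ x)).
Proof.
move=> mf; have := measurable_fun_esups mf 0%N.
apply: eq_measurable_fun => x _; rewrite /esups /nsup; congr ereal_sup.
by apply/seteqP; split => [y [k _ <-]|y [k _ <-]]; exists k.
Qed.

Lemma le_nsup (u : nat -> \bar R) k : u k <= nsup u.
Proof. by apply: ereal_sup_ubound; exists k. Qed.

Lemma nsup_le (u : nat -> \bar R) M : (forall k, u k <= M) -> nsup u <= M.
Proof. by move=> uM; apply: ge_ereal_sup => _ [k _ <-]. Qed.

Lemma nsup_ge0 (u : nat -> \bar R) : (forall k, 0 <= u k) -> 0 <= nsup u.
Proof. by move=> u0; apply: le_trans (u0 0%N) (le_nsup u 0%N). Qed.

Lemma nneseries_le (u : nat -> \bar R) M : (forall k, 0 <= u k) ->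
  (forall n, \sum_(0 <= k < n) u k <= M) -> \sum_(0 <= k <oo) u k <= M.
Proof.
move=> u0 uM; apply: lime_le.
  by apply: is_cvg_nneseries => n _ _.
by apply: nearW.
Qed.

Lemma le_nneseries_term (u : nat -> \bar R) k : (forall j, 0 <= u j) ->
  u k <= \sum_(0 <= j <oo) u j.
Proof.
move=> u0; apply: le_trans (nneseries_lim_ge k.+1 _); last by move=> n _ _.
rewrite big_nat_recr//= leeDr// sume_ge0//.
Qed.

Lemma geometric_nneseries_le (a z : R) : (0 <= a)%R -> (0 <= z)%R -> (z < 1)%R ->
  \sum_(0 <= k <oo) (a * z ^+ k)%:E <= (a / (1 - z))%:E.
Proof.
move=> a0 z0 z1; apply: nneseries_le => [k|n].
  by rewrite lee_fin mulr_ge0// exprn_ge0.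
have z1' : (0 < 1 - z)%R by rewrite subr_gt0.
rewrite sumEFin lee_fin -mulr_sumr ler_wpM2l//.
have : ((1 - z) * (\sum_(0 <= k < n) z ^+ k) = 1 - z ^+ n)%R.
  elim: n => [|n ih]; first by rewrite big_geq// mulr0 subrr.
  by rewrite big_nat_recr//= mulrDr ih exprS; ring.
move=> e; rewrite -[leRHS]mul1r ler_pdivlMr// mulrC e gerBl exprn_ge0//.
Qed.

End series_sup.

Section bump_average.
Context {R : realType}.
Local Open Scope ereal_scope.
Local Notation leb := (@lebesgue_measure R).

Definition bump1 (eps q t : R) : R := (q * (1 + q * `|t|) `^ (- (1 + eps)))%R.

Lemma bump1_ge0 eps q t : (0 < q)%R -> (0 <= bump1 eps q t)%R.
Proof. by move=> q0; rewrite mulr_ge0 ?powR_ge0// ltW. Qed.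

Lemma measurable_bump1 d (T : measurableType d) eps q (f : T -> R) :
  measurable_fun setT f -> measurable_fun setT (fun t => bump1 eps q (f t)).
Proof.
move=> mf; apply: measurable_funM; first exact: measurable_cst.
apply: (measurableT_comp (measurable_powR (- (1 + eps)))).
apply: measurable_funD; first exact: measurable_cst.
apply: measurable_funM; first exact: measurable_cst.
exact: measurableT_comp.
Qed.

(** The sum over [j] of the weights in [bump1_le_average]: a bound, uniform in
    [q], for the mass of the profile [bump1]. *)
Definition bump_mass (eps : R) : R := (2 `^ (2 + eps) / (1 - 2 `^ (- eps)))%R.

Lemma powR2N_lt1 (eps : R) : (0 < eps)%R -> (2 `^ (- eps) < 1 :> R)%R.
Proof.
move=> e0; rewrite powRN invf_lt1 ?powR_gt0//.
rewrite -[ltLHS](powRr0 2) /powR ?gt_eqF//.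
by rewrite ltr_expR mul0r mulr_gt0// ln_gt0// ltr1n.
Qed.

Lemma bump_mass_gt0 eps : (0 < eps)%R -> (0 < bump_mass eps)%R.
Proof. by move=> e0; rewrite divr_gt0 ?powR_gt0// subr_gt0 powR2N_lt1. Qed.

(** Take the least [j] with [q |t| < 2^j]. On that dyadic shell the profile is
    [2^(- j eps)] times the normalised indicator of the ball of radius [2^j /
    q], up to a constant. *)
Lemma bump1_le_average eps q t : (0 < eps)%R -> (0 < q)%R -> exists j : nat,
  (`|t| < 2 ^+ j / q)%R /\
  (bump1 eps q t <= 2 `^ (2 + eps) * (2 `^ (- eps)) ^+ j * (2 ^+ j / q *+ 2)^-1)%R.
Proof.
move=> e0 q0; set u := (q * `|t|)%R.
have u0 : (0 <= u)%R by rewrite mulr_ge0// ltW.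
have exj : exists j, (u < 2 ^+ j)%R.
  exists (Num.truncn u).+1; apply: lt_le_trans (truncnS_gt u) _.
  by rewrite -natrX ler_nat ltnW// ltn_expl.
have [j uj jmin] := ex_minnP exj.
exists j; split; first by rewrite ltr_pdivlMr// mulrC.
(* Minimality of [j]; for [j = 0] the bound holds since [u] is nonnegative. *)
have j1 : (2 ^+ j / 2 <= 1 + u)%R.
  case: j uj jmin => [|j] uj jmin; first by rewrite expr0; lra.
  have : (2 ^+ j <= u)%R by rewrite leNgt; apply/negP => /jmin; rewrite ltnn.
  by rewrite exprS mulrAC divff// mul1r; lra.
have p2 : (0 < 2 ^+ j / 2 :> R)%R by rewrite divr_gt0// exprn_gt0.
rewrite /bump1 -/u.
apply: (@le_trans _ _ (q * (2 ^+ j / 2) `^ (- (1 + eps)))%R).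
  rewrite ler_wpM2l ?(ltW q0)// !powRN lef_pV2 ?posrE ?powR_gt0//; last by lra.
  by apply: ler_powR_base; lra.
have n2 : (2 != 0 :> R)%R by [].
have j2 : (2 ^+ j != 0 :> R)%R by rewrite expf_neq0.
have -> : (2 ^+ j / 2 = 2 `^ (j%:R - 1) :> R)%R.
  by rewrite powRB ?(negbTE n2) ?implybT// powR_mulrn// powRr1.
have -> : ((2 `^ (- eps)) ^+ j = 2 `^ (- eps * j%:R) :> R)%R.
  by rewrite powRrM powR_mulrn// powR_ge0.
have -> : ((2 ^+ j / q *+ 2)^-1 = q * 2 `^ (- j%:R - 1) :> R)%R.
  rewrite powRB ?n2 ?implybT// powRN powR_mulrn// powRr1// -mulr_natr.
  by field; rewrite ?(gt_eqF q0) ?j2.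
have -> : (2 `^ (2 + eps) * 2 `^ (- eps * j%:R) * (q * 2 `^ (- j%:R - 1)) =
  q * (2 `^ (2 + eps) * 2 `^ (- eps * j%:R) * 2 `^ (- j%:R - 1)))%R by ring.
rewrite -powRrM -!powRD ?n2 ?implybT// ler_wpM2l ?(ltW q0)//.
by rewrite le_eqVlt; apply/orP; left; apply/eqP; congr powR; ring.
Qed.

(** Each ball in [bump1_le_average] contributes an average of [h] over a ball
    centred at [x]. *)
Lemma bump1_convolution_le_HL eps q (h : R -> R) x : (0 < eps)%R -> (0 < q)%R ->
  measurable_fun setT h -> (forall t, 0 <= h t)%R ->
  \int[leb]_t ((bump1 eps q (x - t))%:E * (h t)%:E) <=
  (bump_mass eps)%:E * HL_maximal h x.
Proof.
move=> e0 q0 mh h0.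
pose r (j : nat) : R := (2 ^+ j / q)%R.
have r0 j : (0 < r j)%R by rewrite divr_gt0// exprn_gt0.
pose b (j : nat) : R := (2 `^ (2 + eps) * (2 `^ (- eps)) ^+ j)%R.
have b0 j : (0 <= b j)%R by rewrite mulr_ge0 ?powR_ge0// exprn_ge0// powR_ge0.
pose G j (t : R) : \bar R :=
  (b j * (r j *+ 2)^-1)%:E * ((h t)%:E * (\1_(ball x (r j)) t)%:E).
have br0 j : (0 <= b j * (r j *+ 2)^-1)%R.
  by rewrite mulr_ge0// invr_ge0 mulrn_wge0// ltW.
have mI j : measurable_fun setT (fun t => (h t)%:E * (\1_(ball x (r j)) t)%:E).
  apply: emeasurable_funM; first exact/measurable_EFinP.
  by apply/measurable_EFinP; apply: measurable_indic; exact: measurable_ball.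
have G0 j t : 0 <= G j t.
  by apply: mule_ge0; [rewrite lee_fin|apply: mule_ge0; rewrite lee_fin].
have mG j : measurable_fun setT (G j) by exact: measurable_funeM.
apply: (@le_trans _ _ (\int[leb]_t \sum_(0 <= j <oo) G j t)).
  apply: ge0_le_integral => //.
  - by move=> t _; rewrite mule_ge0 ?lee_fin// bump1_ge0.
  - apply: emeasurable_funM; apply/measurable_EFinP => //.
    by apply: measurable_bump1; exact: measurable_funB.
  - by apply: ge0_emeasurable_sum => [j t _ _|j _]; [exact: G0|exact: mG].
  - move=> t _; have [j [tj bj]] := bump1_le_average (x - t)%R e0 q0.
    apply: le_trans (le_nneseries_term j (fun j => G0 j t)).
    have tB : ball x (r j) t by [].
    rewrite /G indicE mem_set// mule1 -!EFinM lee_fin.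
    exact: ler_wpM2r.
rewrite integral_nneseries//.
apply: (@le_trans _ _ (\sum_(0 <= j <oo) ((b j)%:E * HL_maximal h x))).
  apply: lee_nneseries => [j _ _|j _]; first exact: integral_ge0.
  have IG : \int[leb]_t G j t = (b j * (r j *+ 2)^-1)%:E *
      \int[leb]_t ((h t)%:E * (\1_(ball x (r j)) t)%:E).
    apply: ge0_integralZl; [exact: measurableT|exact: mI|move=> t _|].
      by apply: mule_ge0; rewrite lee_fin.
    by rewrite lee_fin.
  rewrite [leLHS](_ : _ = (b j * (r j *+ 2)^-1)%:E *
      \int[leb]_t ((h t)%:E * (\1_(ball x (r j)) t)%:E)); last exact: IG.
  rewrite EFinM -muleA lee_wpmul2l ?lee_fin//.
  have -> : \int[leb]_t ((h t)%:E * (\1_(ball x (r j)) t)%:E) =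
      \int[leb]_(t in ball x (r j)) `|(h t)%:E|.
    rewrite [RHS]integral_mkcond; apply: eq_integral => t _.
    rewrite patchE indicE; case: ifPn => tB.
      by rewrite mule1 gee0_abs ?lee_fin.
    by rewrite mule0.
  apply: ereal_sup_ubound; exists (r j); first by rewrite /= in_itv/= r0.
  rewrite /iavg lebesgue_measure_ball ?(ltW (r0 j))// inver.
  by rewrite gt_eqF// pmulrn_lgt0.
have HL0 : 0 <= HL_maximal h x.
  apply: le_trans (@ereal_sup_ubound _ _ (iavg h (ball x 1)) _); first exact: iavg_ge0.
  by exists 1%R => //; rewrite /= in_itv/= ltr01.
under eq_eseriesr do rewrite muleC.
have sb : \sum_(0 <= j <oo) (b j)%:E <= (bump_mass eps)%:E.
  by apply: geometric_nneseries_le; rewrite ?powR_ge0// powR2N_lt1.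
have [HLoo|HLfin] := eqVneq (HL_maximal h x) +oo.
  by rewrite HLoo gt0_muley ?lte_fin ?bump_mass_gt0// leey.
have HLf : HL_maximal h x \is a fin_num by rewrite ge0_fin_numE// ltey.
rewrite -(fineK HLf) nneseriesZl; last by move=> j _; rewrite lee_fin.
by rewrite muleC lee_wpmul2r// fineK.
Qed.

(** Together with [bump1_convolution_le_HL] for the constant [1], this bounds
    the mass of [bump1]. *)
Lemma HL_maximal_cst1 (x : R) : HL_maximal (cst 1%R) x <= 1.
Proof.
apply: ge_ereal_sup => y /= [r]; rewrite /= in_itv/= andbT => r0 <-{y}.
rewrite /iavg /= normr1 integral_cst//; last exact: measurable_ball.
rewrite mul1e lebesgue_measure_ball ?(ltW r0)// inver gt_eqF ?pmulrn_lgt0//.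
rewrite [X in _ * X](_ : _ = (r *+ 2)%:E); last first.
  by apply: lebesgue_measure_ball; exact: ltW.
by rewrite -EFinM mulVf// gt_eqF// pmulrn_lgt0.
Qed.

End bump_average.

Section maximal_line.
Context {R : realType}.
Local Open Scope ereal_scope.
Local Notation leb := (@lebesgue_measure R).
Variables (eps s : R) (q : nat -> R).
Hypotheses (eps_gt0 : (0 < eps)%R) (s_gt1 : (1 < s)%R) (q_gt0 : forall k, (0 < q k)%R).

Local Notation B := (bump_mass eps).

Lemma measurable_level (f : R -> R) (c : R) : measurable_fun setT f ->
  measurable [set t | (c < f t)%R].
Proof.
move=> mf; rewrite (_ : [set t | _] = f @^-1` `]c, +oo[%classic).
  by rewrite -[X in measurable X]setTI; exact: mf.
by apply/seteqP; split => t /=; rewrite in_itv/= andbT.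
Qed.

Definition superlevel (M : R -> \bar R) (c : R) : set R := [set x | c%:E < M x].

Lemma measurable_superlevel (M : R -> \bar R) (c : R) : measurable_fun setT M ->
  measurable (superlevel M c).
Proof.
move=> mM; rewrite -[X in measurable X]setTI /superlevel.
exact: emeasurable_fun_o_infty.
Qed.

Definition line_maximal (g : R -> \bar R) (x : R) : \bar R :=
  nsup (fun k => \int[leb]_t ((bump1 eps (q k) (x - t))%:E * g t)).

Lemma line_maximal_ge0 g x : (forall t, 0 <= g t) -> 0 <= line_maximal g x.
Proof.
move=> g0; apply: nsup_ge0 => k; apply: integral_ge0 => t _.
by rewrite mule_ge0// lee_fin bump1_ge0.
Qed.

Lemma measurable_line_maximal g : measurable_fun setT g -> (forall t, 0 <= g t) ->
  measurable_fun setT (line_maximal g).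
Proof.
move=> mg g0; apply: measurable_fun_nsup => k.
apply: (measurable_fun_fubini_tonelli_F
  (fun p : measurableTypeR R * measurableTypeR R => (bump1 eps (q k) (p.1 - p.2))%:E * g p.2)).
  apply: emeasurable_funM.
    apply/measurable_EFinP; apply: measurable_bump1.
    by apply: measurable_funB; [exact: measurable_fst|exact: measurable_snd].
  exact: (measurableT_comp mg measurable_snd).
by move=> p; rewrite mule_ge0// lee_fin bump1_ge0.
Qed.

(** Up to [c], the function [f] contributes at most [B c] to the averages, so
    at a point where they exceed [2 B c] the part of [f] above level [c] has a
    Hardy-Littlewood maximal function exceeding [c]. That part is integrable,
    because [f <= c^(1 - s) f^s] on it. *)
Lemma line_maximal_weak_type (f : R -> R) (c : R) : measurable_fun setT f ->
  (forall t, 0 <= f t)%R -> \int[leb]_t (f t `^ s)%:E < +oo -> (0 < c)%R ->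
  leb (superlevel (line_maximal (EFin \o f)) (2 * B * c)%R) <=
  (3 / c)%:E * \int[leb]_t ((f t)%:E * (\1_[set t | (c < f t)%R] t)%:E).
Proof.
move=> mf f0 fs c0.
have mS : measurable [set t | (c < f t)%R].
  exact: measurable_level.
pose f1 t : R := (f t * \1_[set t | (c < f t)%R] t)%R.
have f10 t : (0 <= f1 t)%R by rewrite mulr_ge0.
have mf1 : measurable_fun setT f1.
  by apply: measurable_funM => //; exact: measurable_indic.
have if1 : leb.-integrable setT (EFin \o f1).
  apply/integrableP; split; first exact/measurable_EFinP.
  apply: (@le_lt_trans _ _ (\int[leb]_t ((c `^ (1 - s))%:E * (f t `^ s)%:E))).
    apply: ge0_le_integral => //.
    - by apply: measurableT_comp => //; exact/measurable_EFinP.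
    - apply: measurable_funeM; apply/measurable_EFinP.
      exact: (measurableT_comp (measurable_powR s)).
    - move=> t _; rewrite /= ger0_norm// -EFinM lee_fin /f1 indicE.
      have [ct|ct] := boolP (t \in _); last by rewrite mulr0 mulr_ge0 ?powR_ge0.
      rewrite inE/= in ct; rewrite mulr1.
      have ft0 : (0 < f t)%R by exact: lt_trans ct.
      rewrite -{1}(mulr_powRB1 (ltW ft0) (lt_trans ltr01 s_gt1)).
      have -> : (c `^ (1 - s) * (f t * f t `^ (s - 1)) =
                 f t * (c `^ (1 - s) * f t `^ (s - 1)))%R by ring.
      rewrite ler_peMr ?(ltW ft0)// -[(1 - s)%R]opprB powRN.
      rewrite mulrC ler_pdivlMr ?powR_gt0// mul1r.
      by apply: ler_powR_base; [rewrite subr_ge0 ltW|exact: ltW|exact: ltW].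
  rewrite ge0_integralZl//.
  - by rewrite lte_mul_pinfty// lee_fin powR_ge0.
  - by apply/measurable_EFinP; exact: (measurableT_comp (measurable_powR s)).
  - by move=> t _; rewrite lee_fin powR_ge0.
  - by rewrite lee_fin powR_ge0.
have lf1 : locally_integrable setT f1.
  by have := integrable_locally measurableT if1; rewrite patch_setT.
have Mle x : line_maximal (EFin \o f) x <= (B * c)%:E + B%:E * HL_maximal f1 x.
  apply: nsup_le => k.
  have mb : measurable_fun setT (fun t : R => bump1 eps (q k) (x - t)).
    by apply: measurable_bump1; exact: measurable_funB.
  apply: (@le_trans _ _ (\int[leb]_t ((bump1 eps (q k) (x - t))%:E * c%:E +
      (bump1 eps (q k) (x - t))%:E * (f1 t)%:E))).
    apply: ge0_le_integral => //.
    - by move=> t _; rewrite mule_ge0 ?lee_fin// bump1_ge0.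
    - by apply: emeasurable_funM; exact/measurable_EFinP.
    - apply: emeasurable_funD; apply: emeasurable_funM => //; exact/measurable_EFinP.
    - move=> t _; rewrite -!EFinM -EFinD lee_fin -mulrDr ler_wpM2l ?bump1_ge0//.
      rewrite /f1 indicE; have [ct|ct] := boolP (t \in _).
        by rewrite mulr1 lerDr ltW.
      by rewrite mulr0 addr0 leNgt; apply: contra ct => ct; rewrite inE.
  rewrite ge0_integralD//; last 4 first.
  - by move=> t _; rewrite mule_ge0 ?lee_fin ?bump1_ge0// ltW.
  - by apply: emeasurable_funM; [exact/measurable_EFinP|exact: measurable_cst].
  - by move=> t _; rewrite mule_ge0 ?lee_fin ?bump1_ge0.
  - by apply: emeasurable_funM; exact/measurable_EFinP.
  apply: leeD; last exact: bump1_convolution_le_HL.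
  under eq_integral do rewrite muleC.
  rewrite ge0_integralZl//; last 3 first.
  - exact/measurable_EFinP.
  - by move=> t _; rewrite lee_fin bump1_ge0.
  - by rewrite lee_fin ltW.
  rewrite mulrC EFinM lee_wpmul2l ?lee_fin ?(ltW c0)//.
  have := @bump1_convolution_le_HL R eps (q k) (cst 1%R) x eps_gt0 (q_gt0 k)
    (measurable_cst _) (fun=> ler01).
  rewrite (_ : \int[leb]_t ((bump1 eps (q k) (x - t))%:E * (cst 1%R t)%:E) =
    \int[leb]_t (bump1 eps (q k) (x - t))%:E); last first.
    by apply: eq_integral => t _; rewrite mule1.
  move=> /le_trans; apply; rewrite -[leRHS]mule1 lee_wpmul2l ?lee_fin//.
    by rewrite ltW ?bump_mass_gt0.
  exact: HL_maximal_cst1.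
have -> : \int[leb]_t ((f t)%:E * (\1_[set t | (c < f t)%R] t)%:E) =
    \int[leb]_t `|(f1 t)%:E|.
  by apply: eq_integral => t _; rewrite /= ger0_norm// EFinM.
apply: le_trans (maximal_inequality lf1 c0).
apply: le_measure; rewrite ?inE.
- apply: measurable_superlevel; apply: measurable_line_maximal; first exact/measurable_EFinP.
  by move=> t; rewrite lee_fin.
- rewrite -[X in measurable X]setTI; apply: emeasurable_fun_o_infty => //.
  exact: measurable_HL_maximal.
move=> x /= /lt_le_trans => /(_ _ (Mle x)).
have B0 : (0 < B)%R by exact: bump_mass_gt0.
case: (HL_maximal f1 x) => [y| |] //=.
- rewrite -EFinM -EFinD !lte_fin => H; rewrite -(ltr_pM2l B0); lra.
- by move=> _; rewrite ltry.
- by rewrite gt0_muleNy ?lte_fin// addeNy ltNge leNye.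
Qed.

(** With [z_a = min(v, a)^(s - 1)], the increment of [z] from [a / 2] to [a] is
    a fixed fraction of [a^(s - 1)] as long as [a < v], and it is nonnegative
    in all cases. *)
Lemma layer_telescope (v a : R) : (0 <= v)%R -> (0 < a)%R ->
  (a `^ (s - 1) * (a < v)%R%:R <=
   (1 - 2 `^ (1 - s))^-1 * (Num.min v a `^ (s - 1) - Num.min v (a / 2) `^ (s - 1)))%R.
Proof.
move=> v0 a0; have s10 : (0 < s - 1)%R by rewrite subr_gt0.
have k0 : (0 < 1 - 2 `^ (1 - s) :> R)%R.
  by rewrite subr_gt0 -[(1 - s)%R]opprB powR2N_lt1.
have [av|va] := ltP a v.
  have a2 : (a / 2 <= v)%R by lra.
  rewrite (min_idPr a2) mulr1.
  have -> : ((a / 2) `^ (s - 1) = a `^ (s - 1) * 2 `^ (1 - s))%R.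
    rewrite powRM ?(ltW a0)//; congr (_ * _)%R.
    by rewrite -powR_inv1// -powRrM; congr powR; ring.
  rewrite -{2}[(a `^ _)%R]mulr1 -mulrBr mulrCA mulVf ?mulr1//.
  exact: lt0r_neq0.
rewrite mulr0 mulr_ge0 ?invr_ge0 ?(ltW k0)// subr_ge0.
apply: ler_powR_base; first exact: ltW.
  by rewrite le_min v0 divr_ge0// ltW.
by rewrite ge_min lexx.
Qed.

Let kappa : R := ((1 - 2 `^ (1 - s))^-1)%R.

Let kappa_gt0 : (0 < kappa)%R.
Proof. by rewrite invr_gt0 subr_gt0 -[(1 - s)%R]opprB powR2N_lt1// subr_gt0. Qed.

Let min_le (v a : R) : (0 <= v)%R -> (0 < a)%R -> (Num.min v a `^ (s - 1) <= v `^ (s - 1))%R.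
Proof.
move=> v0 a0; apply: ler_powR_base; first by rewrite subr_ge0 ltW.
  by rewrite le_min v0 ltW.
by rewrite ge_min lexx.
Qed.

Lemma layers_up (v : R) n : (0 <= v)%R ->
  (\sum_(0 <= k < n) ((2 ^+ k) `^ (s - 1) * (2 ^+ k < v)%R%:R) <= kappa * v `^ (s - 1))%R.
Proof.
move=> v0; pose z k : R := (Num.min v (2 ^+ k / 2) `^ (s - 1))%R.
have p0 k : (0 < 2 ^+ k :> R)%R by rewrite exprn_gt0.
apply: (@le_trans _ _ (\sum_(0 <= k < n) kappa * (z k.+1 - z k))%R).
  apply: ler_sum => k _; rewrite /z exprS mulrAC divff// mul1r.
  exact: layer_telescope.
rewrite -mulr_sumr telescope_sumr// ler_wpM2l ?(ltW kappa_gt0)//.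
apply: (@le_trans _ _ (z n)); first by rewrite gerBl powR_ge0.
by apply: min_le => //; rewrite divr_gt0.
Qed.

Lemma layers_down (v : R) n : (0 <= v)%R ->
  (\sum_(0 <= k < n) ((2 ^- k) `^ (s - 1) * (2 ^- k < v)%R%:R) <= kappa * v `^ (s - 1))%R.
Proof.
move=> v0; pose z k : R := (- Num.min v (2 ^- k) `^ (s - 1))%R.
have p0 k : (0 < 2 ^- k :> R)%R by rewrite invr_gt0 exprn_gt0.
apply: (@le_trans _ _ (\sum_(0 <= k < n) kappa * (z k.+1 - z k))%R).
  apply: ler_sum => k _; rewrite /z opprK [(- _ + _)%R]addrC.
  rewrite exprS invfM [(2^-1 * _)%R]mulrC.
  exact: layer_telescope.
rewrite -mulr_sumr telescope_sumr// ler_wpM2l ?(ltW kappa_gt0)//.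
rewrite /z opprK addrC (@le_trans _ _ (Num.min v (2 ^- 0) `^ (s - 1))%R)//.
  by rewrite gerBl powR_ge0.
exact: min_le.
Qed.

(** The weak type inequality at each level [a k] leaves the integral of [f]
    against [sum_k (a k)^(s - 1) 1_(a k < f)], and that sum is at most a
    multiple of [f^(s - 1)]. *)
Let layer_integral (f : R -> R) (a : nat -> R) : measurable_fun setT f ->
  (forall t, 0 <= f t)%R -> \int[leb]_t (f t `^ s)%:E < +oo ->
  (forall k, 0 < a k)%R ->
  (forall v n, (0 <= v)%R ->
     (\sum_(0 <= k < n) (a k `^ (s - 1) * (a k < v)%R%:R) <= kappa * v `^ (s - 1))%R) ->
  \int[leb]_x (\sum_(0 <= k <oo) ((4 * B * a k) `^ s)%:E *
     (\1_(superlevel (line_maximal (EFin \o f)) (2 * B * a k)%R) x)%:E) <=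
  (3 * (4 * B) `^ s * kappa)%:E * \int[leb]_t (f t `^ s)%:E.
Proof.
move=> mf f0 fs a0 Ha.
have B0 : (0 < B)%R by exact: bump_mass_gt0.
have mM : measurable_fun setT (line_maximal (EFin \o f)).
  apply: measurable_line_maximal; first exact/measurable_EFinP.
  by move=> t; rewrite lee_fin.
have mS k : measurable (superlevel (line_maximal (EFin \o f)) (2 * B * a k)%R).
  exact: measurable_superlevel.
have mT k : measurable [set t | (a k < f t)%R].
  exact: measurable_level.
rewrite integral_nneseries//; last 2 first.
- move=> k; apply: measurable_funeM; apply/measurable_EFinP.
  by apply: measurable_indic; exact: mS.
- by move=> k x _; rewrite mule_ge0 ?lee_fin// powR_ge0.
pose F k t : \bar R := (3 * (4 * B) `^ s * a k `^ (s - 1))%:E *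
    ((f t)%:E * (\1_[set t | (a k < f t)%R] t)%:E).
have c0 k : (0 <= 3 * (4 * B) `^ s * a k `^ (s - 1))%R.
  by rewrite mulr_ge0 ?powR_ge0// mulr_ge0 ?powR_ge0.
have mI k : measurable_fun setT (fun t => (f t)%:E * (\1_[set t | (a k < f t)%R] t)%:E).
  apply: emeasurable_funM; first exact/measurable_EFinP.
  by apply/measurable_EFinP; exact: measurable_indic.
have F0 k t : 0 <= F k t.
  by apply: mule_ge0; [rewrite lee_fin|apply: mule_ge0; rewrite lee_fin].
have mF k : measurable_fun setT (F k) by exact: measurable_funeM.
apply: (@le_trans _ _ (\sum_(0 <= k <oo) \int[leb]_t F k t)).
  apply: lee_nneseries => [k _ _|k _].
    by apply: integral_ge0 => x _; rewrite mule_ge0 ?lee_fin// powR_ge0.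
  rewrite ge0_integralZl//; last 2 first.
  - by apply/measurable_EFinP; apply: measurable_indic; exact: mS.
  - by rewrite lee_fin powR_ge0.
  rewrite integral_indic//; last exact: mS.
  have IF : \int[leb]_t F k t = (3 * (4 * B) `^ s * a k `^ (s - 1))%:E *
      \int[leb]_t ((f t)%:E * (\1_[set t | (a k < f t)%R] t)%:E).
    apply: ge0_integralZl; [exact: measurableT|exact: mI|move=> t _|].
      by apply: mule_ge0; rewrite lee_fin.
    by rewrite lee_fin.
  rewrite setIT IF.
  apply: (@le_trans _ _ (((4 * B * a k) `^ s)%:E * ((3 / a k)%:E *
     \int[leb]_t ((f t)%:E * (\1_[set t | (a k < f t)%R] t)%:E)))).
    by rewrite lee_wpmul2l ?lee_fin ?powR_ge0// line_maximal_weak_type.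
  rewrite muleA -EFinM.
  have -> // : ((4 * B * a k) `^ s * (3 / a k) = 3 * (4 * B) `^ s * a k `^ (s - 1))%R.
  have B40 : (0 <= 4 * B)%R by lra.
  rewrite (powRM _ B40 (ltW (a0 k))).
  rewrite -(mulr_powRB1 (ltW (a0 k)) (lt_trans ltr01 s_gt1)).
  by field; rewrite gt_eqF.
rewrite -integral_nneseries// -ge0_integralZl//; last 3 first.
- by apply/measurable_EFinP; exact: (measurableT_comp (measurable_powR s)).
- by move=> t _; rewrite lee_fin powR_ge0.
- by rewrite lee_fin !mulr_ge0 ?powR_ge0// ltW.
apply: ge0_le_integral => //.
- by move=> t _; apply: nneseries_ge0 => k _ _.
- by apply: ge0_emeasurable_sum => [k t _ _|k _]; [exact: F0|exact: mF].
- apply: measurable_funeM; apply/measurable_EFinP.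
  exact: (measurableT_comp (measurable_powR s)).
- move=> t _; apply: nneseries_le => // n; rewrite /F.
  under eq_bigr do rewrite -!EFinM.
  rewrite sumEFin -EFinM lee_fin.
  rewrite -(mulr_powRB1 (f0 t) (lt_trans ltr01 s_gt1)).
  have -> : (3 * (4 * B) `^ s * kappa * (f t * f t `^ (s - 1)) =
     (3 * (4 * B) `^ s * f t) * (kappa * f t `^ (s - 1)))%R by ring.
  apply: (@le_trans _ _ ((3 * (4 * B) `^ s * f t) *
     \sum_(0 <= k < n) (a k `^ (s - 1) * (a k < f t)%R%:R))%R).
    rewrite mulr_sumr le_eqVlt; apply/orP; left; apply/eqP.
    apply: eq_bigr => k _; rewrite indicE.
    have -> : (t \in [set t | (a k < f t)%R]) = (a k < f t)%R.
      by apply/idP/idP => [|kt]; rewrite inE.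
    ring.
  rewrite ler_wpM2l ?Ha// mulr_ge0// mulr_ge0 ?powR_ge0//.
Qed.

Lemma dyadic_bracket (v : R) : (0 < v)%R ->
  exists k, (2 ^+ k < v <= 2 * 2 ^+ k)%R \/ (2 ^- k < v <= 2 * 2 ^- k)%R.
Proof.
move=> v0; have expb (u : R) : exists j, (u <= 2 ^+ j)%R.
  exists (Num.truncn u).+1; apply/ltW/(lt_le_trans (truncnS_gt u)).
  by rewrite -natrX ler_nat ltnW// ltn_expl.
have [v1|v1] := ltP 1%R v.
  have [j vj jmin] := ex_minnP (expb v).
  case: j vj jmin => [|j] vj jmin; first by move: v1; rewrite ltNge -(expr0 2) vj.
  exists j; left; rewrite -exprS vj andbT ltNge; apply/negP => /jmin.
  by rewrite ltnn.
have ex : exists j, (v^-1 < 2 ^+ j)%R.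
  have [j vj] := expb (v^-1)%R; exists j.+1; apply: le_lt_trans vj _.
  by rewrite ltr_eXn2l// ltr1n.
have [j vj jmin] := ex_minnP ex.
case: j vj jmin => [|j] vj jmin.
  by move: vj; rewrite expr0 invf_lt1// ltNge v1.
exists j.+1; right; apply/andP; split.
  by rewrite -[ltRHS]invrK ltf_pV2 ?posrE ?exprn_gt0 ?invr_gt0.
rewrite exprS invfM mulrA mulfV// mul1r -[leLHS]invrK lef_pV2 ?posrE ?exprn_gt0 ?invr_gt0//.
by rewrite leNgt; apply/negP => /jmin; rewrite ltnn.
Qed.

(** A positive finite value [M x] lies between [2 B a] and [4 B a] for some
    dyadic level [a], and the corresponding term alone is at least [M x `^ s].
    Levels above and below [1] are kept in two series. *)
Let pointwise_layers (M : R -> \bar R) x : 0 <= M x ->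
  M x `^ s <=
  \sum_(0 <= k <oo) (((4 * B * 2 ^+ k) `^ s)%:E * (\1_(superlevel M (2 * B * 2 ^+ k)%R) x)%:E) +
  \sum_(0 <= k <oo) (((4 * B * 2 ^- k) `^ s)%:E * (\1_(superlevel M (2 * B * 2 ^- k)%R) x)%:E).
Proof.
have B0 : (0 < B)%R by exact: bump_mass_gt0.
have s0 : (0 < s)%R by exact: lt_trans s_gt1.
move=> Mx0; set S1 := \sum_(0 <= k <oo) _; set S2 := \sum_(0 <= k <oo) _.
have S10 : 0 <= S1 by apply: nneseries_ge0 => k _ _; rewrite mule_ge0 ?lee_fin// powR_ge0.
have S20 : 0 <= S2 by apply: nneseries_ge0 => k _ _; rewrite mule_ge0 ?lee_fin// powR_ge0.
have S1k k : (2 * B * 2 ^+ k)%:E < M x -> ((4 * B * 2 ^+ k) `^ s)%:E <= S1.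
  move=> H; apply: le_trans (le_nneseries_term k _); last first.
    by move=> j; rewrite mule_ge0 ?lee_fin// powR_ge0.
  by rewrite indicE mem_set// mule1.
have S2k k : (2 * B * 2 ^- k)%:E < M x -> ((4 * B * 2 ^- k) `^ s)%:E <= S2.
  move=> H; apply: le_trans (le_nneseries_term k _); last first.
    by move=> j; rewrite mule_ge0 ?lee_fin// powR_ge0.
  by rewrite indicE mem_set// mule1.
have [Moo|Mfin] := eqVneq (M x) +oo.
  have S1oo : S1 = +oo.
    apply/eqyP => A A0.
    have [j Aj] : exists j, (A <= 2 ^+ j)%R.
      exists (Num.truncn A).+1; apply/ltW/(lt_le_trans (truncnS_gt A)).
      by rewrite -natrX ler_nat ltnW// ltn_expl.
    pose v := Num.max 1%R (A `^ s^-1 / (4 * B))%R.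
    have [k vk] : exists k, (v <= 2 ^+ k)%R.
      exists (Num.truncn v).+1; apply/ltW/(lt_le_trans (truncnS_gt v)).
      by rewrite -natrX ler_nat ltnW// ltn_expl.
    apply: le_trans (S1k k _); last by rewrite Moo ltry.
    have eA : A = ((A `^ s^-1) `^ s)%R.
      by rewrite -powRrM mulVf ?gt_eqF// powRr1// ltW.
    rewrite lee_fin [leLHS]eA.
    apply: ler_powR_base; [exact: ltW|exact: powR_ge0|].
    rewrite [leRHS]mulrC -ler_pdivrMr; last by rewrite mulr_gt0.
    apply: (le_trans _ vk).
    by rewrite le_max lexx orbT.
  by rewrite S1oo addye ?leey// gt_eqF// (lt_le_trans _ S20).
have Mf : M x \is a fin_num by rewrite ge0_fin_numE// ltey.
rewrite -(fineK Mf); set m := fine (M x).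
have B20 : (0 < 2 * B)%R by lra.
have [m0|m0] := leP m 0%R.
  have -> : m = 0%R by apply/eqP; rewrite eq_le m0 fine_ge0.
  by rewrite poweR_EFin powR0 ?gt_eqF// adde_ge0.
have [|k [/andP[k1 k2]|/andP[k1 k2]]] := @dyadic_bracket (m / (2 * B))%R.
- by rewrite divr_gt0.
- apply: (@le_trans _ _ S1); last by rewrite leeDl.
  rewrite ltr_pdivlMr// in k1; rewrite ler_pdivrMr// in k2.
  apply: le_trans (S1k k _); last by rewrite -(fineK Mf) -/m lte_fin; lra.
  by rewrite lee_fin; apply: ler_powR_base; [exact: ltW|exact: ltW|lra].
- apply: (@le_trans _ _ S2); last by rewrite leeDr.
  rewrite ltr_pdivlMr// in k1; rewrite ler_pdivrMr// in k2.
  apply: le_trans (S2k k _); last by rewrite -(fineK Mf) -/m lte_fin; lra.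
  by rewrite lee_fin; apply: ler_powR_base; [exact: ltW|exact: ltW|lra].
Qed.

(** The factor [3] comes from the weak type inequality, the factor [2] from the
    two families of dyadic levels. *)
Definition line_const : R := (2 * (3 * (4 * B) `^ s * kappa))%R.

Lemma line_const_gt0 : (0 < line_const)%R.
Proof.
by rewrite !mulr_gt0// powR_gt0// mulr_gt0// bump_mass_gt0.
Qed.

Let strong_type_real (f : R -> R) : measurable_fun setT f ->
  (forall t, 0 <= f t)%R -> \int[leb]_t (f t `^ s)%:E < +oo ->
  \int[leb]_x (line_maximal (EFin \o f) x `^ s) <=
  line_const%:E * \int[leb]_t (f t `^ s)%:E.
Proof.
move=> mf f0 fs; set M := line_maximal (EFin \o f).
have B0 : (0 < B)%R by exact: bump_mass_gt0.
have M0 x : 0 <= M x by apply: line_maximal_ge0 => t; rewrite lee_fin.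
have mM : measurable_fun setT M.
  apply: measurable_line_maximal; first exact/measurable_EFinP.
  by move=> t; rewrite lee_fin.
have mL (a : nat -> R) : measurable_fun setT (fun x => \sum_(0 <= k <oo)
     (((4 * B * a k) `^ s)%:E * (\1_(superlevel M (2 * B * a k)%R) x)%:E)).
  apply: ge0_emeasurable_sum => [k x _ _|k _].
    by rewrite mule_ge0 ?lee_fin// powR_ge0.
  apply: measurable_funeM; apply/measurable_EFinP; apply: measurable_indic.
  exact: measurable_superlevel.
have L0 (a : nat -> R) x : 0 <= \sum_(0 <= k <oo)
     (((4 * B * a k) `^ s)%:E * (\1_(superlevel M (2 * B * a k)%R) x)%:E).
  by apply: nneseries_ge0 => k _ _; rewrite mule_ge0 ?lee_fin// powR_ge0.
apply: (@le_trans _ _ (\int[leb]_x (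
  \sum_(0 <= k <oo) (((4 * B * 2 ^+ k) `^ s)%:E * (\1_(superlevel M (2 * B * 2 ^+ k)%R) x)%:E) +
  \sum_(0 <= k <oo) (((4 * B * 2 ^- k) `^ s)%:E * (\1_(superlevel M (2 * B * 2 ^- k)%R) x)%:E)))).
  apply: ge0_le_integral => //.
  - by move=> x _; exact: poweR_ge0.
  - exact: (measurableT_comp (measurable_poweR s)).
  - by apply: emeasurable_funD; exact: mL.
  - by move=> x _; exact: pointwise_layers.
rewrite ge0_integralD;
  try by [exact: mL|exact: measurableT|move=> x _; exact: L0].
have -> : line_const = (3 * (4 * B) `^ s * kappa + 3 * (4 * B) `^ s * kappa)%R.
  by rewrite /line_const; ring.
have K0 : (0 <= 3 * (4 * B) `^ s * kappa)%R by rewrite !mulr_ge0 ?powR_ge0// ltW.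
rewrite EFinD ge0_muleDl ?lee_fin//.
apply: leeD; apply: layer_integral => //.
- by move=> v n; exact: layers_up.
- by move=> v n; exact: layers_down.
Qed.

(** Integrate [pointwise_layers] and apply [layer_integral] to both families of
    levels. A function with finite [s]-th power integral is finite almost
    everywhere, so real-valued functions suffice. *)
Theorem line_maximal_strong (g : R -> \bar R) : measurable_fun setT g ->
  (forall t, 0 <= g t) ->
  \int[leb]_x (line_maximal g x `^ s) <= line_const%:E * \int[leb]_t (g t `^ s).
Proof.
move=> mg g0.
have s0 : (0 < s)%R by exact: lt_trans s_gt1.
have [goo|gfin] := eqVneq (\int[leb]_t (g t `^ s)) +oo.
  by rewrite goo gt0_muley ?lte_fin ?line_const_gt0// leey.
have gs0 : 0 <= \int[leb]_t (g t `^ s).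
  by apply: integral_ge0 => t _; exact: poweR_ge0.
have mgs : measurable_fun setT (fun t => g t `^ s).
  exact: (measurableT_comp (measurable_poweR s)).
have igs : leb.-integrable setT (fun t => g t `^ s).
  apply/integrableP; split => //.
  under eq_integral do rewrite gee0_abs ?poweR_ge0//.
  by rewrite ltey.
have aefin := integrable_ae measurableT igs.
pose f t := fine (g t).
have mf : measurable_fun setT f by exact: (measurableT_comp (@fine_measurable R setT measurableT)).
have f0 t : (0 <= f t)%R by exact: fine_ge0.
have aeg : {ae leb, forall t, g t = (f t)%:E}.
  apply: filterS aefin => t /(_ I) gt; rewrite /f fineK//.
  move: gt (g0 t); case: (g t) => [//| |//] /=.
  by rewrite gt_eqF.
have Eg x : line_maximal g x = line_maximal (EFin \o f) x.
  congr ereal_sup; apply: eq_imagel => k _.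
  have mb : measurable_fun setT (fun t : R => (bump1 eps (q k) (x - t))%:E).
    by apply/measurable_EFinP; apply: measurable_bump1; exact: measurable_funB.
  apply: ge0_ae_eq_integral => //.
  - exact: emeasurable_funM.
  - by apply: emeasurable_funM => //; exact/measurable_EFinP.
  - by move=> t _; rewrite mule_ge0// lee_fin bump1_ge0.
  - by move=> t _; rewrite mule_ge0// lee_fin ?bump1_ge0.
  - by apply: (@filterS _ _ (ae_filter_ringOfSetsType leb) _ _ _ aeg) => t -> _.
under eq_integral do rewrite Eg.
have If : \int[leb]_t (g t `^ s) = \int[leb]_t (f t `^ s)%:E.
  apply: ge0_ae_eq_integral => //.
  - by apply/measurable_EFinP; exact: (measurableT_comp (measurable_powR s)).
  - by move=> t _; exact: poweR_ge0.
  - by move=> t _; rewrite lee_fin powR_ge0.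
  - by apply: (@filterS _ _ (ae_filter_ringOfSetsType leb) _ _ _ aeg) => t -> _.
by rewrite If; apply: strong_type_real => //; rewrite -If ltey.
Qed.

End maximal_line.

(** * The radial maximal operator on R^n *)

Section maximal_space.
Context {R : realType}.
Local Open Scope ereal_scope.
Local Notation leb := (@lebesgue_measure R).
Variables (eps s : R) (q : nat -> R).
Hypotheses (eps_gt0 : (0 < eps)%R) (s_gt1 : (1 < s)%R) (q_gt0 : forall k, (0 < q k)%R).

Definition bump n (r : R) (x : Rn R n) : R := (\prod_(i < n) bump1 eps r (tnth x i))%R.

Lemma bump_ge0 n r (x : Rn R n) : (0 < r)%R -> (0 <= bump r x)%R.
Proof. by move=> r0; apply: prodr_ge0 => i _; exact: bump1_ge0. Qed.

Lemma bump_tcons n r a (x : Rn R n) :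
  bump r (tcons (a, x)) = (bump1 eps r a * bump r x)%R.
Proof.
rewrite /bump big_ord_recl; congr (_ * _)%R.
by apply: eq_bigr => i _; rewrite /tcons tnthS.
Qed.

Lemma tsub_tcons n a b (x y : Rn R n) :
  tsub (tcons (a, x)) (tcons (b, y)) = tcons (a - b, tsub x y)%R.
Proof.
apply: eq_from_tnth => i; rewrite tnth_mktuple.
by have [j|] := unliftP ord0 i => ->; rewrite /tcons ?tnthS ?tnth_mktuple.
Qed.

Lemma measurable_bump d (T : measurableType d) n r (f : T -> Rn R n) :
  measurable_fun setT f -> measurable_fun setT (fun t => bump r (f t)).
Proof.
move=> /measurable_fun_tnthP mf; apply: measurable_prod => i _.
by apply: measurable_bump1; exact: mf.
Qed.

Definition space_maximal n (g : Rn R n -> \bar R) (x : Rn R n) : \bar R :=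
  nsup (fun k => \int[lebesgueRn R n]_y ((bump (q k) (tsub x y))%:E * g y)).

Lemma space_maximal_ge0 n (g : Rn R n -> \bar R) x : (forall y, 0 <= g y) ->
  0 <= space_maximal g x.
Proof.
move=> g0; apply: nsup_ge0 => k; apply: integral_ge0 => t _.
by rewrite mule_ge0// lee_fin bump_ge0.
Qed.

(** The parameter serves the induction on the dimension, in which [g] is the
    restriction of a function to hyperplanes and the restriction varies. *)
Lemma measurable_space_maximal d (T : measurableType d) n
    (g : T -> Rn R n -> \bar R) (h : T -> Rn R n) :
  measurable_fun setT (fun p : T * Rn R n => g p.1 p.2) -> (forall t y, 0 <= g t y) ->
  measurable_fun setT h ->
  measurable_fun setT (fun t => space_maximal (g t) (h t)).
Proof.
move=> mg g0 mh; apply: measurable_fun_nsup => k.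
apply: (measurable_fun_fubini_tonelli_F
  (fun p : T * Rn R n => (bump (q k) (tsub (h p.1) p.2))%:E * g p.1 p.2)).
  apply: emeasurable_funM => //.
  apply/measurable_EFinP; apply: measurable_bump; apply: measurable_fun_tsub.
    exact: (measurableT_comp mh measurable_fst).
  exact: measurable_snd.
by move=> p; rewrite mule_ge0// lee_fin bump_ge0.
Qed.

(** The product profile factors: averaging first in the last [n] variables and
    taking the supremum there can only increase the result. *)
Lemma space_maximal_tcons n (f : Rn R n.+1 -> \bar R) a (x : Rn R n) :
  measurable_fun setT f -> (forall y, 0 <= f y) ->
  space_maximal f (tcons (a, x)) <=
  line_maximal eps q (fun b => space_maximal (fun y => f (tcons (b, y))) x) a.
Proof.
move=> mf f0; apply: nsup_le => k.
have mfp : measurable_fun setT (fun p : measurableTypeR R * Rn R n => f (tcons p)).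
  exact: (measurableT_comp mf (@measurable_tcons R n)).
have mb : measurable_fun setT
    (fun p : measurableTypeR R * Rn R n => (bump (q k) (tsub x p.2))%:E * f (tcons p)).
  apply: emeasurable_funM => //.
  apply/measurable_EFinP; apply: measurable_bump; apply: measurable_fun_tsub.
    exact: measurable_cst.
  exact: measurable_snd.
have mb1 : measurable_fun setT (fun b : measurableTypeR R => (bump1 eps (q k) (a - b))%:E).
  by apply/measurable_EFinP; apply: measurable_bump1; exact: measurable_funB.
rewrite integral_RnS; last 2 first.
- apply: emeasurable_funM => //.
  apply/measurable_EFinP; apply: measurable_bump; apply: measurable_fun_tsub.
    exact: measurable_cst.
  exact: measurable_id.
- by move=> y; rewrite mule_ge0// lee_fin bump_ge0.
have E b : \int[lebesgueRn R n]_z ((bump (q k) (tsub (tcons (a, x)) (tcons (b, z))))%:E *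
     f (tcons (b, z))) =
   (bump1 eps (q k) (a - b))%:E *
   \int[lebesgueRn R n]_z ((bump (q k) (tsub x z))%:E * f (tcons (b, z))).
  rewrite -ge0_integralZl//.
  - by apply: eq_integral => z _; rewrite tsub_tcons bump_tcons EFinM muleA.
  - exact: (measurable_fun_pair2 b mb).
  - by move=> z _; rewrite mule_ge0// lee_fin bump_ge0.
  - by rewrite lee_fin bump1_ge0.
under eq_integral do rewrite E.
apply: le_trans (le_nsup _ k).
apply: ge0_le_integral => //.
- move=> b _; rewrite mule_ge0 ?lee_fin ?bump1_ge0//; apply: integral_ge0 => z _.
  by rewrite mule_ge0// lee_fin bump_ge0.
- apply: emeasurable_funM => //.
  apply: (measurable_fun_fubini_tonelli_F (fun p : measurableTypeR R * Rn R n =>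
    (bump (q k) (tsub x p.2))%:E * f (tcons p))) => //.
  by move=> p; rewrite mule_ge0// lee_fin bump_ge0.
- apply: emeasurable_funM => //.
  apply: (@measurable_space_maximal _ (measurableTypeR R) n
    (fun b y => f (tcons (b, y))) (cst x)) => //.
- move=> b _; apply: lee_wpmul2l; first by rewrite lee_fin bump1_ge0.
  exact: (le_nsup (fun k => \int[lebesgueRn R n]_z
    ((bump (q k) (tsub x z))%:E * f (tcons (b, z)))) k).
Qed.

(** Induction on the dimension: [space_maximal_tcons] bounds the operator by a
    maximal operator in the first variable applied to one in the others, and
    Tonelli's theorem allows to integrate in either order. *)
Theorem space_maximal_strong n (f : Rn R n -> \bar R) :
  measurable_fun setT f -> (forall y, 0 <= f y) ->
  \int[lebesgueRn R n]_x (space_maximal f x `^ s) <=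
  (line_const eps s ^+ n)%:E * \int[lebesgueRn R n]_x (f x `^ s).
Proof.
have C0 : (0 < line_const eps s)%R by exact: line_const_gt0.
elim: n f => [|n ih] f mf f0.
  rewrite !integral_Rn0 expr0 mul1e.
  suff -> : space_maximal f [tuple] = f [tuple] by [].
  apply/eqP; rewrite eq_le; apply/andP; split.
    by apply: nsup_le => k; rewrite integral_Rn0 /bump big_ord0 mul1e.
  apply: le_trans (le_nsup _ 0%N).
  by rewrite integral_Rn0 /bump big_ord0 mul1e.
have mS : measurable_fun setT (fun p : measurableTypeR R * Rn R n => f (tcons p)).
  exact: (measurableT_comp mf (@measurable_tcons R n)).
pose G (p : measurableTypeR R * Rn R n) :=
  space_maximal (fun y => f (tcons (p.1, y))) p.2.
have G0 p : 0 <= G p by exact: space_maximal_ge0.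
have mG : measurable_fun setT G.
  apply: (@measurable_space_maximal _ (measurableTypeR R * Rn R n)%type n
    (fun p y => f (tcons (p.1, y))) snd) => //.
  apply: (measurableT_comp mS (g := fun p : (measurableTypeR R * Rn R n) * Rn R n => (p.1.1, p.2))).
  apply: measurable_fun_pair; last exact: measurable_snd.
  exact: (measurableT_comp measurable_fst measurable_fst).
have mGs : measurable_fun setT (fun p => G p `^ s).
  exact: (measurableT_comp (measurable_poweR s)).
have Gs0 p : 0 <= G p `^ s by exact: poweR_ge0.
have mMf : measurable_fun setT (space_maximal f).
  apply: (@measurable_space_maximal _ (Rn R n.+1) n.+1 (fun _ => f) id) => //.
  exact: (measurableT_comp mf measurable_snd).
have mMfs : measurable_fun setT (fun x => space_maximal f x `^ s).
  exact: (measurableT_comp (measurable_poweR s)).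
rewrite integral_RnS_swap//; last by move=> x; exact: poweR_ge0.
apply: (@le_trans _ _ (\int[lebesgueRn R n]_z ((line_const eps s)%:E *
    \int[leb]_b (G (b, z) `^ s)))).
  apply: ge0_le_integral => //.
  - by move=> z _; apply: integral_ge0 => t _; exact: poweR_ge0.
  - apply: (measurable_fun_fubini_tonelli_G
      (fun p : measurableTypeR R * Rn R n => space_maximal f (tcons p) `^ s)).
      exact: (measurableT_comp mMfs (@measurable_tcons R n)).
    by move=> p; exact: poweR_ge0.
  - apply: measurable_funeM.
    exact: (measurable_fun_fubini_tonelli_G
      (fun p : measurableTypeR R * Rn R n => G p `^ s)).
  - move=> z _; have mGz : measurable_fun setT (fun b : R => G (b, z)).
      exact: (measurable_fun_pair1 z mG).
    apply: le_trans (line_maximal_strong eps_gt0 s_gt1 q_gt0 mGz (fun b => G0 (b, z))).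
    apply: ge0_le_integral => //.
    + by move=> t _; exact: poweR_ge0.
    + apply: (measurable_fun_pair1 z (f := fun p => space_maximal f (tcons p) `^ s)).
      exact: (measurableT_comp mMfs (@measurable_tcons R n)).
    + apply: (measurableT_comp (measurable_poweR s)).
      apply: measurable_line_maximal => //.
    + move=> t _; apply: gt0_ler_poweR.
      * exact/ltW/(lt_trans ltr01).
      * by rewrite in_itv/= leey andbT space_maximal_ge0.
      * by rewrite in_itv/= leey andbT line_maximal_ge0.
      * exact: space_maximal_tcons.
rewrite ge0_integralZl//; last 3 first.
- exact: (measurable_fun_fubini_tonelli_G
    (fun p : measurableTypeR R * Rn R n => G p `^ s)).
- by move=> z _; exact: integral_ge0.
- by rewrite lee_fin ltW.
have CE (c : R) : (c ^+ n.+1)%:E = c%:E * (c ^+ n)%:E by rewrite exprS EFinM.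
rewrite CE -(muleA (line_const eps s)%:E).
apply: (@lee_wpmul2l _ (line_const eps s)%:E); first by rewrite lee_fin ltW.
have -> : \int[lebesgueRn R n]_z \int[leb]_b (G (b, z) `^ s) =
    \int[leb]_b \int[lebesgueRn R n]_z (G (b, z) `^ s).
  by apply/esym; apply: (fubini_tonelli (fun p : measurableTypeR R * Rn R n => G p `^ s)).
have mfs : measurable_fun setT (fun x => f x `^ s).
  exact: (measurableT_comp (measurable_poweR s)).
rewrite integral_RnS//; last by move=> x; exact: poweR_ge0.
have mfsp : measurable_fun setT (fun p : measurableTypeR R * Rn R n => f (tcons p) `^ s).
  exact: (measurableT_comp mfs (@measurable_tcons R n)).
rewrite -ge0_integralZl//; last 3 first.
- apply: (measurable_fun_fubini_tonelli_F
    (fun p : measurableTypeR R * Rn R n => f (tcons p) `^ s)) => //.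
  by move=> p; exact: poweR_ge0.
- by move=> b _; apply: integral_ge0 => z _; exact: poweR_ge0.
- by rewrite lee_fin exprn_ge0// ltW.
apply: ge0_le_integral => //.
- by move=> b _; exact: integral_ge0.
- exact: (measurable_fun_fubini_tonelli_F
    (fun p : measurableTypeR R * Rn R n => G p `^ s)).
- apply: measurable_funeM; apply: (measurable_fun_fubini_tonelli_F
    (fun p : measurableTypeR R * Rn R n => f (tcons p) `^ s)) => //.
  by move=> p; exact: poweR_ge0.
- move=> b _; exact: (ih (fun y => f (tcons (b, y))) (measurable_fun_pair2 b mS)
    (fun y => f0 (tcons (b, y)))).
Qed.

End maximal_space.

Section radial_maximal_function.
Context {R : realType}.
Local Open Scope ereal_scope.

Lemma abs_tnth_le_enorm n (x : Rn R n) i : (`|tnth x i| <= enorm x)%R.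
Proof.
rewrite -[leLHS]sqrtr_sqr /enorm ler_wsqrtr// /dotp (bigD1 i)//= -expr2 lerDl.
by apply: sumr_ge0 => j _; rewrite -expr2 sqr_ge0.
Qed.

Lemma radial_bump_ge0 n delta r (x : Rn R n) : (0 < r)%R -> (0 <= radial_bump delta r x)%R.
Proof. by move=> r0; rewrite mulr_ge0 ?powR_ge0// exprn_ge0// ltW. Qed.

(** Each coordinate is at most the norm, so [(1 + r |x|)^(- (N + delta))] is at
    most the product over the coordinates of [(1 + r |x_i|)^(- (1 + delta /
    N))]. *)
Lemma radial_bump_le_bump n delta r (x : Rn R n.+1) : (0 < r)%R -> (0 < delta)%R ->
  (radial_bump delta r x <= bump (delta / n.+1%:R) r x)%R.
Proof.
move=> r0 d0; have x0 := enorm_ge0 x.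
have rx0 : (0 <= r * enorm x)%R by rewrite mulr_ge0// ltW.
rewrite /radial_bump /bump /bump1 big_split/= prodr_const card_ord.
rewrite ler_wpM2l ?exprn_ge0 ?(ltW r0)//.
have -> : ((1 + r * enorm x) `^ (- (n.+1%:R + delta)) =
    \prod_(i < n.+1) (1 + r * enorm x) `^ (- (1 + delta / n.+1%:R)))%R.
  rewrite prodr_const card_ord -powR_mulrn ?powR_ge0// -powRrM; congr powR.
  by field; rewrite addrC natr1 pnatr_eq0.
apply: ler_prod => i _; rewrite powR_ge0/= !powRN.
have ri0 : (0 <= r * `|tnth x i|)%R by rewrite mulr_ge0// ltW.
have ri : (r * `|tnth x i| <= r * enorm x)%R.
  by rewrite ler_wpM2l ?(ltW r0)// abs_tnth_le_enorm.
rewrite lef_pV2 ?posrE ?powR_gt0//; [|lra|lra].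
by apply: ler_powR_base; [rewrite addr_ge0// divr_ge0// ltW|lra|lra].
Qed.

Lemma radial_bump_scale n delta a r (x : Rn R n) : (0 < delta)%R -> (0 < a)%R ->
  (a <= r)%R -> (r <= 2 * a)%R ->
  (radial_bump delta r x <= 2 ^+ n * radial_bump delta a x)%R.
Proof.
move=> d0 a0 ar ra; have x0 := enorm_ge0 x; have r0 : (0 < r)%R by lra.
have ax0 : (0 <= a * enorm x)%R by rewrite mulr_ge0// ltW.
have axr : (a * enorm x <= r * enorm x)%R by rewrite ler_wpM2r.
rewrite /radial_bump mulrA -exprMn ler_pM ?powR_ge0 ?exprn_ge0 ?(ltW r0)//.
  by rewrite lerXn2r ?nnegrE ?(ltW r0)//; lra.
rewrite !powRN lef_pV2 ?posrE ?powR_gt0//; [|lra|lra].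
by apply: ler_powR_base; [rewrite addr_ge0// ltW|lra|lra].
Qed.

(** At distance [|x|] the profile is at most [|x|^(- n)] at every scale; this
    is the decay of the maximal function away from the support of a block. *)
Lemma radial_bump_le_inv n delta r (x : Rn R n) : (0 < delta)%R -> (0 < r)%R ->
  (0 < enorm x)%R -> (radial_bump delta r x <= enorm x ^- n)%R.
Proof.
move=> d0 r0 x0; have rx0 : (0 < r * enorm x)%R by rewrite mulr_gt0.
rewrite /radial_bump -ler_pdivlMl ?exprn_gt0// -invfM -exprMn powRN.
rewrite lef_pV2 ?posrE ?powR_gt0 ?exprn_gt0//; last by lra.
have n0 : (0 <= n%:R :> R)%R by [].
rewrite powRD; last by rewrite (_ : n%:R + delta == 0 = false)%R//; apply/eqP; lra.
rewrite powR_mulrn; last by lra.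
rewrite -[leLHS]mulr1 ler_pM ?exprn_ge0 ?(ltW rx0)//.
  by rewrite lerXn2r ?nnegrE; lra.
have h1 : (1 <= 1 + r * enorm x)%R by lra.
by have := ler_powR h1 (ltW d0); rewrite powRr0.
Qed.

Definition dyadic_scale (k : nat) : R := (if odd k then 2 ^+ k./2 else 2 ^- k./2)%R.

Lemma dyadic_scale_gt0 k : (0 < dyadic_scale k)%R.
Proof. by rewrite /dyadic_scale; case: ifP; rewrite ?invr_gt0 exprn_gt0. Qed.

Lemma dyadic_scale_bracket r : (0 < r)%R -> exists k, (dyadic_scale k <= r <= 2 * dyadic_scale k)%R.
Proof.
move=> r0; have [k [/andP[k1 k2]|/andP[k1 k2]]] := dyadic_bracket r0.
  exists (k.*2.+1); rewrite /dyadic_scale /= odd_double /= uphalf_double.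
  by rewrite (ltW k1).
by exists (k.*2); rewrite /dyadic_scale odd_double doubleK (ltW k1).
Qed.

(** Dyadic scales suffice, since the profiles at two scales within a factor [2]
    of each other are comparable ([radial_bump_scale]). *)
Definition radial_maximal n delta (g : Rn R n -> \bar R) (x : Rn R n) : \bar R :=
  nsup (fun k => \int[lebesgueRn R n]_y ((radial_bump delta (dyadic_scale k) (tsub x y))%:E * g y)).

Lemma measurable_radial_bump d (T : measurableType d) n delta r (f : T -> Rn R n) :
  measurable_fun setT f -> measurable_fun setT (fun t => radial_bump delta r (f t)).
Proof.
move=> mf; apply: measurable_funM; first exact: measurable_cst.
apply: (measurableT_comp (measurable_powR _)).
apply: measurable_funD; first exact: measurable_cst.
apply: measurable_funM; first exact: measurable_cst.
exact: measurable_fun_enorm.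
Qed.

Lemma radial_maximal_ge0 n delta (g : Rn R n -> \bar R) x : (forall y, 0 <= g y) ->
  0 <= radial_maximal delta g x.
Proof.
move=> g0; apply: nsup_ge0 => k; apply: integral_ge0 => t _.
by rewrite mule_ge0// lee_fin radial_bump_ge0// dyadic_scale_gt0.
Qed.

Lemma measurable_radial_integrand n delta k (g : Rn R n -> \bar R) x :
  measurable_fun setT g ->
  measurable_fun setT (fun y => (radial_bump delta (dyadic_scale k) (tsub x y))%:E * g y).
Proof.
move=> mg; apply: emeasurable_funM => //; apply/measurable_EFinP.
apply: measurable_radial_bump; apply: measurable_fun_tsub; first exact: measurable_cst.
exact: measurable_id.
Qed.

Lemma measurable_radial_maximal n delta (g : Rn R n -> \bar R) :
  measurable_fun setT g -> (forall y, 0 <= g y) ->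
  measurable_fun setT (radial_maximal delta g).
Proof.
move=> mg g0; apply: measurable_fun_nsup => k.
apply: (measurable_fun_fubini_tonelli_F
  (fun p : Rn R n * Rn R n => (radial_bump delta (dyadic_scale k) (tsub p.1 p.2))%:E * g p.2)).
  apply: emeasurable_funM; last exact: (measurableT_comp mg measurable_snd).
  apply/measurable_EFinP; apply: measurable_radial_bump; apply: measurable_fun_tsub.
    exact: measurable_fst.
  exact: measurable_snd.
by move=> p; rewrite mule_ge0// lee_fin radial_bump_ge0// dyadic_scale_gt0.
Qed.

Theorem radial_maximal_strong n (delta s : R) : (0 < delta)%R -> (1 < s)%R ->
  exists2 C : R, (0 < C)%R & forall f : Rn R n.+1 -> \bar R,
  measurable_fun setT f -> (forall y, 0 <= f y) ->
  \int[lebesgueRn R n.+1]_x (radial_maximal delta f x `^ s) <=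
  C%:E * \int[lebesgueRn R n.+1]_x (f x `^ s).
Proof.
move=> d0 s1; pose eps : R := (delta / n.+1%:R)%R.
have e0 : (0 < eps)%R by rewrite divr_gt0.
exists (line_const eps s ^+ n.+1)%R; first by rewrite exprn_gt0// line_const_gt0.
move=> f mf f0; apply: le_trans (space_maximal_strong e0 s1 dyadic_scale_gt0 mf f0).
have mM : measurable_fun setT (space_maximal eps dyadic_scale f).
  apply: (@measurable_space_maximal _ eps dyadic_scale dyadic_scale_gt0 _ (Rn R n.+1) n.+1 (fun _ => f) id) => //.
  exact: (measurableT_comp mf measurable_snd).
apply: ge0_le_integral.
- exact: measurableT.
- by move=> x _; exact: poweR_ge0.
- by apply: (measurableT_comp (measurable_poweR s)); exact: measurable_radial_maximal.
- exact: (measurableT_comp (measurable_poweR s)).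
- move=> x _; apply: gt0_ler_poweR.
  + exact/ltW/(lt_trans ltr01).
  + by rewrite in_itv/= leey andbT radial_maximal_ge0.
  + by rewrite in_itv/= leey andbT space_maximal_ge0//; exact: dyadic_scale_gt0.
  + apply: nsup_le => k; apply: le_trans (le_nsup _ k).
    apply: ge0_le_integral.
    * exact: measurableT.
    * by move=> y _; rewrite mule_ge0// lee_fin radial_bump_ge0// dyadic_scale_gt0.
    * exact: measurable_radial_integrand.
    * apply: emeasurable_funM => //; apply/measurable_EFinP; apply: measurable_bump.
      by apply: measurable_fun_tsub; [exact: measurable_cst|exact: measurable_id].
    * move=> y _; apply: lee_wpmul2r => //; rewrite lee_fin.
      by apply: radial_bump_le_bump => //; exact: dyadic_scale_gt0.
Qed.

End radial_maximal_function.

(** * Balls, functions concentrated on balls, and annuli *)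

Section ball_measure.
Context {R : realType}.
Local Open Scope ereal_scope.

Lemma measurable_cball n (x0 : Rn R n) r : measurable (cball x0 r).
Proof.
rewrite (_ : cball x0 r = (fun x => enorm (tsub x x0)) @^-1` `]-oo, r]%classic).
  rewrite -[X in measurable X]setTI.
  apply: (measurable_fun_enorm (f := fun x => tsub x x0)) => //.
  by apply: measurable_fun_tsub; [exact: measurable_id|exact: measurable_cst].
by apply/seteqP; split => x /=; rewrite in_itv.
Qed.

(** The ball lies in a cube of side [2 r]. *)
Lemma cball_upper n (x0 : Rn R n) r : (0 <= r)%R ->
  lebesgueRn R n (cball x0 r) <= ((2 * r) ^+ n)%:E.
Proof.
move=> r0; pose A (i : 'I_n) : set R := `[(tnth x0 i - r)%R, (tnth x0 i + r)%R]%classic.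
have mA i : measurable (A i : set (measurableTypeR R)) by exact: measurable_itv.
have mB : measurable [set x : Rn R n | forall i, A i (tnth x i)].
  rewrite (_ : mkset _ = \bigcap_(i in [set: 'I_n])
      ((fun x : Rn R n => tnth x i) @^-1` A i)).
    apply: fin_bigcap_measurable => // i _.
    by rewrite -[X in measurable X]setTI; exact: measurable_tnth.
  by apply/seteqP; split=> [x xA i _|x xA i]; exact: xA.
apply: (@le_trans _ _ (lebesgueRn R n [set x : Rn R n | forall i, A i (tnth x i)])).
  apply: le_measure; rewrite ?inE//; first exact: measurable_cball.
  move=> x xB i; rewrite /A /= in_itv/= -ler_distl.
  by apply: le_trans xB; have := abs_tnth_le_enorm (tsub x x0) i; rewrite tnth_mktuple.
rewrite lebesgueRn_box//.
rewrite (eq_bigr (fun=> (2 * r)%:E)).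
  by rewrite prodEFin prodr_const card_ord.
move=> i _; rewrite lebesgue_measure_itv/= lte_fin.
case: ifPn => h; first by rewrite -EFinB; congr EFin; ring.
have -> : r = 0%R by apply/eqP; rewrite eq_le r0 andbT; move: h; rewrite -leNgt; lra.
by rewrite mulr0.
Qed.

(** The ball contains a cube of half-side [r / N], the crude bound of the norm
    by the sum of the coordinates being enough here. *)
Lemma cball_lower n (x0 : Rn R n.+1) r : (0 < r)%R ->
  ((2 * (r / n.+1%:R)) ^+ n.+1)%:E <= lebesgueRn R n.+1 (cball x0 r).
Proof.
move=> r0; pose t : R := (r / n.+1%:R)%R.
have t0 : (0 < t)%R by rewrite divr_gt0.
pose A (i : 'I_n.+1) : set R := `[(tnth x0 i - t)%R, (tnth x0 i + t)%R]%classic.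
have mA i : measurable (A i : set (measurableTypeR R)) by exact: measurable_itv.
have mB : measurable [set x : Rn R n.+1 | forall i, A i (tnth x i)].
  rewrite (_ : mkset _ = \bigcap_(i in [set: 'I_n.+1])
      ((fun x : Rn R n.+1 => tnth x i) @^-1` A i)).
    apply: fin_bigcap_measurable => // i _.
    by rewrite -[X in measurable X]setTI; exact: measurable_tnth.
  by apply/seteqP; split=> [x xA i _|x xA i]; exact: xA.
apply: (@le_trans _ _ (lebesgueRn R n.+1 [set x : Rn R n.+1 | forall i, A i (tnth x i)])).
  rewrite lebesgueRn_box// (eq_bigr (fun=> (2 * t)%:E)).
    by rewrite prodEFin prodr_const card_ord.
  move=> i _; rewrite lebesgue_measure_itv/= lte_fin ifT; last by lra.
  by rewrite -EFinB; congr EFin; ring.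
apply: le_measure; rewrite ?inE//; first exact: measurable_cball.
move=> x xA; rewrite /cball /= /enorm -(ger0_norm (ltW r0)) -sqrtr_sqr ler_wsqrtr//.
apply: (@le_trans _ _ (\sum_(i < n.+1) t ^+ 2)%R).
  apply: ler_sum => i _; rewrite -expr2 tnth_mktuple -real_normK ?num_real//.
  rewrite lerXn2r ?nnegrE ?(ltW t0)//.
  by have := xA i; rewrite /A /= in_itv/= -ler_distl.
have N1 : (1 <= n.+1%:R :> R)%R by rewrite ler1n.
have -> : r = (t * n.+1%:R)%R by rewrite /t divfK// pnatr_eq0.
have -> : (\sum_(i < n.+1) t ^+ 2 = t ^+ 2 * n.+1%:R)%R.
  by rewrite sumr_const card_ord mulr_natr.
have key (a b : R) : (1 <= b -> a ^+ 2 * b <= (a * b) ^+ 2)%R.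
  move=> b1; rewrite exprMn ler_wpM2l ?sqr_ge0//.
  by rewrite expr2 ler_peMl// (le_trans ler01).
exact: key.
Qed.

Lemma cball_fin n (x0 : Rn R n) r : (0 <= r)%R -> lebesgueRn R n (cball x0 r) < +oo.
Proof. by move=> r0; apply: le_lt_trans (cball_upper x0 r0) _; rewrite ltry. Qed.

End ball_measure.

Section block_mass.
Context {R : realType} {n : nat}.
Local Notation N := n.+1.
Local Notation mu := (lebesgueRn R N).

Definition vol (x0 : Rn R N) r : R := fine (mu (cball x0 r)).

Lemma volE x0 r : (0 <= r)%R -> mu (cball x0 r) = (vol x0 r)%:E.
Proof.
move=> r0; rewrite /vol fineK// ge0_fin_numE//.
exact: cball_fin.
Qed.

Lemma vol_upper x0 r : (0 <= r)%R -> (vol x0 r <= (2 * r) ^+ N)%R.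
Proof. by move=> r0; rewrite -lee_fin -volE// cball_upper. Qed.

Lemma vol_lower x0 r : (0 < r)%R -> ((2 * (r / N%:R)) ^+ N <= vol x0 r)%R.
Proof. by move=> r0; rewrite -lee_fin -volE ?(ltW r0)// cball_lower. Qed.

Lemma vol_gt0 x0 r : (0 < r)%R -> (0 < vol x0 r)%R.
Proof.
by move=> r0; rewrite (lt_le_trans _ (vol_lower x0 r0))// exprn_gt0// mulr_gt0// divr_gt0.
Qed.

Lemma vol_ratio x0 r a b : (0 < r)%R -> (0 < a)%R -> (0 < b)%R ->
  (vol x0 (a * r) <= (N%:R * (a / b)) ^+ N * vol x0 (b * r))%R.
Proof.
move=> r0 a0 b0; have ar : (0 < a * r)%R by rewrite mulr_gt0.
have br : (0 < b * r)%R by rewrite mulr_gt0.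
apply: le_trans (vol_upper x0 (ltW ar)) _.
apply: (@le_trans _ _ ((N%:R * (a / b)) ^+ N * (2 * (b * r / N%:R)) ^+ N)%R); last first.
  by rewrite ler_wpM2l ?vol_lower// exprn_ge0// mulr_ge0// divr_ge0// ltW.
rewrite -exprMn le_eqVlt; apply/orP; left; apply/eqP; congr (_ ^+ _)%R.
by field; rewrite (gt_eqF b0)/= addrC natr1 pnatr_eq0.
Qed.

Local Open Scope ereal_scope.

Lemma poweR_le (s : R) (x y : \bar R) : (0 <= s)%R -> 0 <= x -> x <= y -> x `^ s <= y `^ s.
Proof.
move=> s0 x0 xy; apply: gt0_ler_poweR => //; rewrite in_itv/= leey andbT//.
exact: le_trans xy.
Qed.

(** Either [x <= T], or [x = x^s x^(1 - s)] and [1 - s] is negative. *)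
Lemma truncated_Young (s T : R) (x : \bar R) : (1 < s)%R -> (0 < T)%R -> 0 <= x ->
  x <= T%:E + (T `^ (1 - s))%:E * x `^ s.
Proof.
move=> s1 T0; have TT : (0 < T `^ (1 - s))%R by rewrite powR_gt0.
case: x => [x| |] // x0; last first.
  by rewrite poweRyr ?gt0_muley ?lte_fin// ?leey// gt_eqF// (lt_trans ltr01).
rewrite poweR_EFin -EFinM -EFinD lee_fin; rewrite lee_fin in x0.
have [xT|Tx] := leP x T.
  by rewrite (le_trans xT)// lerDl mulr_ge0 ?powR_ge0// ltW.
have x1 : (0 < x)%R by exact: lt_trans Tx.
rewrite -[leLHS]add0r lerD ?(ltW T0)//.
rewrite -[leLHS]powRr1 ?(ltW x1)// -[X in (x `^ X <= _)%R](subrK s) powRD; last first.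
  by rewrite (gt_eqF x1) implybT.
rewrite ler_wpM2r ?powR_ge0// -(opprB s) !powRN lef_pV2 ?posrE ?powR_gt0//.
by apply: ler_powR_base; lra.
Qed.

(** The size and support conditions on the modulus of a block, with [e] the
    exponent of the volume. Values in the extended reals make room for maximal
    functions, which may be infinite on a null set. *)
Record mass_block (s e : R) (x0 : Rn R N) (r : R) (g : Rn R N -> \bar R) : Prop := MassBlock {
  mass_block_radius : (0 < r)%R ;
  mass_block_measurable : measurable_fun setT g ;
  mass_block_ge0 : forall x, 0 <= g x ;
  mass_block_support : forall x, g x != 0 -> cball x0 r x ;
  mass_block_bound : \int[mu]_x (g x `^ s) <= (vol x0 r `^ (e * s))%:E }.

Lemma integral_indic_cst (c : R) (A : set (Rn R N)) : measurable A -> (0 <= c)%R ->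
  \int[mu]_x ((c * \1_A x)%:E) = c%:E * mu A.
Proof.
move=> mA c0; under eq_integral do rewrite EFinM.
rewrite ge0_integralZl//; last by apply/measurable_EFinP; exact: measurable_indic.
by rewrite integral_indic// setIT.
Qed.

(** Apply [truncated_Young] at the height [T = |B|^(e - 1/s)], the mean height
    of [g]: the part below contributes [T |B|] and the part above [T^(1 - s)
    |B|^(e s)], and both equal [|B|^(1 - 1/s + e)]. *)
Lemma mass_block_L1 s e x0 r g : (1 < s)%R -> mass_block s e x0 r g ->
  \int[mu]_x g x <= (2 * vol x0 r `^ (1 - s^-1 + e))%:E.
Proof.
move=> s1 [r0 mg g0 gB gs]; have m0 := vol_gt0 x0 r0; set m := vol x0 r in m0 gs *.
pose T : R := (m `^ (e - s^-1))%R; have T0 : (0 < T)%R by rewrite powR_gt0.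
have s0 : (0 < s)%R by exact: lt_trans ltr01 s1.
have mB : measurable (cball x0 r) by exact: measurable_cball.
have mgs : measurable_fun setT (fun x => g x `^ s).
  exact: (measurableT_comp (measurable_poweR s)).
apply: (@le_trans _ _ (\int[mu]_x ((T * \1_(cball x0 r) x)%:E + (T `^ (1 - s))%:E * g x `^ s))).
  apply: ge0_le_integral => //.
  - apply: emeasurable_funD; last exact: measurable_funeM.
    apply/measurable_EFinP; apply: measurable_funM; first exact: measurable_cst.
    exact: measurable_indic.
  - move=> x _; have [->|gx] := eqVneq (g x) 0.
      rewrite adde_ge0 ?lee_fin ?mulr_ge0 ?(ltW T0)//.
      exact: powR_ge0.
    rewrite indicE mem_set ?mulr1; last exact: gB.
    exact: truncated_Young.
rewrite ge0_integralD//; last 4 first.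
- by move=> x _; rewrite lee_fin mulr_ge0// ltW.
- apply/measurable_EFinP; apply: measurable_funM; first exact: measurable_cst.
  exact: measurable_indic.
- by move=> x _; rewrite mule_ge0 ?poweR_ge0// lee_fin powR_ge0.
- exact: measurable_funeM.
rewrite integral_indic_cst ?(ltW T0)// (volE x0 (ltW r0)) -/m.
rewrite ge0_integralZl//; last 2 first.
- by move=> x _; exact: poweR_ge0.
- by rewrite lee_fin powR_ge0.
apply: (@le_trans _ _ ((T * m)%:E + (T `^ (1 - s) * m `^ (e * s))%:E)).
  by rewrite EFinM leeD2l// EFinM lee_wpmul2l// lee_fin powR_ge0.
rewrite -EFinD lee_fin le_eqVlt; apply/orP; left; apply/eqP.
have -> : (T * m = m `^ (1 - s^-1 + e))%R.
  have key (z : R) : (0 < z -> z `^ (e - s^-1) * z = z `^ (1 - s^-1 + e))%R.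
    move=> z0; rewrite -{2}(powRr1 (ltW z0)) -powRD; first by congr powR; ring.
    by rewrite (gt_eqF z0) implybT.
  exact: key.
have -> : (T `^ (1 - s) * m `^ (e * s) = m `^ (1 - s^-1 + e))%R.
  have key (z : R) : (0 < z -> (z `^ (e - s^-1)) `^ (1 - s) * z `^ (e * s) =
      z `^ (1 - s^-1 + e))%R.
    move=> z0; rewrite -powRrM -powRD; last by rewrite (gt_eqF z0) implybT.
    by congr powR; field; rewrite gt_eqF.
  exact: key.
by ring.
Qed.

(** On a small ball the total mass is at most [2], as [1 - 1/s + e] is
    positive. On a large ball [g <= 1 + g^s], and [e <= 0] makes the integral
    of [g^s] at most [1]. *)
Lemma mass_block_local s e x0 r g (A : set (Rn R N)) : (1 < s)%R -> (e <= 0)%R ->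
  (- (1 - s^-1) < e)%R -> mass_block s e x0 r g -> measurable A ->
  \int[mu]_x (g x * (\1_A x)%:E) <= 2%:E + mu A.
Proof.
move=> s1 e0 e1 bg mA; case: (bg) => [r0 mg g0 gB gs].
have s0 : (0 < s)%R by exact: lt_trans ltr01 s1.
have m0 := vol_gt0 x0 r0.
have mgA : measurable_fun setT (fun x => g x * (\1_A x)%:E).
  by apply: emeasurable_funM => //; apply/measurable_EFinP; exact: measurable_indic.
have gA0 x : 0 <= g x * (\1_A x)%:E by rewrite mule_ge0// lee_fin.
have mgs : measurable_fun setT (fun x => g x `^ s).
  exact: (measurableT_comp (measurable_poweR s)).
have [m1|m1] := leP (vol x0 r) 1%R.
  apply: (@le_trans _ _ 2%:E); last by rewrite leeDl.
  apply: (@le_trans _ _ (\int[mu]_x g x)).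
    apply: ge0_le_integral => // x _.
    by rewrite -[leRHS]mule1 lee_wpmul2l// lee_fin indicE; case: (_ \in _).
  apply: le_trans (mass_block_L1 s1 bg) _; rewrite lee_fin -[leRHS]mulr1 ler_wpM2l//.
  apply: (@le_trans _ _ (1 `^ (1 - s^-1 + e))%R); last by rewrite powR1.
  by apply: ler_powR_base => //; [lra|exact: ltW].
have mI : measurable_fun setT (fun x : Rn R N => (1 * \1_A x)%:E : \bar R).
  apply/measurable_EFinP; apply: measurable_funM; first exact: measurable_cst.
  exact: measurable_indic.
apply: (@le_trans _ _ (\int[mu]_x ((1 * \1_A x)%:E + g x `^ s))).
  apply: ge0_le_integral => //.
  - exact: emeasurable_funD.
  - move=> x _; rewrite mul1r indicE; case: (x \in A); last first.
      by rewrite mule0 add0e poweR_ge0.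
    by rewrite mule1; have := truncated_Young s1 ltr01 (g0 x); rewrite powR1 mul1e.
rewrite ge0_integralD//; last by move=> x _; exact: poweR_ge0.
rewrite integral_indic_cst// mul1e addeC leeD2r//.
apply: le_trans gs _; rewrite lee_fin (@le_trans _ _ 1%R)//; last by lra.
rewrite -(powRr0 (vol x0 r)); apply: ler_powR; first exact: ltW.
by rewrite mulr_le0_ge0// ltW.
Qed.

(** By [mass_block_local] the series has a finite integral over every ball
    around the origin. *)
Lemma mass_block_summable s e (c : R^nat) (x0 : nat -> Rn R N) (r : R^nat)
    (g : nat -> Rn R N -> \bar R) : (1 < s)%R -> (e <= 0)%R -> (- (1 - s^-1) < e)%R ->
  (forall k, 0 <= c k)%R -> \sum_(0 <= k <oo) (c k)%:E < +oo ->
  (forall k, mass_block s e (x0 k) (r k) (g k)) ->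
  {ae mu, forall x, \sum_(0 <= k <oo) ((c k)%:E * g k x) < +oo}.
Proof.
move=> s1 e0 e1 c0 cs bg.
have mg k : measurable_fun setT (g k) by case: (bg k).
have g0 k x : 0 <= g k x by case: (bg k).
pose G x := \sum_(0 <= k <oo) ((c k)%:E * g k x).
have mG : measurable_fun setT G.
  apply: ge0_emeasurable_sum => [j t _ _|j _]; first by rewrite mule_ge0// lee_fin.
  exact: measurable_funeM.
have G0 x : 0 <= G x by apply: nneseries_ge0 => k _ _; rewrite mule_ge0// lee_fin.
pose o : Rn R N := [tuple 0%R | i < N].
pose B (M : nat) := cball o M%:R.
have mB M : measurable (B M) by exact: measurable_cball.
have fB M : mu (B M) < +oo by exact: cball_fin.
suff H M : {ae mu, forall x, B M x -> G x < +oo}.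
  have : {ae mu, forall x, forall M, B M x -> G x < +oo} by exact: ae_foralln.
  apply: (@filterS _ _ (ae_filter_ringOfSetsType mu)) => x Hx.
  have [M Mx] : exists M : nat, (enorm (tsub x o) <= M%:R)%R.
    exists (Num.truncn (enorm (tsub x o))).+1; apply/ltW; exact: truncnS_gt.
  exact: (Hx M Mx).
have mGB : measurable_fun setT (fun x => G x * (\1_(B M) x)%:E).
  by apply: emeasurable_funM => //; apply/measurable_EFinP; exact: measurable_indic.
have iGB : mu.-integrable setT (fun x => G x * (\1_(B M) x)%:E).
  apply/integrableP; split=> //.
  under eq_integral do rewrite gee0_abs ?mule_ge0 ?lee_fin//.
  apply: (@le_lt_trans _ _ (\sum_(0 <= k <oo) (c k)%:E * (2%:E + mu (B M)))); last first.
    rewrite (eq_eseriesr (g := fun k => (fine (2%:E + mu (B M)))%:E * (c k)%:E)); last first.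
      by move=> k _; rewrite muleC fineK// fin_numD/= ge0_fin_numE// fB.
    rewrite nneseriesZl => [|k _]; last by rewrite lee_fin.
    by rewrite lte_mul_pinfty// lee_fin fine_ge0// adde_ge0.
  rewrite (_ : \int[mu]_x _ = \sum_(0 <= k <oo) \int[mu]_x ((c k)%:E * (g k x * (\1_(B M) x)%:E))).
    apply: lee_nneseries => [k _ _|k _].
      by apply: integral_ge0 => x _; rewrite !mule_ge0// lee_fin.
    rewrite ge0_integralZl ?lee_fin//; last 2 first.
      by apply: emeasurable_funM => //; apply/measurable_EFinP; exact: measurable_indic.
      by move=> x _; rewrite mule_ge0// lee_fin.
    by rewrite lee_wpmul2l ?lee_fin//; exact: (mass_block_local s1 e0 e1 (bg k)).
  rewrite -integral_nneseries//.
  - apply: eq_integral => x _; rewrite /G muleC -nneseriesZl//.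
      by apply: eq_eseriesr => k _; rewrite muleC muleA.
    by move=> k _; rewrite mule_ge0// lee_fin.
  - move=> k; apply: measurable_funeM.
    by apply: emeasurable_funM => //; apply/measurable_EFinP; exact: measurable_indic.
  - by move=> k x _; rewrite !mule_ge0// lee_fin.
have := integrable_ae measurableT iGB.
apply: (@filterS _ _ (ae_filter_ringOfSetsType mu)) => x /(_ I) Hx Bx.
move: Hx; rewrite indicE mem_set// mule1 => Hx.
by rewrite -ge0_fin_numE.
Qed.

End block_mass.

Lemma expr_le (R : realDomainType) k (a b : R) : 0 <= a -> a <= b -> a ^+ k <= b ^+ k.
Proof. by move=> a0 ab; rewrite lerXn2r ?nnegrE// (le_trans a0). Qed.

Section annuli.
Context {R : realType} {n : nat}.
Local Notation N := n.+1.
Local Notation mu := (lebesgueRn R N).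

Definition annulus (x0 : Rn R N) (r : R) (j : nat) : set (Rn R N) :=
  cball x0 (2 ^+ j.+1 * r) `\` (if j is 0%N then set0 else cball x0 (2 ^+ j * r)).

Lemma measurable_annulus x0 r j : measurable (annulus x0 r j).
Proof.
apply: measurableD; first exact: measurable_cball.
by case: j => // j; exact: measurable_cball.
Qed.

Lemma annulus_cover x0 r x : 0 < r -> exists j, annulus x0 r j x.
Proof.
move=> r0.
have ex : exists j, (enorm (tsub x x0) <= 2 ^+ j.+1 * r).
  pose t := enorm (tsub x x0) / r.
  exists (Num.truncn t).+1; rewrite -ler_pdivrMr//.
  have := truncnS_gt t; rewrite -/t => /ltW/le_trans; apply.
  rewrite -natrX ler_nat; apply: (@leq_trans (2 ^ (Num.truncn t).+1)).
    exact/ltnW/ltn_expl.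
  by rewrite leq_exp2l.
exists (ex_minn ex); case: ex_minnP => -[|j] xj jmin; split=> //=.
by rewrite /cball/= => xj'; have := jmin j xj'; rewrite ltnn.
Qed.

(** From [(u + v)^2 <= 2 u^2 + 2 v^2] in each coordinate; the factor [2] is
    small enough to separate a ball from the complement of its double. *)
Lemma quasi_triangle (x y x0 : Rn R N) :
  enorm (tsub x x0) ^+ 2 <= 2 * enorm (tsub x y) ^+ 2 + 2 * enorm (tsub y x0) ^+ 2.
Proof.
rewrite !sqr_enorm /dotp !mulr_sumr -big_split/=; apply: ler_sum => i _.
rewrite !tnth_mktuple.
by have := sqr_ge0 (tnth x i + tnth x0 i - 2 * tnth y i); nra.
Qed.

Lemma annulus_separation x0 r j x y : 0 < r -> annulus x0 r j.+1 x -> cball x0 r y ->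
  2 ^+ j.+2 * r / 4 <= enorm (tsub x y).
Proof.
move=> r0 [_ /=]; rewrite /cball /= => /negP; rewrite -ltNge => xj yr.
have q := quasi_triangle x y x0.
have a0 := enorm_ge0 (tsub x y).
have y0 := enorm_ge0 (tsub y x0).
have p1 : 1 <= 2 ^+ j :> R by rewrite exprn_ege1// ler1n.
move: p1 xj; rewrite !exprS; set P := 2 ^+ j => p1 xj.
rewrite leNgt; apply/negP => ax.
have : (2 * P * r) ^+ 2 <= enorm (tsub x x0) ^+ 2.
  by apply: expr_le (ltW xj); rewrite !mulr_ge0// ?(ltW r0)// (le_trans ler01).
have : enorm (tsub y x0) ^+ 2 <= r ^+ 2.
  by rewrite lerXn2r ?nnegrE// ltW.
have : enorm (tsub x y) ^+ 2 < (P * r) ^+ 2.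
  by rewrite ltrXn2r ?nnegrE// ?mulr_ge0 ?(ltW r0) ?(le_trans ler01)//; lra.
have : r ^+ 2 <= (P * r) ^+ 2.
  rewrite lerXn2r ?nnegrE ?mulr_ge0 ?(ltW r0) ?(le_trans ler01)//.
  by rewrite ler_peMl// ltW.
by nra.
Qed.

End annuli.

Section annulus_estimate.
Context {R : realType} {n : nat}.
Local Notation N := n.+1.
Local Notation mu := (lebesgueRn R N).
Local Open Scope ereal_scope.
Variables (delta s e : R).
Hypotheses (delta_gt0 : (0 < delta)%R) (s_gt1 : (1 < s)%R).
Hypotheses (e_le0 : (e <= 0)%R) (e_gt : (- (1 - s^-1) < e)%R).

Let gam : R := (1 - s^-1 + e)%R.
Let gam_gt0 : (0 < gam)%R. Proof. by move: e_gt; rewrite /gam; set t := (s^-1)%R; lra. Qed.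
Let s_gt0 : (0 < s)%R. Proof. exact: lt_trans ltr01 s_gt1. Qed.
Let N0 : (0 < N%:R :> R)%R. Proof. by []. Qed.

(** Passing to the next annulus divides the bound [mass / distance^N] by [2^N],
    while the size allowed to a block changes with the volume of the ball; the
    exponent [gam] measures what remains. *)
Definition annular_rate : R := ((2^-1 ^+ N) `^ gam)%R.

Lemma annular_rate_gt0 : (0 < annular_rate)%R.
Proof. by rewrite powR_gt0// exprn_gt0. Qed.

Lemma annular_rate_lt1 : (annular_rate < 1)%R.
Proof.
apply: (@lt_le_trans _ _ (1 `^ gam)%R); last by rewrite powR1.
apply: gt0_ltr_powR; rewrite ?nnegrE ?exprn_ge0//.
by rewrite exprn_ilt1//; lra.
Qed.

(** The factor [2] is that of [mass_block_L1]; [8^N] compares the volume of a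
    ball of radius [Q] with [(Q / 4)^N]; the last factor comes from bounding
    balls by cubes. *)
Let far_const : R := (2 * 8 ^+ N * (N%:R ^+ N) `^ gam)%R.

Let far_arith (x0 : Rn R N) (r : R) j : (0 < r)%R ->
  ((2 ^+ j.+2 * r / 4) ^- N * (2 * vol x0 r `^ gam) <=
   far_const * annular_rate ^+ j.+1 * vol x0 (2 ^+ j.+2 * r) `^ (e - s^-1))%R.
Proof.
move=> r0; set Q := (2 ^+ j.+2 * r)%R.
have Q0 : (0 < Q)%R by rewrite mulr_gt0// exprn_gt0.
have m0 := vol_gt0 x0 r0; have M0 := vol_gt0 x0 Q0.
set m := vol x0 r in m0 *; set M := vol x0 Q in M0 *.
have h1 : ((Q / 4) ^- N <= 8 ^+ N / M)%R.
  have := vol_upper x0 (ltW Q0); rewrite -/M => MQ.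
  rewrite ler_pdivlMr// ler_pdivrMl ?exprn_gt0 ?divr_gt0// -exprMn.
  by apply: le_trans MQ _; rewrite le_eqVlt; apply/orP; left; apply/eqP; congr (_ ^+ _)%R; field.
have h2 : (m <= N%:R ^+ N * (2^-1 ^+ N) ^+ j.+1 * M)%R.
  have := @vol_ratio _ _ x0 r 1%R (2 ^+ j.+2)%R r0 ltr01 (exprn_gt0 _ (ltr0Sn _ _)).
  rewrite !mul1r -/m -/Q -/M => /le_trans; apply.
  rewrite ler_wpM2r ?(ltW M0)// exprMn ler_wpM2l ?exprn_ge0//.
  rewrite exprAC lerXn2r ?nnegrE ?invr_ge0 ?exprn_ge0//.
  by rewrite exprVn lef_pV2 ?posrE ?exprn_gt0// ler_eXn2l ?ltr1n.
have h3 : (m `^ gam <= (N%:R ^+ N) `^ gam * annular_rate ^+ j.+1 * M `^ gam)%R.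
  apply: (@le_trans _ _ ((N%:R ^+ N * (2^-1 ^+ N) ^+ j.+1 * M) `^ gam)%R).
    by apply: ler_powR_base => //; exact: ltW.
  rewrite !powRM ?mulr_ge0 ?exprn_ge0 ?(ltW M0)//.
  have key (a : R) k : (0 <= a -> (a `^ gam) ^+ k = (a ^+ k) `^ gam)%R.
    by move=> a0; rewrite -powR_mulrn ?powR_ge0// -powRrM mulrC powRrM powR_mulrn.
  by rewrite /annular_rate key// exprn_ge0.
have h4 : (M `^ (e - s^-1) = M `^ gam / M)%R.
  rewrite -[X in (_ / X)%R]powRr1 ?(ltW M0)// -powRN -powRD; first by congr powR; rewrite /gam; ring.
  by rewrite (gt_eqF M0) implybT.
rewrite h4.
apply: (@le_trans _ _ ((8 ^+ N / M) * (2 * ((N%:R ^+ N) `^ gam * annular_rate ^+ j.+1 * M `^ gam)))%R).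
  apply: ler_pM.
  - by rewrite invr_ge0 exprn_ge0// divr_ge0// ltW.
  - by rewrite mulr_ge0 ?powR_ge0.
  - exact: h1.
  - by rewrite ler_pM2l; [exact: h3|].
by rewrite le_eqVlt; apply/orP; left; apply/eqP; rewrite /far_const; ring.
Qed.

Let radial_maximal_far (x0 : Rn R N) r (g : Rn R N -> \bar R) j x : mass_block s e x0 r g ->
  annulus x0 r j.+1 x ->
  radial_maximal delta g x <= ((2 ^+ j.+2 * r / 4) ^- N * (2 * vol x0 r `^ gam))%:E.
Proof.
move=> bg xA; case: (bg) => [r0 mg g0 gB gs]; apply: nsup_le => k.
set Q := (2 ^+ j.+2 * r / 4)%R.
have Q0 : (0 < Q)%R by rewrite divr_gt0// mulr_gt0// exprn_gt0.
apply: (@le_trans _ _ (\int[mu]_y ((Q ^- N)%:E * g y))).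
  apply: ge0_le_integral.
  - exact: measurableT.
  - by move=> y _; rewrite mule_ge0// lee_fin radial_bump_ge0// dyadic_scale_gt0.
  - exact: measurable_radial_integrand.
  - exact: measurable_funeM.
  - move=> y _; have [->|gy] := eqVneq (g y) 0; first by rewrite !mule0.
    have yB := gB y gy; have xy := annulus_separation r0 xA yB; rewrite -/Q in xy.
    apply: lee_wpmul2r => //; rewrite lee_fin.
    have xy0 : (0 < enorm (tsub x y))%R by exact: lt_le_trans xy.
    apply: le_trans (radial_bump_le_inv delta_gt0 (dyadic_scale_gt0 k) xy0) _.
    by rewrite lef_pV2 ?posrE ?exprn_gt0//; apply: expr_le (ltW Q0) xy.
rewrite ge0_integralZl//; last by rewrite lee_fin invr_ge0 exprn_ge0// ltW.
rewrite EFinM lee_wpmul2l ?lee_fin ?invr_ge0 ?exprn_ge0 ?(ltW Q0)//.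
exact: (mass_block_L1 s_gt1 bg).
Qed.

(** On the doubled ball, the strong type inequality; replacing [|B|^e] by
    [|2B|^e] costs a constant as [e <= 0]. On the other annuli, the pointwise
    decay of [radial_maximal_far] and the volume of the annulus. *)
Lemma annulus_estimate : exists2 C : R, (0 < C)%R &
  forall x0 r (g : Rn R N -> \bar R) j, mass_block s e x0 r g ->
  \int[mu]_x ((radial_maximal delta g x * (\1_(annulus x0 r j) x)%:E) `^ s) <=
  ((C * annular_rate ^+ j) `^ s * vol x0 (2 ^+ j.+1 * r) `^ (e * s))%:E.
Proof.
have [C0 C00 strong] := @radial_maximal_strong R n delta s delta_gt0 s_gt1.
(* The second factor bounds [(|B| / |2B|)^(e s)] through cubes. *)
pose near_const : R := ((C0 * ((2 * N%:R) ^+ N) `^ (- (e * s))) `^ s^-1)%R.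
have nc0 : (0 <= near_const)%R by exact: powR_ge0.
have fc0 : (0 < far_const)%R.
  by rewrite /far_const !mulr_gt0 ?powR_gt0 ?exprn_gt0.
have z0 := annular_rate_gt0.
exists (near_const + far_const)%R; first by rewrite ltr_wpDl.
move=> x0 r g j bg; case: (bg) => [r0 mg g0 gB gs].
have mV := measurable_radial_maximal delta mg g0.
have V0 x : 0 <= radial_maximal delta g x by exact: radial_maximal_ge0.
have mA := measurable_annulus x0 r j.
have m1A : measurable_fun setT (fun x => (\1_(annulus x0 r j) x)%:E : \bar R).
  by apply/measurable_EFinP; exact: measurable_indic.
have mVA : measurable_fun setT (fun x =>
    (radial_maximal delta g x * (\1_(annulus x0 r j) x)%:E) `^ s).
  by apply: (measurableT_comp (measurable_poweR s)); exact: emeasurable_funM.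
have VA0 x : 0 <= radial_maximal delta g x * (\1_(annulus x0 r j) x)%:E.
  by rewrite mule_ge0// lee_fin.
have m0 := vol_gt0 x0 r0.
case: j => [|j] in mA m1A mVA VA0 *.
  apply: (@le_trans _ _ (C0 * (vol x0 r `^ (e * s)))%:E).
    rewrite EFinM; apply: (@le_trans _ _ (C0%:E * \int[mu]_x (g x `^ s))); last first.
      by rewrite lee_wpmul2l// lee_fin ltW.
    apply: le_trans (strong g mg g0); apply: ge0_le_integral.
    - exact: measurableT.
    - by move=> x _; exact: poweR_ge0.
    - by [].
    - exact: (measurableT_comp (measurable_poweR s)).
    - move=> x _; apply: poweR_le; [exact: ltW| exact: VA0|].
      by rewrite -[leRHS]mule1 lee_wpmul2l// lee_fin indicE; case: (_ \in _).
  rewrite lee_fin expr1 expr0 mulr1.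
  have M0 : (0 < vol x0 (2 * r))%R by apply: vol_gt0; rewrite mulr_gt0.
  have es0 : (0 <= - (e * s))%R by rewrite oppr_ge0 mulr_le0_ge0// ltW.
  have K0 : (0 < (2 * N%:R) ^+ N :> R)%R by rewrite exprn_gt0// mulr_gt0.
  have ratio : (vol x0 (2 * r) <= (2 * N%:R) ^+ N * vol x0 r)%R.
    have := @vol_ratio _ _ x0 r 2%R 1%R r0 (ltr0Sn _ _) ltr01.
    by rewrite divr1 mul1r [(N%:R * 2)%R]mulrC.
  apply: (@le_trans _ _ (near_const `^ s * vol x0 (2 * r) `^ (e * s))%R); last first.
    rewrite ler_wpM2r ?powR_ge0//; apply: ler_powR_base; [exact: ltW|by []|].
    by rewrite lerDl ltW.
  have root (a : R) : (0 <= a -> (a `^ s^-1) `^ s = a)%R.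
    by move=> a0; rewrite -powRrM mulVf ?gt_eqF// powRr1.
  have -> : (near_const `^ s = C0 * ((2 * N%:R) ^+ N) `^ (- (e * s)))%R.
    by apply: root; apply: mulr_ge0; [exact: ltW|exact: powR_ge0].
  rewrite -mulrA ler_wpM2l ?(ltW C00)//.
  have key (a b K d : R) : (0 < a -> 0 < b -> 0 < K -> 0 <= d -> b <= K * a ->
      a `^ (- d) <= K `^ d * b `^ (- d))%R.
    move=> a0 b0 Kp d0 bKa; rewrite !powRN ler_pdivlMr ?powR_gt0// mulrC.
    rewrite ler_pdivrMr ?powR_gt0// -powRM ?(ltW Kp) ?(ltW a0)//.
    by apply: ler_powR_base => //; exact: ltW.
  by have := key _ _ _ _ m0 M0 K0 es0 ratio; rewrite opprK.
set Q := (2 ^+ j.+2 * r)%R.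
have Q0 : (0 < Q)%R by rewrite mulr_gt0// exprn_gt0.
have M0 := vol_gt0 x0 Q0.
set D := ((2 ^+ j.+2 * r / 4) ^- N * (2 * vol x0 r `^ gam))%R.
have D0 : (0 <= D)%R.
  by rewrite /D mulr_ge0 ?mulr_ge0 ?powR_ge0// invr_ge0 exprn_ge0// divr_ge0// ltW.
apply: (@le_trans _ _ (\int[mu]_x ((D `^ s * \1_(cball x0 Q) x)%:E))).
  apply: ge0_le_integral.
  - exact: measurableT.
  - by move=> x _; exact: poweR_ge0.
  - by [].
  - apply/measurable_EFinP; apply: measurable_funM; first exact: measurable_cst.
    by apply: measurable_indic; exact: measurable_cball.
  - move=> x _; have [xA|xA] := pselect (annulus x0 r j.+1 x); last first.
      rewrite [X in (_ * X%:E) `^ _]indicE memNset// mule0 poweR0r ?gt_eqF//.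
      by rewrite lee_fin mulr_ge0// powR_ge0.
    rewrite [X in (_ * X%:E) `^ _]indicE mem_set// mule1 indicE mem_set; last by case: xA.
    rewrite mulr1 -poweR_EFin; apply: poweR_le; [exact: ltW|exact: V0|].
    exact: radial_maximal_far.
rewrite integral_indic_cst ?powR_ge0//; last exact: measurable_cball.
rewrite (volE x0 (ltW Q0)) -EFinM lee_fin.
have DC : (D <= (near_const + far_const) * annular_rate ^+ j.+1 * vol x0 Q `^ (e - s^-1))%R.
  apply: le_trans (far_arith x0 j r0) _.
  by rewrite ler_wpM2r ?powR_ge0// ler_wpM2r ?exprn_ge0 ?(ltW z0)// lerDr.
apply: (@le_trans _ _ (((near_const + far_const) * annular_rate ^+ j.+1 *
    vol x0 Q `^ (e - s^-1)) `^ s * vol x0 Q)%R).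
  exact: ler_wpM2r (ltW M0) _ _ (ler_powR_base (ltW s_gt0) D0 DC).
rewrite powRM ?powR_ge0//; last first.
  by rewrite mulr_ge0 ?exprn_ge0 ?(ltW z0)// addr_ge0// ltW.
rewrite -mulrA ler_wpM2l ?powR_ge0// -powRrM.
have key (v : R) : (0 < v -> v `^ ((e - s^-1) * s) * v = v `^ (e * s))%R.
  move=> v0; rewrite -{2}(powRr1 (ltW v0)) -powRD; last by rewrite (gt_eqF v0) implybT.
  by congr powR; field; rewrite gt_eqF.
by rewrite key.
Qed.

End annulus_estimate.

(** * Control of the maximal Bochner-Riesz operator *)

Section null_modification.
Context d (T : measurableType d) (R : realType) (mu : {measure set T -> \bar R}).
Local Open Scope ereal_scope.
Import HBNNSimple.

(** The integral is a supremum over simple functions below the integrand, and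
    cutting such a function off to the complement of [A] changes neither its
    integral nor its being below [f], while putting it below [g]. The argument
    covers integrands that are not measurable. *)
Lemma ge0_le_integral_off_null (A : set T) (f g : T -> \bar R) :
  measurable A -> mu A = 0 -> (forall x, 0 <= f x) -> (forall x, 0 <= g x) ->
  (forall x, ~ A x -> f x = g x) -> \int[mu]_x f x <= \int[mu]_x g x.
Proof.
move=> mA A0 f0 g0 fg; rewrite ge0_integralTE//; apply: ge_ereal_sup => _ [h hf <-].
have mC : measurable (~` A) by exact: measurableC.
rewrite -integralT_nnsfun.
rewrite (@ae_eq_integral _ _ _ mu setT (EFin \o proj_nnsfun h mC) (EFin \o h))//.
- rewrite integralT_nnsfun ge0_integralTE//; apply: ereal_sup_ubound.
  exists (proj_nnsfun h mC) => // x /=; rewrite mindicE.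
  have [Ax|Ax] := pselect (A x); first by rewrite memNset ?mulr0//=; apply.
  by rewrite mem_set// mulr1 -fg.
- exact/measurable_EFinP.
- exact/measurable_EFinP.
- exists A; split=> // x /=; apply: contra_notP => nAx _.
  by rewrite mindicE mem_set// mulr1.
Qed.

Lemma integral_off_null (A : set T) (f g : T -> \bar R) :
  measurable A -> mu A = 0 -> (forall x, ~ A x -> f x = g x) ->
  \int[mu]_x f x = \int[mu]_x g x.
Proof.
move=> mA A0 fg.
have H (u v : T -> \bar R) : (forall x, 0 <= u x) -> (forall x, 0 <= v x) ->
    (forall x, ~ A x -> u x = v x) -> \int[mu]_x u x = \int[mu]_x v x.
  move=> u0 v0 uv; apply/eqP; rewrite eq_le; apply/andP; split.
    exact: (ge0_le_integral_off_null mA A0 u0 v0).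
  by apply: (ge0_le_integral_off_null mA A0 v0 u0) => x /uv.
rewrite integralE [RHS]integralE; congr (_ - _); apply: H => // x Ax.
- by rewrite !funeposE fg.
- by rewrite !funenegE fg.
Qed.

End null_modification.

Section complex_modulus.
Context {R : realType}.
Implicit Types z : R[i].

Lemma Re_mul_real z (k : R) : complex.Re (z * k%:C%C) = complex.Re z * k.
Proof. by case: z => a b /=; rewrite mulr0 subr0. Qed.

Lemma Im_mul_real z (k : R) : complex.Im (z * k%:C%C) = complex.Im z * k.
Proof. by case: z => a b /=; rewrite mulr0 add0r. Qed.

Lemma normcE_sqrt z : Normc.normc z = Num.sqrt (complex.Re z ^+ 2 + complex.Im z ^+ 2).
Proof. by case: z. Qed.

Lemma normr_Re_le z : `|complex.Re z| <= Normc.normc z.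
Proof. by rewrite normcE_sqrt -sqrtr_sqr ler_wsqrtr// lerDl sqr_ge0. Qed.

Lemma normr_Im_le z : `|complex.Im z| <= Normc.normc z.
Proof. by rewrite normcE_sqrt -sqrtr_sqr ler_wsqrtr// lerDr sqr_ge0. Qed.

Lemma normc_le_add z : Normc.normc z <= `|complex.Re z| + `|complex.Im z|.
Proof.
rewrite normcE_sqrt -[leRHS]ger0_norm ?addr_ge0// -sqrtr_sqr ler_wsqrtr//.
rewrite -(real_normK (num_real (complex.Re z))) -(real_normK (num_real (complex.Im z))).
have := normr_ge0 (complex.Re z); have := normr_ge0 (complex.Im z); nra.
Qed.

Lemma normc_ge0 z : 0 <= Normc.normc z.
Proof. by rewrite normcE_sqrt sqrtr_ge0. Qed.

Lemma measurable_normc d (T : measurableType d) (f : T -> R[i]) :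
  measurable_fun setT (fun x => complex.Re (f x)) ->
  measurable_fun setT (fun x => complex.Im (f x)) ->
  measurable_fun setT (fun x => Normc.normc (f x)).
Proof.
move=> mr mi; under eq_fun do rewrite normcE_sqrt.
apply: measurable_fun_sqrt; apply: measurable_funD.
  exact: (measurable_funX 2 mr).
exact: (measurable_funX 2 mi).
Qed.

Lemma cvg_normc (f : nat -> R[i]) (a b : R) :
  complex.Re (f k) @[k --> \oo] --> a -> complex.Im (f k) @[k --> \oo] --> b ->
  Normc.normc (f k) @[k --> \oo] --> Normc.normc (a +i* b)%C.
Proof.
move=> fa fb; under eq_cvg do rewrite normcE_sqrt.
apply: (@cvg_comp _ _ _ _ (@Num.sqrt R)); last exact: sqrt_continuous.
by rewrite !expr2; apply: cvgD; under eq_cvg do rewrite expr2; exact: cvgM.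
Qed.

End complex_modulus.

Section positive_rationals.
Context {R : realType}.

Definition positive_rational (i : nat) : R :=
  if @unpickle rat i is Some q then (if 0 < ratr q :> R then ratr q else 1) else 1.

Lemma positive_rational_gt0 i : 0 < positive_rational i.
Proof. by rewrite /positive_rational; case: unpickle => [q|//]; case: ifPn. Qed.

Lemma positive_rational_dense (a b : R) : 0 <= a -> a < b -> exists i, a < positive_rational i < b.
Proof.
move=> a0 ab; have [q /itvP qab] := rat_in_itvoo ab.
exists (pickle q); rewrite /positive_rational pickleK ifT ?qab//.
by rewrite (le_lt_trans a0)// qab.
Qed.

Lemma positive_rational_cvg (a : R) : 0 < a -> exists i : nat -> nat,
  (forall k, a < positive_rational (i k) < 2 * a) /\ positive_rational (i k) @[k --> \oo] --> a.
Proof.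
move=> a0; have H k : exists i, a < positive_rational i < a + a / k.+2%:R.
  by apply: positive_rational_dense; rewrite ?(ltW a0)// ltrDl divr_gt0.
pose i k := projT1 (cid (H k)); have iP k := projT2 (cid (H k)).
exists i; split=> [k|].
  have /andP[-> /lt_le_trans] := iP k; apply.
  by rewrite mulr2n mulrDl mul1r lerD2l ler_pdivrMr// ler_peMr ?(ltW a0)// ler1n.
apply: (squeeze_cvgr (f := cst a) (h := fun k => a + a / k.+2%:R)).
- by apply: nearW => k; have /andP[/ltW -> /ltW ->] := iP k.
- exact: cvg_cst.
- rewrite -[X in _ --> X]addr0; apply: cvgD; first exact: cvg_cst.
  rewrite -(mulr0 a); apply: cvgM; first exact: cvg_cst.
  rewrite (cvg_shiftS (fun k => k.+1%:R^-1 : R)); exact: cvg_harmonic.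
Qed.

End positive_rationals.

Section kernel.
Context {R : realType} {n : nat}.
Local Notation N := n.+1.
Variable lam : R.
Hypothesis lam_gt : n%:R / 2 < lam.

Let lam_ge0 : 0 <= lam.
Proof. by apply: le_trans (ltW lam_gt); rewrite divr_ge0. Qed.

Definition real_kernel (rho : R) (z : Rn R N) : R :=
  radial_const n lam * rho ^+ N * osc_cos (lam + n%:R / 2) (2 * pi * (rho * enorm z)).

Lemma br_kernel_real rho z : 0 < rho -> br_kernel lam rho z = (real_kernel rho z)%:C%C.
Proof. by move=> r0; rewrite br_kernelE. Qed.

Lemma real_kernel_bound : exists2 C, 0 < C & forall rho z, 0 < rho ->
  `|real_kernel rho z| <= C * radial_bump (lam - n%:R / 2) rho z.
Proof.
have [C C0 H] := br_kernel_bound lam_gt; exists C => // rho z r0.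
apply: le_trans (H rho z r0); rewrite br_kernel_real//.
exact: (normr_Re_le (real_kernel rho z)%:C%C).
Qed.

Let osc_continuous : continuous (osc_cos (lam + n%:R / 2)).
Proof. by apply: continuous_osc_cos; rewrite addr_ge0// divr_ge0. Qed.

Lemma measurable_real_kernel d (T : measurableType d) rho (z : T -> Rn R N) :
  measurable_fun setT z -> measurable_fun setT (fun t => real_kernel rho (z t)).
Proof.
move=> mz; apply: measurable_funM; first exact: measurable_cst.
apply: (measurableT_comp (f := osc_cos (lam + n%:R / 2))).
  exact: continuous_measurable_fun.
apply: measurable_funM; first exact: measurable_cst.
apply: measurable_funM; first exact: measurable_cst.
exact: measurable_fun_enorm.
Qed.

Lemma real_kernel_cvg (r : nat -> R) (rho : R) z : r k @[k --> \oo] --> rho ->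
  real_kernel (r k) z @[k --> \oo] --> real_kernel rho z.
Proof.
move=> rr; apply: cvgM.
  apply: cvgM; first exact: cvg_cst.
  by apply: (@cvg_comp _ _ _ r (fun t => t ^+ N) _ _ _ rr); exact: exprn_continuous.
apply: continuous_cvg; first exact: osc_continuous.
by apply: cvgM; [exact: cvg_cst|apply: cvgM => //; exact: cvg_cst].
Qed.

End kernel.

Section convolution.
Context {R : realType} {n : nat}.
Local Notation N := n.+1.
Local Notation mu := (lebesgueRn R N).
Local Open Scope ereal_scope.
Variables (lam C : R).
Hypothesis lam_gt : (n%:R / 2 < lam)%R.
Hypothesis C_gt0 : (0 < C)%R.
Local Notation delta := (lam - n%:R / 2)%R.
Hypothesis kern_le : forall rho (z : Rn R N), (0 < rho)%R ->
  (`|real_kernel lam rho z| <= C * radial_bump delta rho z)%R.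
Variable F : Rn R N -> \bar R.
Hypotheses (mF : measurable_fun setT F) (F0 : forall y, 0 <= F y).

Let delta_gt0 : (0 < delta)%R. Proof. by rewrite subr_gt0. Qed.

Definition real_conv (u : Rn R N -> R) rho x : R :=
  (\int[mu]_y (u y * real_kernel lam rho (tsub x y)))%R.

Let conv_const : R := (C * 4 ^+ N)%R.
Let conv_const_gt0 : (0 < conv_const)%R.
Proof. by rewrite mulr_gt0// exprn_gt0. Qed.

Let kern_le_scale k r (z : Rn R N) : (dyadic_scale k <= r)%R -> (r <= 4 * dyadic_scale k)%R ->
  (`|real_kernel lam r z| <= conv_const * radial_bump delta (dyadic_scale k) z)%R.
Proof.
move=> kr rk; have k0 : (0 < dyadic_scale k :> R)%R by exact: dyadic_scale_gt0.
have r0 : (0 < r)%R by exact: lt_le_trans kr.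
apply: le_trans (kern_le z r0) _; rewrite /conv_const -mulrA ler_wpM2l ?(ltW C_gt0)//.
have [r2|r2] := leP r (2 * dyadic_scale k)%R.
  apply: le_trans (radial_bump_scale z delta_gt0 k0 kr r2) _.
  rewrite ler_wpM2r ?radial_bump_ge0//; apply: expr_le => //; lra.
have k20 : (0 < 2 * dyadic_scale k :> R)%R by lra.
have r4 : (r <= 2 * (2 * dyadic_scale k))%R by lra.
apply: le_trans (radial_bump_scale z delta_gt0 k20 (ltW r2) r4) _.
have kk : (dyadic_scale k <= 2 * dyadic_scale k :> R)%R by lra.
have := radial_bump_scale z delta_gt0 k0 kk (lexx _).
rewrite -(ler_pM2l (exprn_gt0 N (ltr0Sn R 1))) mulrA -exprMn => /le_trans; apply.
by rewrite mulrA -exprMn -natrM.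
Qed.

Let majorant k x y : \bar R :=
  conv_const%:E * ((radial_bump delta (dyadic_scale k) (tsub x y))%:E * F y).

Let majorant_ge0 k x y : 0 <= majorant k x y.
Proof.
by rewrite !mule_ge0 ?lee_fin ?(ltW conv_const_gt0)// radial_bump_ge0// dyadic_scale_gt0.
Qed.

Let measurable_majorant k x : measurable_fun setT (majorant k x).
Proof. by apply: measurable_funeM; exact: measurable_radial_integrand. Qed.

Let integral_majorant k x :
  \int[mu]_y majorant k x y <= conv_const%:E * radial_maximal delta F x.
Proof.
rewrite ge0_integralZl//; last 3 first.
- exact: measurable_radial_integrand.
- by move=> y _; rewrite mule_ge0// lee_fin radial_bump_ge0// dyadic_scale_gt0.
- by rewrite lee_fin ltW.
rewrite lee_wpmul2l ?lee_fin ?(ltW conv_const_gt0)//.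
exact: (le_nsup (fun k => \int[mu]_y ((radial_bump delta (dyadic_scale k) (tsub x y))%:E * F y)) k).
Qed.

Let integrable_majorant k x : radial_maximal delta F x < +oo ->
  mu.-integrable setT (majorant k x).
Proof.
move=> fx; apply/integrableP; split; first exact: measurable_majorant.
under eq_integral do rewrite gee0_abs//.
apply: le_lt_trans (integral_majorant k x) _.
by rewrite lte_mul_pinfty// lee_fin ltW.
Qed.

Variable u : Rn R N -> R.
Hypothesis mu_u : measurable_fun setT u.
Hypothesis u_le : forall y, (`|u y|)%:E <= F y.

Let integrand rho x y : \bar R := (u y * real_kernel lam rho (tsub x y))%:E.

Let measurable_integrand rho x : measurable_fun setT (integrand rho x).
Proof.
apply/measurable_EFinP; apply: measurable_funM => //.
apply: measurable_real_kernel => //.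
by apply: measurable_fun_tsub; [exact: measurable_cst|exact: measurable_id].
Qed.

Let integrand_le k r x y : (dyadic_scale k <= r)%R -> (r <= 4 * dyadic_scale k)%R ->
  `|integrand r x y| <= majorant k x y.
Proof.
move=> kr rk; have -> : majorant k x y = F y * (conv_const * radial_bump delta (dyadic_scale k) (tsub x y))%:E.
  by rewrite /majorant muleA -EFinM muleC.
rewrite /integrand abse_EFin normrM (EFinM `|u y|%R).
by apply: lee_pmul; rewrite ?lee_fin//; exact: kern_le_scale.
Qed.

(** The kernel at scale [rho] is at most a constant times the profile at the
    dyadic scale below [rho]. *)
Lemma real_conv_bound rho x : (0 < rho)%R -> radial_maximal delta F x < +oo ->
  (`|real_conv u rho x|)%:E <= (C * 4 ^+ N)%:E * radial_maximal delta F x.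
Proof.
move=> r0 fx; have [k /andP[kr rk]] := dyadic_scale_bracket r0.
have k0 : (0 < dyadic_scale k :> R)%R by exact: dyadic_scale_gt0.
have rk4 : (rho <= 4 * dyadic_scale k)%R by lra.
apply: le_trans (integral_majorant k x).
apply: (@le_trans _ _ `|\int[mu]_y integrand rho x y|).
  by rewrite /real_conv /Rintegral; case: (\int[mu]_y _) => [a||]//=; rewrite normr0 leey.
apply: le_trans (le_abse_integral _ measurableT (measurable_integrand rho x)) _.
apply: ge0_le_integral.
- exact: measurableT.
- by move=> y _; exact: abse_ge0.
- exact: measurableT_comp.
- exact: measurable_majorant.
- by move=> y _; exact: integrand_le.
Qed.

Lemma measurable_real_conv rho : measurable_fun setT (real_conv u rho).
Proof.
pose h (p : Rn R N * Rn R N) : \bar R := (u p.2 * real_kernel lam rho (tsub p.1 p.2))%:E.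
have mh : measurable_fun setT h.
  apply/measurable_EFinP; apply: measurable_funM.
    exact: (measurableT_comp mu_u measurable_snd).
  apply: measurable_real_kernel => //.
  by apply: measurable_fun_tsub; [exact: measurable_fst|exact: measurable_snd].
apply: (@measurableT_comp _ _ _ _ _ _ (@fine R)); first by [].
rewrite (_ : (fun x => _) = (fun x => \int[mu]_y (h^\+ (x, y)) - \int[mu]_y (h^\- (x, y)))).
  apply: emeasurable_funB.
    apply: (measurable_fun_fubini_tonelli_F (h^\+)) => //.
    exact: measurable_funepos.
  apply: (measurable_fun_fubini_tonelli_F (h^\-)) => //.
  exact: measurable_funeneg.
apply/funext => x; rewrite integralE; congr (_ - _); apply: eq_integral => y _.
  by rewrite !funeposE.
by rewrite !funenegE.
Qed.

(** All scales between [rho] and [2 rho] share the integrable majorant attached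
    to the dyadic scale below [rho], so dominated convergence applies. *)
Lemma real_conv_cvg (r : nat -> R) rho x : (0 < rho)%R ->
  (forall k, rho < r k < 2 * rho)%R -> (r k @[k --> \oo] --> rho)%R ->
  radial_maximal delta F x < +oo ->
  (real_conv u (r k) x @[k --> \oo] --> real_conv u rho x)%R.
Proof.
move=> r0 rr rrho fx; have [k /andP[kr rk]] := dyadic_scale_bracket r0.
have k0 : (0 < dyadic_scale k :> R)%R by exact: dyadic_scale_gt0.
have rk4 : (rho <= 4 * dyadic_scale k)%R by lra.
have [_ _ H] := @dominated_convergence _ _ _ mu setT measurableT
  (fun i => integrand (r i) x) (integrand rho x) (majorant k x)
  (fun i => measurable_integrand (r i) x) (measurable_integrand rho x)
  ltac:(apply: aeW => y _; apply/cvg_EFin; [exact: nearW|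
    apply: cvgM; [exact: cvg_cst|exact: real_kernel_cvg]]) (integrable_majorant k fx)
  ltac:(apply: aeW => y i _; apply: integrand_le; have /andP[] := rr i; lra).
apply: fine_cvg; rewrite fineK//.
apply: (integrable_fin_num measurableT).
apply: le_integrable (integrable_majorant k fx) => //; first exact: measurable_integrand.
by move=> y _; rewrite [leRHS]gee0_abs//; exact: integrand_le.
Qed.

End convolution.

Section maximal_operator.
Context {R : realType} {n : nat}.
Local Notation N := n.+1.
Local Notation mu := (lebesgueRn R N).
Variable lam : R.
Implicit Types f : Rn R N -> R[i].

Lemma br_mean_off_null rho (A : set (Rn R N)) f g x : measurable A -> mu A = 0%E ->
  (forall y, ~ A y -> f y = g y) -> br_mean lam rho f x = br_mean lam rho g x.
Proof.
move=> mA A0 fg; rewrite /br_mean /convolution /cintegral /Rintegral.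
congr (fine _ +i* fine _)%C.
  by apply: (integral_off_null mA A0) => y Ay; rewrite fg.
by apply: (integral_off_null mA A0) => y Ay; rewrite fg.
Qed.

Lemma br_maximal_off_null (A : set (Rn R N)) f g x : measurable A -> mu A = 0%E ->
  (forall y, ~ A y -> f y = g y) -> br_maximal lam f x = br_maximal lam g x.
Proof.
move=> mA A0 fg; rewrite /br_maximal; congr ereal_sup.
apply/seteqP; split=> _ [rho r0 <-]; exists rho => //.
  by rewrite (br_mean_off_null rho x mA A0 fg).
by rewrite (br_mean_off_null rho x mA A0 fg).
Qed.

(** A countable supremum, hence a measurable function. *)
Definition rational_br_maximal f x : \bar R :=
  nsup (fun i => (Normc.normc (br_mean lam (positive_rational i) f x))%:E).

Hypothesis lam_gt : n%:R / 2 < lam.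
Local Notation delta := (lam - n%:R / 2).

Lemma br_mean_real_conv rho f x : 0 < rho -> br_mean lam rho f x =
  (real_conv lam (fun y => complex.Re (f y)) rho x +i*
   real_conv lam (fun y => complex.Im (f y)) rho x)%C.
Proof.
move=> r0; rewrite /br_mean /convolution /cintegral /real_conv /Rintegral.
congr (fine _ +i* fine _)%C.
  by apply: eq_integral => y _; rewrite br_kernel_real// Re_mul_real.
by apply: eq_integral => y _; rewrite br_kernel_real// Im_mul_real.
Qed.

(** Where the maximal function of the majorant [F] is finite, the means are
    bounded by it and depend continuously on [rho], so that the supremum over
    the rationals is the full one. *)
Theorem br_maximal_controlled : exists2 C : R, 0 < C &
  forall f (F : Rn R N -> \bar R), cmeasurable f ->
  measurable_fun setT F -> (forall y, 0 <= F y)%E ->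
  (forall y, (Normc.normc (f y))%:E <= F y)%E ->
  measurable_fun setT (rational_br_maximal f) /\
  forall x, (radial_maximal delta F x < +oo)%E ->
    br_maximal lam f x = rational_br_maximal f x /\
    (rational_br_maximal f x <= C%:E * radial_maximal delta F x)%E.
Proof.
have [C C0 kern_le] := real_kernel_bound lam_gt.
have D0 : 0 < C * 4 ^+ N by rewrite mulr_gt0// exprn_gt0.
exists (2 * (C * 4 ^+ N)); first by rewrite mulr_gt0.
move=> f F [mRe mIm] mF F0 fF.
have Re_le y : (`|complex.Re (f y)|%:E <= F y)%E.
  by apply: le_trans (fF y); rewrite lee_fin normr_Re_le.
have Im_le y : (`|complex.Im (f y)|%:E <= F y)%E.
  by apply: le_trans (fF y); rewrite lee_fin normr_Im_le.
have mean_le rho x : 0 < rho -> (radial_maximal delta F x < +oo)%E ->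
    ((Normc.normc (br_mean lam rho f x))%:E <=
      (2 * (C * 4 ^+ N))%:E * radial_maximal delta F x)%E.
  move=> r0 fx; rewrite br_mean_real_conv//.
  apply: (@le_trans _ _ (`|real_conv lam (fun y => complex.Re (f y)) rho x|%:E +
      `|real_conv lam (fun y => complex.Im (f y)) rho x|%:E)%E).
    by rewrite -EFinD lee_fin; exact: normc_le_add.
  rewrite mulr2n mulrDl mul1r EFinD ge0_muleDl ?lee_fin ?(ltW D0)//.
  by apply: leeD; exact: real_conv_bound.
split.
  apply: measurable_fun_nsup => i; apply/measurable_EFinP; apply: measurable_normc.
    under eq_fun do rewrite br_mean_real_conv ?positive_rational_gt0//=.
    exact: measurable_real_conv.
  under eq_fun do rewrite br_mean_real_conv ?positive_rational_gt0//=.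
  exact: measurable_real_conv.
move=> x fx; split; last by apply: nsup_le => i; apply: mean_le => //; exact: positive_rational_gt0.
apply/eqP; rewrite eq_le; apply/andP; split; last first.
  apply: nsup_le => i; apply: ereal_sup_ubound; exists (positive_rational i) => //.
  by rewrite /= in_itv/= positive_rational_gt0.
apply: ge_ereal_sup => _ [rho /= + <-]; rewrite in_itv/= andbT => r0.
have [i [ri icvg]] := positive_rational_cvg r0.
have H : Normc.normc (br_mean lam (positive_rational (i k)) f x) @[k --> \oo] -->
    Normc.normc (br_mean lam rho f x).
  rewrite (br_mean_real_conv f x r0); apply: cvg_normc.
    under eq_cvg do rewrite br_mean_real_conv ?positive_rational_gt0//=.
    exact: (real_conv_cvg lam_gt C0 kern_le mF F0 mRe Re_le r0 ri icvg fx).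
  under eq_cvg do rewrite br_mean_real_conv ?positive_rational_gt0//=.
  exact: (real_conv_cvg lam_gt C0 kern_le mF F0 mIm Im_le r0 ri icvg fx).
have H' : (Normc.normc (br_mean lam (positive_rational (i k)) f x))%:E @[k --> \oo] -->
    (Normc.normc (br_mean lam rho f x))%:E.
  by apply: cvg_EFin => //; exact: nearW.
rewrite -(cvg_lim _ H')//; apply: lime_le; first by apply/cvg_ex; eexists; exact: H'.
by apply: nearW => k; exact: (le_nsup (fun i => (Normc.normc (br_mean lam (positive_rational i) f x))%:E) (i k)).
Qed.

End maximal_operator.

(** * Block decomposition of the maximal function *)

Section series.
Context {R : realType}.
Local Open Scope ereal_scope.

Lemma nneseries_pairing : exists phi : nat -> nat * nat,
  forall a : nat -> nat -> \bar R, (forall k j, 0 <= a k j) ->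
  \sum_(0 <= m <oo) a (phi m).1 (phi m).2 =
  \sum_(0 <= k <oo) \sum_(0 <= j <oo) a k j.
Proof.
have /pcard_eqP[f] : ([set: nat] #= [set: nat * nat])%card.
  by rewrite card_eq_sym; exact: card_nat2.
exists f => a a0.
rewrite nneseries_esumT// [RHS]nneseries_esumT; last first.
  by move=> k; exact: nneseries_ge0.
under [RHS]eq_esum do rewrite nneseries_esumT//.
rewrite esum_esum//; apply/esym.
rewrite (_ : [set: nat] `*`` _ = [set: nat * nat]); last first.
  by apply/seteqP; split.
by rewrite (@reindex_esum _ _ _ [set: nat] _ f).
Qed.

(** No term exceeds [S^(1 / q)], where [S] is the sum of the powers; so [c k <=
    S^((1 - q) / q) (c k)^q]. *)
Lemma summable_of_powR (q : R) (c : nat -> R) : (0 < q)%R -> (q <= 1)%R ->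
  (forall k, 0 <= c k)%R -> \sum_(0 <= k <oo) (c k `^ q)%:E < +oo ->
  \sum_(0 <= k <oo) (c k)%:E < +oo.
Proof.
move=> q0 q1 c0; set S := \sum_(0 <= k <oo) (c k `^ q)%:E => Soo.
have S0 : 0 <= S by apply: nneseries_ge0 => k _ _; rewrite lee_fin powR_ge0.
have SE : S = (fine S)%:E by rewrite fineK// ge0_fin_numE.
have T0 : (0 <= fine S)%R by exact: fine_ge0.
have cS k : (c k `^ q <= fine S)%R.
  rewrite -lee_fin -SE.
  by apply: (le_nneseries_term (u := fun k => (c k `^ q)%:E)) => j; rewrite lee_fin powR_ge0.
have cE k : (c k <= (fine S `^ q^-1) `^ (1 - q) * c k `^ q)%R.
  have [->|ck] := eqVneq (c k) 0%R; first by rewrite mulr_ge0 ?powR_ge0.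
  have ck0 : (0 < c k)%R by rewrite lt_neqAle eq_sym ck c0.
  rewrite -[leLHS]powRr1// -[X in (c k `^ X <= _)%R](subrK q) powRD; last by rewrite ck implybT.
  rewrite ler_wpM2r ?powR_ge0//; apply: ler_powR_base; [lra|exact: c0|].
  rewrite -[leLHS]powRr1// -(@mulfV _ q) ?gt_eqF// powRrM.
  by apply: ler_powR_base; rewrite ?powR_ge0// invr_ge0 ltW.
apply: (@le_lt_trans _ _ (\sum_(0 <= k <oo)
    (((fine S `^ q^-1) `^ (1 - q))%:E * (c k `^ q)%:E))).
  by apply: lee_nneseries => [k _ _|k _]; rewrite ?lee_fin// -EFinM lee_fin.
rewrite nneseriesZl => [|k _]; last by rewrite lee_fin powR_ge0.
by rewrite lte_mul_pinfty// lee_fin powR_ge0.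
Qed.

End series.

Section blocks.
Context {R : realType} {n : nat}.
Local Notation N := n.+1.
Local Notation mu := (lebesgueRn R N).
Variables (p s alpha : R).
Hypotheses (s_gt1 : 1 < s) (p_gt0 : 0 < p).

Definition block_exponent : R := - (alpha / (p * N%:R)) - p^-1 + s^-1.
Local Notation e := block_exponent.

Definition modulus (a : Rn R N -> R[i]) x : \bar R := (Normc.normc (a x))%:E.

Let s_gt0 : 0 < s. Proof. exact: lt_trans ltr01 s_gt1. Qed.

Lemma cmeasurable_modulus a : cmeasurable a -> measurable_fun setT (modulus a).
Proof. by move=> [mRe mIm]; apply/measurable_EFinP; exact: measurable_normc. Qed.

Let Lnorm_modulus a x0 r : 0 < r ->
  (Lnorm mu s%:E (fun x => (Normc.normc (a x))%:E) <= mu (cball x0 r) `^ e)%E <->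
  (\int[mu]_x (modulus a x `^ s) <= (vol x0 r `^ (e * s))%:E)%E.
Proof.
move=> r0; rewrite unlock (volE x0 (ltW r0)) poweR_EFin.
have E : (\int[mu]_x (`|(Normc.normc (a x))%:E| `^ s) = \int[mu]_x (modulus a x `^ s))%E.
  by apply: eq_integral => x _; rewrite gee0_abs// lee_fin normc_ge0.
rewrite E; set I := (\int[mu]_x _)%E.
have I0 : (0 <= I)%E by apply: integral_ge0 => x _; exact: poweR_ge0.
split => H.
  have -> : I = ((I `^ s^-1) `^ s)%E by rewrite -poweRrM mulVf ?gt_eqF// poweRe1.
  by rewrite powRrM -poweR_EFin; apply: poweR_le; [exact: ltW|exact: poweR_ge0|].
have -> : (vol x0 r `^ e)%:E = ((vol x0 r `^ (e * s))%:E `^ s^-1)%E.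
  by rewrite poweR_EFin -powRrM -mulrA mulfV ?gt_eqF// mulr1.
by apply: poweR_le; rewrite ?invr_ge0 ?(ltW s_gt0).
Qed.

Lemma mass_block_of_block a : is_block p s alpha a ->
  exists x0 r, mass_block s e x0 r (modulus a).
Proof.
move=> [ma [x0 [r [r0 aB aL]]]]; exists x0, r; split => //.
- exact: cmeasurable_modulus.
- by move=> x; rewrite lee_fin normc_ge0.
- move=> x ax; apply: aB; apply/eqP => a0; move: ax.
  by rewrite /modulus a0 Normc.normc0 eqxx.
- exact/(Lnorm_modulus _ _ r0).
Qed.

Lemma block_of_mass_block a x0 r : cmeasurable a ->
  mass_block s e x0 r (modulus a) -> is_block p s alpha a.
Proof.
move=> ma [r0 _ _ aB aI]; split => //; exists x0, r; split => //.
- move=> x ax; apply: aB; apply: contra_neq ax.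
  by rewrite /modulus => -[]; exact: Normc.eq0_normc.
- exact/(Lnorm_modulus _ _ r0).
Qed.

End blocks.

Section superposition.
Context {R : realType} {n : nat}.
Local Notation N := n.+1.
Local Notation mu := (lebesgueRn R N).
Local Open Scope ereal_scope.

(** The averages are additive by monotone convergence, and a supremum of sums
    is at most the sum of the suprema. *)
Lemma radial_maximal_series delta (c : nat -> R) (g : nat -> Rn R N -> \bar R) x :
  (forall k, 0 <= c k)%R -> (forall k, measurable_fun setT (g k)) ->
  (forall k y, 0 <= g k y) ->
  radial_maximal delta (fun y => \sum_(0 <= k <oo) (c k)%:E * g k y) x <=
  \sum_(0 <= k <oo) (c k)%:E * radial_maximal delta (g k) x.
Proof.
move=> c0 mg g0; apply: nsup_le => i.
pose h k y := (c k)%:E * ((radial_bump delta (dyadic_scale i) (tsub x y))%:E * g k y).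
have b0 y : 0 <= (radial_bump delta (dyadic_scale i) (tsub x y))%:E :> \bar R.
  by rewrite lee_fin radial_bump_ge0// dyadic_scale_gt0.
have mh k : measurable_fun setT (fun y => (radial_bump delta (dyadic_scale i) (tsub x y))%:E * g k y).
  exact: measurable_radial_integrand.
have E y : (radial_bump delta (dyadic_scale i) (tsub x y))%:E * (\sum_(0 <= k <oo) (c k)%:E * g k y) =
    \sum_(0 <= k <oo) h k y.
  rewrite -nneseriesZl => [|k _]; last by rewrite mule_ge0// lee_fin.
  by apply: eq_eseriesr => k _; rewrite /h muleCA.
rewrite (eq_integral (fun y => \sum_(0 <= k <oo) h k y)); last by move=> y _; exact: E.
rewrite integral_nneseries//; last 2 first.
- by move=> k; exact: measurable_funeM.
- by move=> k y _; rewrite !mule_ge0// lee_fin.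
apply: lee_nneseries => [k _ _|k _].
  by apply: integral_ge0 => y _; rewrite !mule_ge0// lee_fin.
rewrite /h ge0_integralZl ?lee_fin//; last by move=> y _; rewrite mule_ge0.
rewrite lee_wpmul2l ?lee_fin//.
exact: (le_nsup (fun i => \int[mu]_y ((radial_bump delta (dyadic_scale i) (tsub x y))%:E * g k y)) i).
Qed.

Lemma mass_block_le s e x0 r (g h : Rn R N -> \bar R) : (0 <= s)%R ->
  mass_block s e x0 r g -> measurable_fun setT h -> (forall x, 0 <= h x) ->
  (forall x, h x <= g x) -> mass_block s e x0 r h.
Proof.
move=> s0 [r0 mg g0 gB gI] mh h0 hg; split => //.
- move=> x hx; apply: gB; apply: contra_neq hx => gx.
  by apply/eqP; rewrite eq_le h0 andbT -gx.
- apply: le_trans gI; apply: ge0_le_integral.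
  + exact: measurableT.
  + by move=> x _; exact: poweR_ge0.
  + exact: (measurableT_comp (measurable_poweR s)).
  + exact: (measurableT_comp (measurable_poweR s)).
  + by move=> x _; exact: poweR_le.
Qed.

Lemma normcD_le (z w : R[i]) : (Normc.normc (z + w) <= Normc.normc z + Normc.normc w)%R.
Proof.
have := ler_normD z w; rewrite !normc_def -!normcE_sqrt -rmorphD/= lecR.
exact.
Qed.

Lemma normc_sum_le (c : nat -> R[i]) (b : nat -> R[i]) M :
  (Normc.normc (\sum_(0 <= k < M) c k * b k) <=
   \sum_(0 <= k < M) Normc.normc (c k) * Normc.normc (b k))%R.
Proof.
elim: M => [|M ih]; first by rewrite !big_geq// Normc.normc0.
rewrite !big_nat_recr//=; apply: le_trans (normcD_le _ _) _.
by rewrite lerD// Normc.normcM.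
Qed.

Lemma cmeasurable_partial_sum (c : nat -> R[i]) (b : nat -> Rn R N -> R[i]) M :
  (forall k, cmeasurable (b k)) -> cmeasurable (fun x => \sum_(0 <= k < M) c k * b k x)%R.
Proof.
move=> mb; elim: M => [|M [ihR ihI]].
  by split; under eq_fun do rewrite big_geq//; exact: measurable_cst.
have [mR mI] := mb M.
split; under eq_fun do rewrite big_nat_recr//=.
  rewrite (_ : (fun x => _) = fun x => (complex.Re (\sum_(0 <= k < M) c k * b k x) +
     (complex.Re (c M) * complex.Re (b M x) - complex.Im (c M) * complex.Im (b M x)))%R).
    apply: measurable_funD => //; apply: measurable_funB; apply: measurable_funM => //; exact: measurable_cst.
  by apply/funext => x; case: (\sum_(0 <= k < M) _)%R => ? ?; case: (c M) => ? ?; case: (b M x).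
rewrite (_ : (fun x => _) = fun x => (complex.Im (\sum_(0 <= k < M) c k * b k x) +
     (complex.Re (c M) * complex.Im (b M x) + complex.Im (c M) * complex.Re (b M x)))%R).
  apply: measurable_funD => //; apply: measurable_funD; apply: measurable_funM => //; exact: measurable_cst.
by apply/funext => x; case: (\sum_(0 <= k < M) _)%R => ? ?; case: (c M) => ? ?; case: (b M x).
Qed.

Lemma Re_Im_cvg (S : nat -> R[i]) (z : R[i]) :
  (Normc.normc (S k - z) @[k --> \oo] --> (0 : R))%R ->
  (complex.Re (S k) @[k --> \oo] --> complex.Re z)%R /\
  (complex.Im (S k) @[k --> \oo] --> complex.Im z)%R.
Proof.
move=> H; split; apply/subr_cvg0.
  apply: norm_cvg0; apply: (squeeze_cvgr (f := cst 0%R) _ _ H); last exact: cvg_cst.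
  apply: nearW => k; rewrite normr_ge0/=; apply: le_trans (normr_Re_le _).
  by case: (S k) => ? ?; case: z {H}.
apply: norm_cvg0; apply: (squeeze_cvgr (f := cst 0%R) _ _ H); last exact: cvg_cst.
apply: nearW => k; rewrite normr_ge0/=; apply: le_trans (normr_Im_le _).
by case: (S k) => ? ?; case: z {H}.
Qed.

(** The partial sums are measurable and converge to [f] off a null Borel set
    [A]; let [f1] be [f] off [A] and zero on [A]. The bound passes to the limit
    in the triangle inequality. *)
Lemma block_sum_representative (f : Rn R N -> R[i]) (c : nat -> R[i])
    (b : nat -> Rn R N -> R[i]) : (forall k, cmeasurable (b k)) ->
  {ae mu, forall x, (Normc.normc (\sum_(0 <= k < M) c k * b k x - f x) @[M --> \oo]
          --> (0 : R))%R} ->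
  exists A f1, [/\ measurable A, mu A = 0, forall x, ~ A x -> f x = f1 x,
    cmeasurable f1 & forall x,
    modulus f1 x <= \sum_(0 <= k <oo) (Normc.normc (c k))%:E * modulus (b k) x].
Proof.
move=> mb [A [mA A0 Af]].
exists A, (fun x => if x \in A then 0%R else f x); split => //.
- by move=> x nAx; rewrite memNset.
- have cvgf x : ~ A x -> (Normc.normc (\sum_(0 <= k < M) c k * b k x - f x) @[M --> \oo]
          --> (0 : R))%R by move=> nAx; apply: contrapT => /Af.
  have mC : measurable (~` A) by exact: measurableC.
  have mS M := @cmeasurable_partial_sum c b M mb.
  split.
    apply: (@measurable_fun_cvg _ _ _ setT (fun M x => complex.Re (\sum_(0 <= k < M) c k * b k x) *
       \1_(~` A) x)%R).
      move=> M; apply: measurable_funM; first by case: (mS M).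
      by apply: measurable_indic.
    move=> x _; have [Ax|nAx] := pselect (A x).
      have nC : ~ (~` A) x by apply.
      rewrite mem_set//=; under eq_cvg do rewrite indicE (memNset nC) mulr0.
      exact: cvg_cst.
    rewrite memNset//; under eq_cvg do rewrite indicE mem_set// mulr1.
    exact: (Re_Im_cvg (cvgf _ nAx)).1.
  apply: (@measurable_fun_cvg _ _ _ setT (fun M x => complex.Im (\sum_(0 <= k < M) c k * b k x) *
     \1_(~` A) x)%R).
    move=> M; apply: measurable_funM; first by case: (mS M).
    by apply: measurable_indic.
  move=> x _; have [Ax|nAx] := pselect (A x).
    have nC : ~ (~` A) x by apply.
    rewrite mem_set//=; under eq_cvg do rewrite indicE (memNset nC) mulr0.
    exact: cvg_cst.
  rewrite memNset//; under eq_cvg do rewrite indicE mem_set// mulr1.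
  exact: (Re_Im_cvg (cvgf _ nAx)).2.
- move=> x; have F0 : 0 <= \sum_(0 <= k <oo) (Normc.normc (c k))%:E * modulus (b k) x.
    by apply: nneseries_ge0 => k _ _; rewrite mule_ge0// lee_fin normc_ge0.
  rewrite /modulus; case: ifPn => [_|/negP nAx]; first by rewrite Normc.normc0.
  have [cR cI] := Re_Im_cvg (contrapT (fun h => nAx (mem_set (Af _ h)))).
  have H := cvg_normc cR cI.
  have fE : (complex.Re (f x) +i* complex.Im (f x))%C = f x by case: (f x).
  rewrite fE in H.
  have H' : (Normc.normc (\sum_(0 <= k < M) c k * b k x)%R)%:E @[M --> \oo] -->
      (Normc.normc (f x))%:E by apply: cvg_EFin => //; exact: nearW.
  rewrite -(cvg_lim _ H')//; apply: lime_le; first by apply/cvg_ex; eexists; exact: H'.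
  apply: nearW => M; apply: le_trans (nneseries_lim_ge M _); last first.
    by move=> k _ _; rewrite mule_ge0// lee_fin normc_ge0.
  apply: (@le_trans _ _ (\sum_(0 <= k < M) Normc.normc (c k) * Normc.normc (b k x))%R%:E).
    by rewrite lee_fin; exact: normc_sum_le.
  by rewrite -sumEFin; apply: lee_sum => k _; rewrite EFinM.
Qed.

End superposition.

Section transfer.
Context {R : realType} {n : nat}.
Local Notation N := n.+1.
Local Notation mu := (lebesgueRn R N).
Variables (lam p s alpha : R).
Hypotheses (lam_gt : n%:R / 2 < lam) (s_gt1 : 1 < s) (p_gt0 : 0 < p).
Local Notation e := (@block_exponent R n p s alpha).
Hypotheses (e_le0 : e <= 0) (e_gt : - (1 - s^-1) < e).
Local Notation delta := (lam - n%:R / 2).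
Local Notation q := (pbar p).
Local Open Scope ereal_scope.

Let delta_gt0 : (0 < delta)%R. Proof. by rewrite subr_gt0. Qed.
Let s_gt0 : (0 < s)%R. Proof. exact: lt_trans ltr01 s_gt1. Qed.

Let q_gt0 : (0 < q)%R.
Proof. by rewrite /pbar lt_min p_gt0 ltr01. Qed.

Let q_le1 : (q <= 1)%R.
Proof. by rewrite /pbar ge_min lexx orbT. Qed.

Let z : R := @annular_rate R n s e.
Let z_gt0 : (0 < z)%R. Proof. exact: annular_rate_gt0. Qed.
Let z_lt1 : (z < 1)%R. Proof. exact: annular_rate_lt1. Qed.

Section decomposition.
Variables (C1 : R) (c : nat -> R) (x0 : nat -> Rn R N) (r : nat -> R)
  (g : nat -> Rn R N -> \bar R).
Hypotheses (C1_gt0 : (0 < C1)%R) (c_ge0 : forall k, (0 <= c k)%R).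
Hypothesis g_block : forall k, mass_block s e (x0 k) (r k) (g k).
Hypothesis annuli : forall k j,
  \int[mu]_x ((radial_maximal delta (g k) x * (\1_(annulus (x0 k) (r k) j) x)%:E) `^ s) <=
  ((C1 * z ^+ j) `^ s * vol (x0 k) (2 ^+ j.+1 * r k) `^ (e * s))%:E.

Definition layer_size j : R := (C1 * z ^+ j)%R.
Local Notation kap := layer_size.

(** The piece of the maximal function of [g k] on the [j]-th annulus,
    normalised so as to satisfy the size condition of a block. *)
Definition layer k j x : \bar R := (kap j)^-1%:E *
  (radial_maximal delta (g k) x * (\1_(annulus (x0 k) (r k) j) x)%:E).

Lemma layer_size_gt0 j : (0 < kap j)%R.
Proof. by rewrite mulr_gt0// exprn_gt0. Qed.

Let V0 k x : 0 <= radial_maximal delta (g k) x.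
Proof. by apply: radial_maximal_ge0; case: (g_block k). Qed.

Lemma layer_ge0 k j x : 0 <= layer k j x.
Proof. by rewrite !mule_ge0// lee_fin invr_ge0 ltW// layer_size_gt0. Qed.

Lemma layer_block k j : mass_block s e (x0 k) (2 ^+ j.+1 * r k) (layer k j).
Proof.
case: (g_block k) => [r0 mg g0 _ _].
have mV : measurable_fun setT (fun x =>
    radial_maximal delta (g k) x * (\1_(annulus (x0 k) (r k) j) x)%:E).
  apply: emeasurable_funM; first exact: measurable_radial_maximal.
  apply/measurable_EFinP; apply: measurable_indic; exact: measurable_annulus.
have ki0 : (0 <= (kap j)^-1)%R by rewrite invr_ge0 ltW// layer_size_gt0.
have VA0 x : 0 <= radial_maximal delta (g k) x * (\1_(annulus (x0 k) (r k) j) x)%:E.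
  by rewrite mule_ge0// lee_fin.
split.
- by rewrite mulr_gt0// exprn_gt0.
- exact: measurable_funeM.
- exact: layer_ge0.
- move=> x; have [[]//|nA] := pselect (annulus (x0 k) (r k) j x).
  by rewrite /layer indicE memNset// !mule0 eqxx.
- under eq_integral do rewrite /layer poweRM//.
  rewrite ge0_integralZl//; last 3 first.
  + exact: (measurableT_comp (measurable_poweR s)).
  + by move=> x _; exact: poweR_ge0.
  + exact: poweR_ge0.
  rewrite poweR_EFin; apply: (@le_trans _ _ (((kap j)^-1 `^ s)%:E *
      (kap j `^ s * vol (x0 k) (2 ^+ j.+1 * r k) `^ (e * s))%:E)).
    by rewrite lee_wpmul2l ?lee_fin ?powR_ge0//; exact: annuli.
  rewrite -EFinM lee_fin mulrA -powRM ?(ltW (layer_size_gt0 j))//.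
  by rewrite mulVf ?gt_eqF ?layer_size_gt0// powR1 mul1r.
Qed.

(** Every point lies in one of the annuli around each ball, so the pieces add
    up to at least the maximal functions they were cut from. *)
Lemma layers_dominate x :
  radial_maximal delta (fun y => \sum_(0 <= k <oo) (c k)%:E * g k y) x <=
  \sum_(0 <= k <oo) \sum_(0 <= j <oo) (c k * kap j)%:E * layer k j x.
Proof.
apply: le_trans.
  by apply: radial_maximal_series => // k; case: (g_block k).
apply: lee_nneseries => [k _ _|k _]; first by rewrite mule_ge0// lee_fin.
have [r0 _ _ _ _] := g_block k.
have [j xj] := annulus_cover (x0 k) x r0.
apply: le_trans (le_nneseries_term (u := fun j => (c k * kap j)%:E * layer k j x) j _).
  rewrite /layer indicE mem_set// mule1 muleA -EFinM.
  by rewrite mulfK// gt_eqF// layer_size_gt0.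
by move=> i; rewrite mule_ge0 ?layer_ge0// lee_fin mulr_ge0// ltW// layer_size_gt0.
Qed.

Lemma layer_coefs_summable : \sum_(0 <= k <oo) (c k)%:E < +oo ->
  \sum_(0 <= k <oo) \sum_(0 <= j <oo) (c k * kap j)%:E < +oo.
Proof.
move=> cs; apply: (@le_lt_trans _ _ (\sum_(0 <= k <oo) ((C1 / (1 - z))%:E * (c k)%:E))).
  apply: lee_nneseries => [k _ _|k _].
    apply: nneseries_ge0 => j _ _.
    by rewrite lee_fin mulr_ge0// ltW// layer_size_gt0.
  rewrite -EFinM (eq_eseriesr (g := fun j => (c k * C1 * z ^+ j)%:E)); last first.
    by move=> j _; rewrite /layer_size mulrA.
  have cC : (0 <= c k * C1)%R by rewrite mulr_ge0// ltW.
  apply: le_trans (geometric_nneseries_le cC (ltW z_gt0) z_lt1) _.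
  by rewrite lee_fin -mulrA mulrC.
rewrite nneseriesZl => [|k _]; last by rewrite lee_fin.
by rewrite lte_mul_pinfty// lee_fin divr_ge0 ?(ltW C1_gt0)// subr_ge0 ltW.
Qed.

(** For fixed [k] the powers of the coefficients form a geometric series of
    ratio [z `^ q]. *)
Lemma layer_coefs_powR (C0 : R) : (0 <= C0)%R ->
  \sum_(0 <= k <oo) \sum_(0 <= j <oo) ((C0 * (c k * kap j)) `^ q)%:E <=
  ((C0 * C1) `^ q / (1 - z `^ q))%:E * \sum_(0 <= k <oo) (c k `^ q)%:E.
Proof.
move=> C00; rewrite -nneseriesZl => [|k _]; last by rewrite lee_fin powR_ge0.
apply: lee_nneseries => [k _ _|k _].
  by apply: nneseries_ge0 => j _ _; rewrite lee_fin powR_ge0.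
have zq1 : (z `^ q < 1)%R.
  apply: (@lt_le_trans _ _ (1 `^ q)%R); last by rewrite powR1.
  by apply: gt0_ltr_powR; rewrite ?nnegrE// ltW.
rewrite (eq_eseriesr (g := fun j => ((C0 * C1) `^ q * c k `^ q * (z `^ q) ^+ j)%:E)); last first.
  move=> j _; congr EFin.
  have -> : ((z `^ q) ^+ j = (z ^+ j) `^ q)%R.
    by rewrite -powR_mulrn ?powR_ge0// -powRrM mulrC powRrM powR_mulrn// ltW.
  have C10 := ltW C1_gt0; have zj : (0 <= z ^+ j)%R by rewrite exprn_ge0// ltW.
  rewrite -!powRM ?mulr_ge0//; congr powR; rewrite /layer_size; ring.
apply: le_trans (geometric_nneseries_le _ _ zq1) _; rewrite ?mulr_ge0 ?powR_ge0//.
by rewrite -EFinM lee_fin mulrAC.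
Qed.

End decomposition.

(** An infinite value can only occur with coefficient zero, in which case both
    sides vanish. *)
Lemma fine_mul_of_finite (d : R) (y : \bar R) : (0 <= d)%R -> 0 <= y ->
  d%:E * y < +oo -> (d * fine y)%:E = d%:E * y.
Proof.
move=> d0; case: y => [y| |]//= _.
have [->|dn] := eqVneq d 0%R; first by rewrite mul0r mul0e.
by rewrite gt0_muley// lte_fin lt_neqAle eq_sym dn.
Qed.

(** The maximal function [M] of [f] is dominated by [C0 * G], with [G] the sum
    of the pieces weighted by their coefficients. Multiplying each piece by
    [tau], the ratio of [M] to [C0 * G], keeps its size and support conditions
    and makes the sum equal to [M]. *)
Theorem br_maximal_block_decomposition : exists2 K : R, (0 < K)%R &
  forall f c b, block_decomposition p s alpha f c b ->
  {ae mu, forall x, br_maximal lam f x < +oo} /\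
  exists c' b', block_decomposition p s alpha
    (fun x => (fine (br_maximal lam f x))%:C%C) c' b' /\
    block_coef_sum p c' <= K%:E * block_coef_sum p c.
Proof.
have [C1 C1_gt0 annul] := @annulus_estimate R n delta s e delta_gt0 s_gt1 e_le0 e_gt.
have [C0 C0_gt0 control] := br_maximal_controlled lam_gt.
have zq1 : (z `^ q < 1)%R.
  apply: (@lt_le_trans _ _ (1 `^ q)%R); last by rewrite powR1.
  by apply: gt0_ltr_powR; rewrite ?nnegrE// ltW.
exists ((C0 * C1) `^ q / (1 - z `^ q))%R.
  by rewrite divr_gt0 ?powR_gt0 ?mulr_gt0// subr_gt0.
move=> f c b [bb cs fb].
pose cc k : R := Normc.normc (c k).
have cc0 k : (0 <= cc k)%R by exact: normc_ge0.
have cc1 : \sum_(0 <= k <oo) (cc k)%:E < +oo by exact: (summable_of_powR q_gt0 q_le1).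
have /choice[xr bm] : forall k, exists xr : Rn R N * R,
    mass_block s e xr.1 xr.2 (modulus (b k)).
  move=> k; have [x0 [r H]] := mass_block_of_block s_gt1 (bb k).
  by exists (x0, r).
have mb k : cmeasurable (b k) by case: (bb k).
pose g k := modulus (b k).
have mg k : measurable_fun setT (g k) by case: (bm k).
have g0 k x : 0 <= g k x by exact: (mass_block_ge0 (bm k)).
pose F y := \sum_(0 <= k <oo) (cc k)%:E * g k y.
have F0 y : 0 <= F y by apply: nneseries_ge0 => k _ _; rewrite mule_ge0// lee_fin.
have mF : measurable_fun setT F.
  apply: ge0_emeasurable_sum => [k y _ _|k _]; first by rewrite mule_ge0// lee_fin.
  exact: measurable_funeM.
have [A [f1 [mA A0 ff1 mf1 f1F]]] := block_sum_representative mb fb.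
have [mM HM] := control f1 F mf1 mF F0 f1F.
have fM x : br_maximal lam f x = br_maximal lam f1 x.
  exact: (br_maximal_off_null lam x mA A0 ff1).
pose M x := rational_br_maximal lam f1 x.
pose x0 k := (xr k).1; pose r k := (xr k).2.
pose B := @layer C1 x0 r g.
have bmk k : mass_block s e (x0 k) (r k) (g k) by exact: bm.
have annk k j := annul (x0 k) (r k) (g k) j (bmk k).
have B0 k j x : 0 <= B k j x by exact: (@layer_ge0 C1 x0 r g C1_gt0 bmk).
have BB k j : mass_block s e (x0 k) (2 ^+ j.+1 * r k) (B k j).
  exact: (layer_block C1_gt0 bmk annk).
(* From here on a single index [m] enumerates the pieces [phi m = (k, j)]. *)
have [phi pairing_sum] := @nneseries_pairing R.
have kap0 j : (0 <= layer_size C1 j)%R by exact/ltW/layer_size_gt0.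
pose d m : R := (cc (phi m).1 * layer_size C1 (phi m).2)%R.
have d0 m : (0 <= d m)%R by rewrite mulr_ge0.
pose Bm m := B (phi m).1 (phi m).2.
have Bm0 m x : 0 <= Bm m x by exact: B0.
have Bmm m : measurable_fun setT (Bm m) by case: (BB (phi m).1 (phi m).2).
have ds : \sum_(0 <= m <oo) (d m)%:E < +oo.
  rewrite (pairing_sum (fun k j => (cc k * layer_size C1 j)%:E)).
    exact: layer_coefs_summable.
  by move=> k j; rewrite lee_fin mulr_ge0.
pose G x := \sum_(0 <= m <oo) (d m)%:E * Bm m x.
have G0 x : 0 <= G x by apply: nneseries_ge0 => m _ _; rewrite mule_ge0// lee_fin.
have mG : measurable_fun setT G.
  apply: ge0_emeasurable_sum => [m y _ _|m _]; first by rewrite mule_ge0// lee_fin.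
  exact: measurable_funeM.
have Goo : {ae mu, forall x, G x < +oo}.
  exact: (mass_block_summable s_gt1 e_le0 e_gt d0 ds (fun m => BB (phi m).1 (phi m).2)).
have FG x : radial_maximal delta F x <= G x.
  rewrite /G (pairing_sum (fun k j => (cc k * layer_size C1 j)%:E * B k j x)).
    exact: (layers_dominate C1_gt0 cc0 bmk).
  by move=> k j; rewrite mule_ge0// lee_fin mulr_ge0.
have good x : G x < +oo -> br_maximal lam f x = M x /\ M x <= C0%:E * G x.
  move=> Gx; have [] := HM x (le_lt_trans (FG x) Gx).
  rewrite fM => -> Mx; split => //; apply: le_trans Mx _.
  by rewrite lee_wpmul2l// lee_fin ltW.
have M0 x : 0 <= M x by apply: nsup_ge0 => i; rewrite lee_fin normc_ge0.
split.
  apply: (@filterS _ _ (ae_filter_ringOfSetsType mu) _ _ _ Goo) => x Gx.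
  have [-> MG] := good x Gx; apply: le_lt_trans MG _.
  by rewrite lte_mul_pinfty// lee_fin ltW.
(* The ratio of [M] to [C0 * G]. Where [G] vanishes so does [M], and the value
   of the negative power at zero is immaterial. The minimum makes [tau <= 1]
   evident at every point. *)
pose tau x : R := Num.min (fine (M x) * (C0 * fine (G x)) `^ (-1))%R 1%R.
have tau0 x : (0 <= tau x)%R.
  by rewrite /tau le_min ler01 andbT mulr_ge0 ?powR_ge0// fine_ge0.
have tau1 x : (tau x <= 1)%R by rewrite /tau ge_min lexx orbT.
have mtau : measurable_fun setT tau.
  apply: measurable_minr; last exact: measurable_cst.
  apply: measurable_funM; first exact: (measurableT_comp _ mM).
  apply: (measurableT_comp (measurable_powR (-1))).
  by apply: measurable_funM; [exact: measurable_cst|exact: measurableT_comp].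
have tauE x : G x < +oo -> fine (M x) = (C0 * (tau x * fine (G x)))%R.
  move=> Gx; have [_ MG] := good x Gx.
  have GE : G x = (fine (G x))%:E by rewrite fineK// ge0_fin_numE.
  have h0 : (0 <= fine (G x))%R by exact: fine_ge0.
  move: MG; rewrite GE -EFinM => MG.
  have {}MG : (fine (M x) <= C0 * fine (G x))%R.
    by rewrite -lee_fin fineK// ge0_fin_numE// (le_lt_trans MG) ?ltry.
  have m0 : (0 <= fine (M x))%R by exact: fine_ge0.
  have [hE|hn] := eqVneq (fine (G x)) 0%R.
    by rewrite hE !mulr0; apply/eqP; rewrite eq_le m0 andbT; move: MG; rewrite hE mulr0.
  have hp : (0 < C0 * fine (G x))%R by rewrite mulr_gt0// lt_neqAle eq_sym hn.
  have -> : tau x = (fine (M x) / (C0 * fine (G x)))%R.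
    rewrite /tau powR_inv1 ?(ltW hp)//; apply/min_idPl.
    by rewrite ler_pdivrMr// mul1r.
  by field; rewrite hn gt_eqF.
pose b' m x : R[i] := (tau x * fine (Bm m x))%:C%C.
pose c' m : R[i] := (C0 * d m)%:C%C.
have normr_C (t : R) : (0 <= t)%R -> Normc.normc t%:C%C = t.
  by move=> t0; rewrite normcE_sqrt/= expr0n/= addr0 sqrtr_sqr ger0_norm.
have coefE : block_coef_sum p c' =
    \sum_(0 <= k <oo) \sum_(0 <= j <oo) ((C0 * (cc k * layer_size C1 j)) `^ q)%:E.
  rewrite -(pairing_sum (fun k j => ((C0 * (cc k * layer_size C1 j)) `^ q)%:E)).
    apply: eq_eseriesr => m _; rewrite /c' normr_C//.
    exact: (mulr_ge0 (ltW C0_gt0) (d0 m)).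
  by move=> k j; rewrite lee_fin powR_ge0.
have coef_le : block_coef_sum p c' <=
    ((C0 * C1) `^ q / (1 - z `^ q))%:E * block_coef_sum p c.
  by rewrite coefE; exact: (layer_coefs_powR C1_gt0 cc0 (ltW C0_gt0)).
exists c', b'; split; last exact: coef_le.
split.
- move=> m; have mtB : measurable_fun setT (fun x => tau x * fine (Bm m x))%R.
    by apply: measurable_funM => //; exact: measurableT_comp.
  have tB0 x : (0 <= tau x * fine (Bm m x))%R by rewrite mulr_ge0// fine_ge0.
  apply: (@block_of_mass_block R n p s alpha s_gt1 _ _ _ _ (mass_block_le (ltW s_gt0) (BB (phi m).1 (phi m).2) _ _ _)).
  + by split => //; exact: measurable_cst.
  + by apply/measurable_EFinP; under eq_fun do rewrite normr_C//.
  + by move=> x; rewrite lee_fin normc_ge0.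
  + move=> x; rewrite /modulus normr_C// -/(Bm m).
    case: (Bm m x) (Bm0 m x) => [t| |]//= t0; last by rewrite leey.
    by rewrite lee_fin ler_piMl.
- apply: le_lt_trans coef_le _.
  by rewrite lte_mul_pinfty// lee_fin divr_ge0 ?powR_ge0// subr_ge0 ltW.
- apply: (@filterS _ _ (ae_filter_ringOfSetsType mu) _ _ _ Goo) => x Gx.
  have [-> _] := good x Gx; rewrite tauE//.
  have term m : (d m * fine (Bm m x))%:E = (d m)%:E * Bm m x.
    apply: fine_mul_of_finite => //; apply: le_lt_trans Gx.
    by apply: (le_nneseries_term (u := fun m => (d m)%:E * Bm m x)) => j; rewrite mule_ge0// lee_fin.
  have GE : G x = (fine (G x))%:E by rewrite fineK// ge0_fin_numE.
  have cvgG : (\sum_(0 <= m < L) d m * fine (Bm m x))%R @[L --> \oo] --> fine (G x).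
    have H : limn (fun L => \sum_(0 <= m < L) (d m)%:E * Bm m x) = G x by [].
    have cH : cvgn (fun L => \sum_(0 <= m < L) (d m)%:E * Bm m x).
      by apply: is_cvg_nneseries => m _ _; rewrite mule_ge0// lee_fin.
    have {}H : (fun L => \sum_(0 <= m < L) (d m)%:E * Bm m x) @ \oo --> (fine (G x))%:E.
      by rewrite -GE -H; exact: cH.
    have E : (fun L => \sum_(0 <= m < L) d m * fine (Bm m x))%R =
        fine \o (fun L => \sum_(0 <= m < L) (d m)%:E * Bm m x).
      apply/funext => L /=; rewrite [in RHS](eq_bigr (fun m => (d m * fine (Bm m x))%:E)).
        by rewrite sumEFin.
      by move=> m _; rewrite term.
    by rewrite E; exact: fine_cvg.
  have sumE L : (\sum_(0 <= m < L) c' m * b' m x =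
      (C0 * (tau x * \sum_(0 <= m < L) d m * fine (Bm m x)))%:C%C)%R.
    rewrite !mulr_sumr rmorph_sum/=; apply: eq_bigr => m _.
    by rewrite /c' /b' -rmorphM/=; congr (_%:C)%C; ring.
  have normB (u v : R) : (Normc.normc (u%:C%C - v%:C%C) = `|u - v|)%R.
    by rewrite normcE_sqrt/= subrr expr0n/= addr0 sqrtr_sqr.
  have H : ((fun L => `|C0 * (tau x * \sum_(0 <= m < L) d m * fine (Bm m x)) -
      C0 * (tau x * fine (G x))|) @ \oo --> (0 : R))%R.
    rewrite -[X in _ --> X](@normr0 _ R); apply: cvg_norm; apply/subr_cvg0.
    apply: cvgM; first exact: cvg_cst.
    by apply: cvgM; first exact: cvg_cst.
  by under eq_cvg do rewrite sumE normB.
Qed.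

End transfer.

Local Open Scope complex_scope.

Theorem theorem5p5 (R : realType) (n : nat) (lam s p alpha : R)
    (n_gt0 : (0 < n)%N)
    (lam_gt : (n%:R - 1) / 2 < lam)
    (s_gt1 : 1 < s)
    (p_gt0 : 0 < p) (p_le_s : p <= s)
    (alpha_ge : n%:R * (p / s - 1) <= alpha)
    (alpha_lt : alpha < n%:R * (p - 1)) :
  exists C : R, forall f : Rn R n -> R[i],
    in_BL p s alpha f ->
    {ae lebesgueRn R n, forall x, (br_maximal lam f x < +oo)%E} /\
    (BL_norm p s alpha (fun x => (fine (br_maximal lam f x))%:C) <=
     C%:E * BL_norm p s alpha f)%E.
Proof.
case: n => [//|n] in n_gt0 lam_gt alpha_ge alpha_lt *.
have lam_gt' : n%:R / 2 < lam by move: lam_gt; rewrite -[n.+1%:R]natr1 addrK.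
have s_gt0 : 0 < s by exact: lt_trans ltr01 s_gt1.
have N_gt0 : 0 < n.+1%:R :> R by [].
have pN : 0 < p * n.+1%:R by rewrite mulr_gt0.
have e_le0 : @block_exponent R n p s alpha <= 0.
  have : n.+1%:R * (p / s - 1) / (p * n.+1%:R) <= alpha / (p * n.+1%:R).
    by rewrite ler_wpM2r// invr_ge0 ltW.
  have -> : n.+1%:R * (p / s - 1) / (p * n.+1%:R) = s^-1 - p^-1.
    by field; rewrite !gt_eqF.
  rewrite /block_exponent; set X := alpha / _; set Y := s^-1; set Z := p^-1.
  by move: X Y Z => X Y Z; lra.
have e_gt : - (1 - s^-1) < @block_exponent R n p s alpha.
  have : alpha / (p * n.+1%:R) < n.+1%:R * (p - 1) / (p * n.+1%:R).
    by rewrite ltr_pM2r// invr_gt0.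
  have -> : n.+1%:R * (p - 1) / (p * n.+1%:R) = 1 - p^-1.
    by field; rewrite !gt_eqF.
  rewrite /block_exponent; set X := alpha / _; set Y := s^-1; set Z := p^-1.
  by move: X Y Z => X Y Z; lra.
have [K K_gt0 transfer] :=
  br_maximal_block_decomposition lam_gt' s_gt1 p_gt0 e_le0 e_gt.
exists (K `^ (pbar p)^-1) => f [c [b cb]]; split.
  by have [] := transfer f c b cb.
rewrite -lee_pdivrMl ?powR_gt0//; apply: le_ereal_inf_tmp => _ [c1 [b1 [cb1 ->]]].
rewrite lee_pdivrMl ?powR_gt0//.
have [_ [c' [b' [cb' coef_le]]]] := transfer f c1 b1 cb1.
have q0 : 0 <= (pbar p)^-1 by rewrite invr_ge0 /pbar le_min ler01 (ltW p_gt0).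
have S0 c2 : (0 <= block_coef_sum p c2 :> \bar R)%E.
  by apply: nneseries_ge0 => k _ _; rewrite lee_fin powR_ge0.
apply: (@le_trans _ _ (block_coef_sum p c' `^ (pbar p)^-1)%E).
  by apply: ereal_inf_lbound; exists c', b'.
apply: (le_trans (poweR_le q0 (S0 c') coef_le)).
by rewrite poweRM ?lee_fin ?(ltW K_gt0)// poweR_EFin.
Qed.
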